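(* The functors $Min_{\bullet}\colon {}_c\mathbf{FrobSem}(\mathbb{Hilb})\to\mathbf{WSet}_{\bullet}^{\mathsf{op}}$ and $\ell^2_{\bullet}\colon\mathbf{WSet}_{\bullet}^{\mathsf{op}}\to{}_c\mathbf{FrobSem}(\mathbb{Hilb})$ form an adjunction $Min_{\bullet}\dashv\ell^2_{\bullet}$ ($Min_\bullet$ being the left adjoint), which restricts to an adjoint equivalence $\mathbf{WSet}_{\bullet}^{\mathsf{op}}\simeq{}_{\mathsf{semisimple},c}\mathbf{FrobSem}(\mathbb{Hilb})$. In particular, ${}_{\mathsf{semisimple},c}\mathbf{FrobSem}(\mathbb{FdHilb})\simeq\mathbf{FinSet}_{\bullet}^{\mathsf{op}}$, where $\mathbf{FinSet}_{\bullet}$ is the category of finite pointed sets and base-point preserving maps.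
   Context: All Hilbert spaces are complex; $\hat{\otimes}_2$ is the Hilbert space tensor product; $f^{\dagger}$ is the Hilbert adjoint. A Hilbertian semigroup is a pair $(H,\mu)$ with $H$ a Hilbert space and $\mu\colon H\hat{\otimes}_2H\to H$ bounded linear, associative and commutative (no unit assumed); write $xy:=\mu(x\otimes y)$. With $\alpha\colon (H\hat{\otimes}_2H)\hat{\otimes}_2H\to H\hat{\otimes}_2(H\hat{\otimes}_2H)$ the canonical unitary, it is Frobenius when $(\mu\hat{\otimes}_2 id)\circ\alpha^{-1}\circ(id\hat{\otimes}_2\mu^{\dagger})=\mu^{\dagger}\circ\mu=(id\hat{\otimes}_2\mu)\circ\alpha\circ(\mu^{\dagger}\hat{\otimes}_2 id)$. ${}_c\mathbf{FrobSem}(\mathbb{Hilb})$ is the category of Hilbertian Frobenius semigroups with morphisms the bounded linear maps $f$ such that $f(uv)=f(u)f(v)$. An ideal of $(H,\mu)$ is an ideal of the commutative Banach algebra $H$ with product $(x,y)\mapsto xy$, and $J(H,\mu)$ is the Jacobson radical of this Banach algebra (intersection of the maximal modular ideals); $(H,\mu)$ is semisimple when $J(H,\mu)=(0)$. ${}_{\mathsf{semisimple},c}\mathbf{FrobSem}(\mathbb{Hilb})$ is the full subcategory of semisimple objects, and ${}_{\mathsf{semisimple},c}\mathbf{FrobSem}(\mathbb{FdHilb})$ the full subcategory of semisimple objects on finite-dimensional Hilbert spaces. $G(H,\mu):=\{x\in H\setminus\{0\}\colon\mu^{\dagger}(x)=x\otimes x\}$ is the set of group-like elements. $\mathbf{WSet}_{\bullet}$: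 objects are pointed sets with a weight function $(X,x_0,\alpha)$, $\alpha\colon X\setminus\{x_0\}\to[C_{\alpha},+\infty[$ for some $C_{\alpha}>0$; a morphism $(X,x_0,\alpha)\to(Y,y_0,\beta)$ is a base-point preserving map $f$ such that $f^{-1}(\{y\})$ is finite for each $y\neq y_0$ and there is a real $M_f\geq0$ with $\sum_{x\in f^{-1}(\{y\})}\alpha(x)\leq M_f\beta(y)$ for all $y\neq y_0$. Functor $Min_{\bullet}$: let $Min(H,\mu)$ be the set of all minimal ideals of $(H,\mu)$. The paper asserts that each minimal ideal $I$ is of the form $I=\mathbb{C}g$ for a unique group-like element $g$, denoted $g(I)$, and that $I\mapsto g(I)$ is a bijection from $Min(H,\mu)$ onto $G(H,\mu)$; one also sets $g(0):=0$. Then $Min_{\bullet}(H,\mu):=(Min(H,\mu)\cup\{0\},0,w_{(H,\mu)})$ with $w_{(H,\mu)}\colon Min(H,\mu)\to[b(H,\mu)^{-2},+\infty[$, $w_{(H,\mu)}(I):=1/\|g(I)\|^2$, where $b(H,\mu)$ is the operator norm of $\mu$ if $\mu\neq0$, and $b(H,\mu):=1$ if $\mu=0$. For $f\colon(H,\mu)\to(K,\gamma)$ one has $f^{\dagger}(G(K,\gamma))\subseteq G(H,\mu)\cup\{0\}$, and $Min_{\bullet}(f)\colon Min_{\bullet}(K,\gamma)\to Min_{\bullet}(H,\mu)$ is $I\mapsto\mathbb{C}f^{\dagger}(g(I))$ (so $0\mapsto0$). Functor $\ell^2_{\bullet}$: $\ell^2_{\bullet}(X,x_0,\alpha)$ is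 the Hilbert space of functions $u\colon X\to\mathbb{C}$ with $u(x_0)=0$ and $\sum_{x\neq x_0}\alpha(x)|u(x)|^2<+\infty$, with inner product $\langle u,v\rangle_{\alpha}=\sum_{x\neq x_0}\alpha(x)u(x)\overline{v(x)}$ and pointwise multiplication; for a $\mathbf{WSet}_{\bullet}$-morphism $f\colon(X,x_0,\alpha)\to(Y,y_0,\beta)$, $\ell^2_{\bullet}(f)\colon\ell^2_{\bullet}(Y,y_0,\beta)\to\ell^2_{\bullet}(X,x_0,\alpha)$ is $u\mapsto u\circ f$.
   Formalization: Min(H,μ) is taken to be the minimal ideals not contained in the Jacobson radical: for μ=0 on ℂ, H is a minimal ideal with no group-like element, so g(I) is undefined; for semisimple H nothing is excluded. *)

(* Defs.v *)
From HB Require Import structures.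
From mathcomp Require Import all_boot all_order all_algebra.
From mathcomp Require Import complex.
From mathcomp Require Import all_classical all_reals all_analysis.
From mathcomp Require Import ring lra.

Set Implicit Arguments.
Unset Strict Implicit.
Unset Printing Implicit Defensive.

Import Order.TTheory GRing.Theory Num.Theory.
Import numFieldNormedType.Exports.
Import Normc.

Local Open Scope classical_set_scope.
Local Open Scope ring_scope.
Local Open Scope complex_scope.

(* Fixed conventions: the complex numbers are R[i] for an arbitrary
   R : realType, inner products are linear in the first argument, a "set" is a
   choiceType, and sums over an infinite index set are unordered sums, based
   on esum. *)

Section csum.
Context {R : realType} {I : choiceType}.
Implicit Types (f g : I -> R).

Definition absum f := (\esum_(x in [set: I]) `|f x|%:E < +oo)%E.

(* The sum of an absolutely summable real family (junk otherwise). *)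
Definition rsum f : R :=
  fine (\esum_(x in [set: I]) (Num.max (f x) 0)%:E)
  - fine (\esum_(x in [set: I]) (Num.max (- f x) 0)%:E).

Lemma posnegB (a : R) : Num.max a 0 - Num.max (- a) 0 = a.
Proof. by have [a0|a0] := leP a 0; have [b0|b0] := leP (- a) 0; lra. Qed.

Lemma le_esumR f g : (forall x, f x <= g x) ->
  (\esum_(x in [set: I]) (f x)%:E <= \esum_(x in [set: I]) (g x)%:E)%E.
Proof. by move=> fg; apply: le_esum => x _; rewrite lee_fin. Qed.

Lemma absum_le f g : (forall x, `|f x| <= g x) ->
  (\esum_(x in [set: I]) (g x)%:E < +oo)%E -> absum f.
Proof. by move=> fg; apply: le_lt_trans; exact: le_esumR. Qed.

Lemma esum_fin f : (forall x, 0 <= f x) -> absum f ->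
  (\esum_(x in [set: I]) (f x)%:E)%E \is a fin_num.
Proof.
move=> f0 fs; rewrite ge0_fin_numE; last by apply: esum_ge0 => x _; rewrite lee_fin.
by apply: le_lt_trans fs; apply: le_esumR => x; exact: ler_norm.
Qed.

Lemma rsumE f g h : (forall x, 0 <= g x) -> (forall x, 0 <= h x) ->
  absum g -> absum h -> (forall x, f x = g x - h x) ->
  rsum f = fine (\esum_(x in [set: I]) (g x)%:E) - fine (\esum_(x in [set: I]) (h x)%:E).
Proof.
move=> g0 h0 gs hs fE; rewrite /rsum.
have fs : absum f.
  have : (\esum_(x in [set: I]) (`|g x| + `|h x|)%:E < +oo)%E.
    under eq_esum do rewrite EFinD.
    by rewrite esumD; [exact: lte_add_pinfty|move=> *; rewrite lee_fin..].
  by apply: absum_le => x; rewrite fE; exact: ler_normB.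
set p := (fun x => Num.max (f x) 0); set n := (fun x => Num.max (- f x) 0).
have p0 x : 0 <= p x by rewrite /p le_max lexx orbT.
have n0 x : 0 <= n x by rewrite /n le_max lexx orbT.
have ps : absum p.
  apply: absum_le fs => x; rewrite ger0_norm// /p ge_max normr_ge0 andbT; exact: ler_norm.
have ns : absum n.
  by apply: absum_le fs => x; rewrite ger0_norm// /n ge_max normr_ge0 andbT -normrN; exact: ler_norm.
apply/eqP; rewrite subr_eq addrAC eq_sym subr_eq -!fineD ?esum_fin//.
rewrite -!esumD => [|x _|x _|x _|x _]; rewrite ?lee_fin ?p0 ?n0//.
apply/eqP; congr fine; apply: eq_esum => x _; rewrite -!EFinD; congr EFin.
rewrite /n fE; have := posnegB (g x - h x).
by move: (Num.max _ _) (Num.max _ _) => a b; lra.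
Qed.

Lemma rsumD f g : absum f -> absum g -> rsum (fun x => f x + g x) = rsum f + rsum g.
Proof.
move=> fs gs.
pose p (f : I -> R) x := Num.max (f x) 0; pose n (f : I -> R) x := Num.max (- f x) 0.
have p0 k x : 0 <= p k x by rewrite /p le_max lexx orbT.
have n0 k x : 0 <= n k x by rewrite /n le_max lexx orbT.
have ps k : absum k -> absum (p k).
  by move=> ks; apply: absum_le ks => x; rewrite ger0_norm// /p ge_max normr_ge0 andbT; exact: ler_norm.
have ns k : absum k -> absum (n k).
  by move=> ks; apply: absum_le ks => x; rewrite ger0_norm// /n ge_max normr_ge0 andbT -normrN; exact: ler_norm.
have sD (h k : I -> R) : (forall x, 0 <= h x) -> (forall x, 0 <= k x) ->
    absum h -> absum k -> absum (fun x => h x + k x).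
  move=> h0 k0 hs ks; rewrite /absum.
  under eq_esum do rewrite ger0_norm ?addr_ge0// EFinD.
  rewrite esumD; try by move=> *; rewrite lee_fin.
  by apply: lte_add_pinfty; rewrite ltey_eq esum_fin.
rewrite (@rsumE _ (fun x => p f x + p g x) (fun x => n f x + n g x)).
- under eq_esum do rewrite EFinD.
  rewrite esumD; try by move=> *; rewrite lee_fin.
  under [X in _ - fine X]eq_esum do rewrite EFinD.
  rewrite esumD; try by move=> *; rewrite lee_fin.
  by rewrite !fineD ?esum_fin; auto; rewrite /rsum /p/n; ring.
- by move=> x; rewrite addr_ge0.
- by move=> x; rewrite addr_ge0.
- by apply: sD => //; auto.
- by apply: sD => //; auto.
- by move=> x; rewrite -[in LHS](posnegB (f x)) -[in LHS](posnegB (g x)) /p /n; ring.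
Qed.

Lemma absumD f g : absum f -> absum g -> absum (fun x => f x + g x).
Proof.
move=> fs gs; apply: (@absum_le _ (fun x => `|f x| + `|g x|)) => [x|].
  exact: ler_normD.
under eq_esum do rewrite EFinD.
by rewrite esumD; [exact: lte_add_pinfty|move=> *; rewrite lee_fin..].
Qed.

Lemma esumZ (D : set I) (c : R) f : 0 <= c ->
  (\esum_(x in D) (c * f x)%:E = c%:E * \esum_(x in D) (f x)%:E)%E.
Proof.
move=> c0; rewrite /esum -ereal_supZl//; last first.
  by apply/set0P; exists (\sum_(x \in set0) (f x)%:E)%E; exists set0 => //; exact: fsets_set0.
rewrite image_comp; congr ereal_sup; apply: eq_imagel => A [finA _] /=.
by rewrite !fsumEFin// -EFinM mulr_fsumr.
Qed.

Lemma absumZ (c : R) f : absum f -> absum (fun x => c * f x).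
Proof.
rewrite /absum => fs.
under eq_esum do rewrite normrM.
by rewrite esumZ// lte_mul_pinfty// lee_fin.
Qed.

Lemma rsumZ (c : R) f : absum f -> rsum (fun x => c * f x) = c * rsum f.
Proof.
move=> fs.
pose p x := Num.max (f x) 0; pose n x := Num.max (- f x) 0.
have p0 x : 0 <= p x by rewrite /p le_max lexx orbT.
have n0 x : 0 <= n x by rewrite /n le_max lexx orbT.
have ps : absum p.
  by apply: absum_le fs => x; rewrite ger0_norm// /p ge_max normr_ge0 andbT; exact: ler_norm.
have ns : absum n.
  by apply: absum_le fs => x; rewrite ger0_norm// /n ge_max normr_ge0 andbT -normrN; exact: ler_norm.
have [c0|c0] := leP 0 c.
  rewrite (@rsumE _ (fun x => c * p x) (fun x => c * n x)); try exact: absumZ.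
  - by rewrite !esumZ// !fineM// ?esum_fin// /rsum mulrBr.
  - by move=> x; rewrite mulr_ge0.
  - by move=> x; rewrite mulr_ge0.
  - by move=> x; rewrite -mulrBr /p /n posnegB.
have c0' : 0 <= - c by rewrite oppr_ge0 ltW.
rewrite (@rsumE _ (fun x => - c * n x) (fun x => - c * p x)); try exact: absumZ.
- rewrite !esumZ// !fineM// ?esum_fin//=; rewrite /rsum -/p -/n; by move: (fine _) (fine _) => a b; ring.
- by move=> x; rewrite mulr_ge0.
- by move=> x; rewrite mulr_ge0.
- by move=> x; rewrite -[in LHS](posnegB (f x)) /p /n; ring.
Qed.

Lemma rsum_ge0E f : (forall x, 0 <= f x) -> rsum f = fine (\esum_(x in [set: I]) (f x)%:E).
Proof.
move=> f0; rewrite /rsum [X in _ - fine X]esum1 ?subr0 => [|x _]; last first.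
  by rewrite max_r// oppr_le0.
by congr fine; apply: eq_esum => x _; rewrite max_l.
Qed.

End csum.

Section l2.
Context {R : realType} {I : choiceType} (w : I -> R).
Implicit Types u v : I -> R[i].

Definition l2_term u x : R := w x * normc (u x) ^+ 2.

(* Weighted square-summable functions supported on the set where w is positive;
   the support condition makes the weighted norm definite whatever w is. *)
Definition l2_pred u : Prop :=
  (forall x, ~~ (0 < w x) -> u x = 0) /\
  (\esum_(x in [set: I]) (l2_term u x)%:E < +oo)%E.

Definition l2_mem : {pred I -> R[i]} := [pred u | `[< l2_pred u >]].

Record l2 := L2 { l2_fun :> I -> R[i]; l2P : l2_fun \in l2_mem }.

HB.instance Definition _ := [isSub for l2_fun].
HB.instance Definition _ := [Choice of l2 by <:].

Lemma normc2 (z : R[i]) : normc z ^+ 2 = complex.Re z ^+ 2 + complex.Im z ^+ 2.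
Proof. by case: z => a b /=; rewrite sqr_sqrtr// addr_ge0 ?sqr_ge0. Qed.

Lemma l2_term_ge0 u : (forall x, ~~ (0 < w x) -> u x = 0) -> forall x, 0 <= l2_term u x.
Proof.
move=> u0 x; rewrite /l2_term; have [w0|w0] := ltP 0 (w x).
  by rewrite mulr_ge0 ?sqr_ge0// ltW.
by rewrite u0 -?leNgt// normc0 expr0n mulr0.
Qed.

Lemma l2_term_absum u : l2_pred u -> absum (l2_term u).
Proof.
move=> [u0 us]; rewrite /absum; under eq_esum do rewrite ger0_norm ?l2_term_ge0//.
by [].
Qed.

Lemma l2_submod_closed : submod_closed l2_mem.
Proof.
split=> [|a u v]; rewrite !unfold_in.
  apply: asboolT; split=> //; rewrite esum1// => x _.
  by rewrite /l2_term [X in normc X](_ : _ = 0)// normc0 expr0n mulr0.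
move=> /asboolP[u0 us] /asboolP[v0 vs]; apply: asboolT.
have z0 x : ~~ (0 < w x) -> (a *: u + v) x = 0.
  by move=> wx; rewrite !fctE u0// v0// scaler0 addr0.
split=> //.
have le x : l2_term (a *: u + v) x <= (2 * normc a ^+ 2) * l2_term u x + 2 * l2_term v x.
  rewrite /l2_term; have [w0|w0] := ltP 0 (w x); last first.
    by rewrite z0 ?u0 ?v0 -?leNgt// normc0 expr0n !mulr0 addr0.
  rewrite [leRHS](_ : _ = w x * (2 * (normc a * normc (u x)) ^+ 2 +
    2 * normc (v x) ^+ 2)); last by ring.
  rewrite ler_pM2l// -normcM -[_ *: _ + _]/(fun y => a * u y + v y) /=.
  rewrite !normc2; move: (a * u x) (v x) => [p q] [r s] /=.
  rewrite -subr_ge0.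
  rewrite [X in _ <= X](_ : _ = (p - r) ^+ 2 + (q - s) ^+ 2); last by ring.
  by rewrite addr_ge0 ?sqr_ge0.
apply: le_lt_trans (le_esumR le) _.
under eq_esum do rewrite EFinD.
have n2 : 0 <= 2 * normc a ^+ 2 by rewrite mulr_ge0 ?sqr_ge0.
rewrite esumD; last 2 first.
- by move=> x _; rewrite lee_fin mulr_ge0 ?l2_term_ge0.
- by move=> x _; rewrite lee_fin mulr_ge0 ?l2_term_ge0.
by rewrite !esumZ// lte_add_pinfty// lte_mul_pinfty// lee_fin.
Qed.

HB.instance Definition _ := GRing.isSubmodClosed.Build _ _ l2_mem l2_submod_closed.
HB.instance Definition _ := [SubChoice_isSubLmodule of l2 by <:].

Implicit Types f g h : l2.

Lemma l2_suppE f x : ~~ (0 < w x) -> f x = 0.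
Proof. by case: f => u /= /asboolP[+ _]; exact. Qed.

Lemma l2_fin f : absum (l2_term f).
Proof. by apply: l2_term_absum; case: f => u /= /asboolP. Qed.

Lemma l2D f g x : (f + g) x = f x + g x. Proof. by []. Qed.
Lemma l2N f x : (- f) x = - f x. Proof. by []. Qed.
Lemma l2B f g x : (f - g) x = f x - g x. Proof. by []. Qed.
Lemma l2Z (a : R[i]) f x : (a *: f) x = a * f x. Proof. by []. Qed.

Definition l2_sq f : R := fine (\esum_(x in [set: I]) (l2_term f x)%:E).

Lemma l2_sqE f : (l2_sq f)%:E = (\esum_(x in [set: I]) (l2_term f x)%:E)%E.
Proof. by rewrite /l2_sq fineK// esum_fin//; [apply: l2_term_ge0; exact: l2_suppE|exact: l2_fin]. Qed.

Lemma l2_tge0 f x : 0 <= l2_term f x. Proof. by apply: l2_term_ge0; exact: l2_suppE. Qed.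

Lemma l2_sq_ge0 f : 0 <= l2_sq f.
Proof. by rewrite /l2_sq fine_ge0// esum_ge0// => x _; rewrite lee_fin l2_tge0. Qed.

Lemma l2_le_sq f x : l2_term f x <= l2_sq f.
Proof.
rewrite -lee_fin l2_sqE; apply: esum_ge; exists [set x].
  by split=> //; exact: finite_set1.
by rewrite fsbig_set1.
Qed.

Lemma l2_sq_eq0 f : l2_sq f = 0 -> f = 0.
Proof.
move=> f0; apply: val_inj; apply/funext => x /=.
have [w0|w0] := ltP 0 (w x); last by rewrite l2_suppE// -leNgt.
have := l2_le_sq f x; rewrite f0 /l2_term pmulr_rle0// => n0.
by apply: eq0_normc; apply/eqP; rewrite -sqrf_eq0 eq_le n0 sqr_ge0.
Qed.

Lemma l2_sqZ a f : l2_sq (a *: f) = normc a ^+ 2 * l2_sq f.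
Proof.
apply: EFin_inj; rewrite EFinM !l2_sqE -esumZ ?sqr_ge0//.
apply: eq_esum => x _; congr EFin.
by rewrite /l2_term l2Z normcM exprMn; ring.
Qed.

Lemma l2_sqD_le f g (a b : R) : 0 < a -> 0 < b ->
  l2_sq (f + g) <= (a + b) / a * l2_sq f + (a + b) / b * l2_sq g.
Proof.
move=> a0 b0; rewrite -lee_fin EFinD !EFinM !l2_sqE.
have c0 : 0 <= (a + b) / a by rewrite divr_ge0// ltW// addr_gt0.
have d0 : 0 <= (a + b) / b by rewrite divr_ge0// ltW// addr_gt0.
rewrite -!esumZ// -esumD; last 2 first.
- by move=> x _; rewrite lee_fin mulr_ge0 ?l2_tge0.
- by move=> x _; rewrite lee_fin mulr_ge0 ?l2_tge0.
under [leRHS]eq_esum do rewrite -EFinD.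
apply: le_esumR => x; rewrite /l2_term l2D.
have [w0|w0] := ltP 0 (w x); last first.
  by rewrite !l2_suppE -?leNgt// addr0 normc0 expr0n !mulr0 addr0.
rewrite ![_ / _ * (w x * _)]mulrCA -mulrDr ler_pM2l//.
rewrite !normc2; move: (f x) (g x) => [p q] [r s] /=.
rewrite -subr_ge0.
rewrite [X in _ <= X](_ : _ =
  ((b * p - a * r) ^+ 2 + (b * q - a * s) ^+ 2) / (a * b)).
  by rewrite divr_ge0 ?addr_ge0 ?sqr_ge0// mulr_ge0// ltW.
by field; rewrite !gt_eqF.
Qed.

Definition l2_norm f : R[i] := (Num.sqrt (l2_sq f))%:C.

Lemma l2_normD f g : l2_norm (f + g) <= l2_norm f + l2_norm g.
Proof.
rewrite /l2_norm -rmorphD lecR.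
have := l2_sq_ge0 f; rewrite le_eqVlt => /predU1P[/esym f0|f0].
  by rewrite (l2_sq_eq0 f0) add0r lerDr sqrtr_ge0.
have := l2_sq_ge0 g; rewrite le_eqVlt => /predU1P[/esym g0|g0].
  by rewrite (l2_sq_eq0 g0) addr0 lerDl sqrtr_ge0.
have sf : 0 < Num.sqrt (l2_sq f) by rewrite sqrtr_gt0.
have sg : 0 < Num.sqrt (l2_sq g) by rewrite sqrtr_gt0.
rewrite -ler_sqr ?nnegrE ?addr_ge0 ?sqrtr_ge0// sqr_sqrtr ?l2_sq_ge0//.
apply: le_trans (l2_sqD_le f g sf sg) _.
have ea : l2_sq f = Num.sqrt (l2_sq f) ^+ 2 by rewrite sqr_sqrtr ?l2_sq_ge0.
have eb : l2_sq g = Num.sqrt (l2_sq g) ^+ 2 by rewrite sqr_sqrtr ?l2_sq_ge0.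
move: sf sg ea eb; move: (Num.sqrt _) (Num.sqrt _) => a b a0 b0 -> ->.
by rewrite le_eqVlt; apply/orP; left; apply/eqP; field; rewrite !gt_eqF.
Qed.

Lemma l2_normZ a f : l2_norm (a *: f) = `|a| * l2_norm f.
Proof.
rewrite /l2_norm l2_sqZ sqrtrM ?sqr_ge0// sqrtr_sqr ger0_norm ?rmorphM//.
by case: a => x y; rewrite /= sqrtr_ge0.
Qed.

Lemma l2_norm0_eq0 f : l2_norm f = 0 -> f = 0.
Proof.
move=> /complexI/eqP; rewrite sqrtr_eq0 => f0; apply: l2_sq_eq0.
by apply/eqP; rewrite eq_le f0 l2_sq_ge0.
Qed.

HB.instance Definition _ :=
  Lmodule_isNormed.Build R[i] l2 l2_normD l2_normZ l2_norm0_eq0.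

Lemma l2_ballE f g (e : R) : 0 < e -> ball f e%:C g <-> l2_sq (f - g) < e ^+ 2.
Proof.
move=> e0; rewrite -ball_normE /ball_/= -[`|f - g|]/(l2_norm (f - g)) ltcR.
by rewrite -[in X in _ <-> X](sqr_sqrtr (l2_sq_ge0 (f - g))) ltr_sqr ?nnegrE ?sqrtr_ge0// ltW.
Qed.

Lemma l2_complete (F : set_system l2) : ProperFilter F -> cauchy F -> cvg F.
Proof.
move=> FF Fc.
have Fball (e : R) : 0 < e -> exists v : l2, F [set f | l2_sq (v - f) < e ^+ 2].
  move=> e0; have /(cauchyP F)/(_ e%:C) := Fc; rewrite ltcR => /(_ e0)[v Fv].
  by exists v; apply: filterS Fv => f /(l2_ballE _ _ e0).
have coord (p : R[i] -> R) x :
    (forall a b, p (a - b) = p a - p b) -> (forall a, p a ^+ 2 <= normc a ^+ 2) ->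
    cvg ((fun f : l2 => p (f x)) @ F).
  move=> pB pn; have [w0|w0] := ltP 0 (w x); last first.
    apply/cvg_ex; exists (p 0); rewrite [X in X @ _](_ : _ = fun=> p 0); first exact: cvg_cst.
    by apply/funext => f; rewrite l2_suppE// -leNgt.
  apply: cauchy_cvg; apply/cauchyP => e e0.
  have s0 : 0 < Num.sqrt (w x) * e by rewrite mulr_gt0 ?sqrtr_gt0.
  have [v Fv] := Fball _ s0; exists (p (v x)).
  change (F [set f : l2 | ball (p (v x)) e (p (f x))]).
  apply: filterS Fv => f /= vf; rewrite -ball_normE /ball_/=.
  rewrite -ltr_sqr ?nnegrE//; last exact: ltW.
  rewrite -normrX ger0_norm ?sqr_ge0// -pB.
  apply: le_lt_trans (pn _) _; rewrite -(ltr_pM2l w0).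
  apply: le_lt_trans (l2_le_sq (v - f) x) _; apply: lt_le_trans vf _.
  by rewrite exprMn sqr_sqrtr// ltW.
have cRe x : cvg ((fun f : l2 => complex.Re (f x)) @ F).
  apply: (coord (@complex.Re R)) => [[a b] [c d]//|a].
  by rewrite normc2 lerDl sqr_ge0.
have cIm x : cvg ((fun f : l2 => complex.Im (f x)) @ F).
  apply: (coord (@complex.Im R)) => [[a b] [c d]//|a].
  by rewrite normc2 lerDr sqr_ge0.
pose L x := lim ((fun f : l2 => complex.Re (f x)) @ F) +i*
            lim ((fun f : l2 => complex.Im (f x)) @ F).
have L0 x : ~~ (0 < w x) -> L x = 0.
  move=> wx; have fx0 (f : l2) : f x = 0 by rewrite l2_suppE.
  rewrite /L; under eq_fun do rewrite fx0; under [X in _ +i* lim (X @ _)]eq_fun do rewrite fx0.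
  by rewrite !lim_cst.
have bnd (v : l2) (e : R) : 0 < e -> F [set f | l2_sq (v - f) < e ^+ 2] ->
    (\esum_(x in [set: I]) (l2_term (fun x => (v : I -> R[i]) x - L x) x)%:E <= (e ^+ 2)%:E)%E.
  move=> e0 Fv; apply: ge_ereal_sup => _ [A [finA _] <-].
  rewrite fsumEFin// lee_fin.
  have cA : (fun f : l2 => \sum_(x \in A) l2_term (v - f) x) @ F -->
      \sum_(x \in A) l2_term (fun x => (v : I -> R[i]) x - L x) x.
    rewrite fsbig_finite//=.
    have -> : (fun f : l2 => \sum_(x \in A) l2_term (v - f) x) =
        (fun f : l2 => \sum_(x <- finmap.enum_fset (fset_set A)) l2_term (v - f) x).
      by apply/funext => f; rewrite fsbig_finite.
    elim: (finmap.enum_fset (fset_set A)) => [|x s IH].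
      rewrite big_nil [X in X @ _](_ : _ = fun=> 0); first exact: cvg_cst.
      by apply/funext => f; rewrite big_nil.
    rewrite big_cons [X in X @ _](_ : _ = fun f : l2 => l2_term (v - f) x +
      \sum_(x <- s) l2_term (v - f) x); last first.
      by apply/funext => f; rewrite big_cons.
    apply: cvgD => //; rewrite /l2_term; apply: cvgM; first exact: cvg_cst.
    under eq_fun do rewrite normc2 l2B; rewrite normc2.
    case: (v x) => a b; rewrite /L /=.
    have -> : (fun f : l2 => complex.Re ((a +i* b) - f x) ^+ 2 + complex.Im ((a +i* b) - f x) ^+ 2)
      = (fun f : l2 => (a - complex.Re (f x)) * (a - complex.Re (f x)) +
           (b - complex.Im (f x)) * (b - complex.Im (f x))).
      by apply/funext => f; case: (f x) => c d /=; rewrite !expr2.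
    rewrite !expr2; apply: cvgD; apply: cvgM; apply: cvgB; (exact: cvg_cst || exact: cRe || exact: cIm).
  rewrite -(cvg_lim _ cA)//; apply: limr_le; first by apply/cvg_ex; eexists; exact: cA.
  apply: filterS Fv => f /= /ltW; apply: le_trans.
  rewrite -lee_fin l2_sqE -fsumEFin//; apply: esum_ge; exists A => //.
have Lmem : L \in l2_mem.
  have [v Fv] := Fball 1 ltr01.
  have vL : (fun x => v x - L x) \in l2_mem.
    rewrite unfold_in; apply: asboolT; split.
      by move=> x wx; rewrite L0// l2_suppE// subr0.
    by apply: le_lt_trans (bnd v 1 ltr01 Fv) _; rewrite ltry.
  have := rpredB (l2P v) vL.
  rewrite (_ : _ - _ = L)//; apply/funext => x.
  by rewrite -[LHS]/(v x - (v x - L x)) subKr.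
apply/cvg_ex; exists (L2 Lmem); apply/cvg_ballP => e e0.
have [d [d0 ed]] : exists d : R, 0 < d /\ e = d%:C.
  move: e0; case: e => a b; rewrite ltcE /= => /andP[/eqP -> a0].
  by exists a.
rewrite {}ed {e e0}.
have d2 : 0 < d / 2 by rewrite divr_gt0.
have [v Fv] := Fball _ d2.
have vL : l2_norm (v - L2 Lmem) <= (d / 2)%:C.
  rewrite /l2_norm lecR -ler_sqr ?nnegrE ?sqrtr_ge0//; last exact: ltW.
  rewrite sqr_sqrtr ?l2_sq_ge0// -lee_fin l2_sqE.
  exact: bnd.
near=> f.
have fv : l2_norm (v - f) < (d / 2)%:C.
  have : l2_sq (v - f) < (d / 2) ^+ 2 by near: f.
  rewrite ltcR -{1}(sqr_sqrtr (l2_sq_ge0 (v - f))) ltr_sqr ?nnegrE ?sqrtr_ge0//.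
  exact: ltW.
rewrite -ball_normE /ball_/= -[`|_|]/(l2_norm _).
rewrite (_ : L2 Lmem - f = - (v - L2 Lmem) + (v - f)); last first.
  by rewrite opprB addrA subrK.
apply: le_lt_trans (l2_normD _ _) _.
have N h : l2_norm (- h) = l2_norm h by exact: (normrN h).
rewrite N (_ : d%:C = (d/2)%:C + (d/2)%:C) ?ler_ltD//.
by rewrite -rmorphD -splitr.
Unshelve. all: by end_near. Qed.

HB.instance Definition _ := Uniform_isComplete.Build l2 l2_complete.

End l2.

HB.mixin Record isHilbert (R : realType) H & CompleteNormedModule R[i] H := {
  dot : H -> H -> R[i] ;
  dot_linearl : forall (a : R[i]) x y z, dot (a *: x + y) z = a * dot x z + dot y z ;
  dotC : forall x y, dot y x = (dot x y)^* ;
  dotxx : forall x, dot x x = `|x| ^+ 2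
}.

#[short(type="hilbertType")]
HB.structure Definition Hilbert (R : realType) :=
  {H of CompleteNormedModule R[i] H & isHilbert R H}.

Definition csum {R : realType} {I : choiceType} (f : I -> R[i]) : R[i] :=
  rsum (fun x => complex.Re (f x)) +i* rsum (fun x => complex.Im (f x)).

Section l2_hilbert.
Context {R : realType} {I : choiceType} (w : I -> R).
Implicit Types f g : l2 w.

Definition l2_dot f g : R[i] := csum (fun x => (w x)%:C * f x * (g x)^*).

Lemma l2_cross f g (p : R[i] -> R) : (forall z, p z ^+ 2 <= normc z ^+ 2) ->
  absum (fun x => p ((w x)%:C * f x * (g x)^*)).
Proof.
move=> pn; apply: (@absum_le _ _ _ (fun x => l2_term w f x + l2_term w g x)); last first.
  under eq_esum do rewrite EFinD.
  rewrite esumD; try by move=> x _; rewrite lee_fin l2_tge0.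
  by rewrite -!l2_sqE ltry.
move=> x; have [w0|w0] := ltP 0 (w x); last first.
  rewrite [f x]l2_suppE -?leNgt// mulr0 mul0r /l2_term !l2_suppE -?leNgt//.
  rewrite normc0 expr0n !mulr0 addr0.
  have := pn 0; rewrite normc0 expr0n /= => h.
  by rewrite normr_le0 -sqrf_eq0 eq_le h sqr_ge0.
rewrite -ler_sqr ?nnegrE ?addr_ge0 ?l2_tge0// -normrX ger0_norm ?sqr_ge0//.
apply: le_trans (pn _) _; rewrite !normcM /l2_term.
have -> : normc (w x)%:C = w x by rewrite /= expr0n addr0 sqrtr_sqr ger0_norm// ltW.
have -> : normc (g x)^* = normc (g x) by case: (g x) => a b /=; rewrite sqrrN.
have n0 z : 0 <= @normc R z by case: z => a b; rewrite sqrtr_ge0.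
have := n0 (f x); have := n0 (g x); move: (normc (f x)) (normc (g x)) => a b b0 a0.
rewrite -mulrDr -mulrA !exprMn ler_pM2l ?exprn_gt0//.
have ab : a * b <= a ^+ 2 + b ^+ 2.
  rewrite -subr_ge0 (_ : _ - _ = ((a - b) ^+ 2 + a ^+ 2 + b ^+ 2) / 2); last by field.
  by rewrite divr_ge0// !addr_ge0// sqr_ge0.
by rewrite -exprMn ler_sqr ?nnegrE ?addr_ge0 ?mulr_ge0 ?sqr_ge0.
Qed.

Let pRe (z : R[i]) : complex.Re z ^+ 2 <= normc z ^+ 2.
Proof. by rewrite normc2 lerDl sqr_ge0. Qed.
Let pIm (z : R[i]) : complex.Im z ^+ 2 <= normc z ^+ 2.
Proof. by rewrite normc2 lerDr sqr_ge0. Qed.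

Lemma l2_dot_linearl (a : R[i]) f g h :
  l2_dot (a *: f + g) h = a * l2_dot f h + l2_dot g h.
Proof.
rewrite /l2_dot /csum.
set sf := fun x => (w x)%:C * f x * (h x)^*; set sg := fun x => (w x)%:C * g x * (h x)^*.
have E x : (w x)%:C * (a *: f + g) x * (h x)^* = a * sf x + sg x.
  by rewrite l2D l2Z /sf /sg; ring.
under eq_fun do rewrite E; under [X in _ +i* rsum X]eq_fun do rewrite E.
have fRe := l2_cross f h pRe; have fIm := l2_cross f h pIm.
have gRe := l2_cross g h pRe; have gIm := l2_cross g h pIm.
case: a {E} => a b.
have -> : (fun x => complex.Re ((a +i* b) * sf x + sg x)) =
   (fun x => (a * complex.Re (sf x) + - b * complex.Im (sf x)) + complex.Re (sg x)).
  by apply/funext => x; case: (sf x) => p q; case: (sg x) => r s /=; ring.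
have -> : (fun x => complex.Im ((a +i* b) * sf x + sg x)) =
   (fun x => (a * complex.Im (sf x) + b * complex.Re (sf x)) + complex.Im (sg x)).
  by apply/funext => x; case: (sf x) => p q; case: (sg x) => r s /=; ring.
have lin (k l : R) (p q r : I -> R) : absum p -> absum q -> absum r ->
    rsum (fun x => (k * p x + l * q x) + r x) = (k * rsum p + l * rsum q) + rsum r.
  move=> ps qs rs; have kp := absumZ k ps; have lq := absumZ l qs.
  by rewrite (rsumD (absumD kp lq) rs) (rsumD kp lq) (rsumZ k ps) (rsumZ l qs).
rewrite (lin a (- b) _ _ _ fRe fIm gRe) (lin a b _ _ _ fIm fRe gIm).
by apply/eqP; rewrite eq_complex /=; apply/andP; split; apply/eqP; ring.
Qed.

Lemma l2_dotC f g : l2_dot g f = (l2_dot f g)^*.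
Proof.
rewrite /l2_dot /csum /=; congr (_ +i* _).
  congr rsum; apply/funext => x; case: (f x) => a b; case: (g x) => c d /=; ring.
rewrite -mulN1r -rsumZ; last exact: l2_cross.
congr rsum; apply/funext => x; case: (f x) => a b; case: (g x) => c d /=; ring.
Qed.

Lemma l2_dotxx f : l2_dot f f = `|f| ^+ 2.
Proof.
rewrite -[`|f|]/(l2_norm f) /l2_norm -rmorphXn sqr_sqrtr ?l2_sq_ge0//.
rewrite /l2_dot /csum.
have -> : (fun x => complex.Re ((w x)%:C * f x * (f x)^*)) = l2_term w f.
  by apply/funext => x; rewrite /l2_term normc2; case: (f x) => a b /=; ring.
have -> : (fun x => complex.Im ((w x)%:C * f x * (f x)^*)) = (fun=> 0 * 0).
  by apply/funext => x; case: (f x) => a b /=; ring.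
rewrite rsumZ; last by rewrite /absum esum1// => x _; rewrite normr0.
by rewrite mul0r rsum_ge0E//; exact: l2_tge0.
Qed.

HB.instance Definition _ := isHilbert.Build R (l2 w) l2_dot_linearl l2_dotC l2_dotxx.

End l2_hilbert.

Section orthonormal.
Context {R : realType} (H : hilbertType R).
Implicit Types (x y z : H) (B : set H).

Lemma dotDl x y z : dot (x + y) z = dot x z + dot y z.
Proof. by rewrite -{1}[x]scale1r dot_linearl mul1r. Qed.

Lemma dot0l y : dot (0 : H) y = 0.
Proof. by have /eqP := dotDl 0 0 y; rewrite addr0 -subr_eq0 opprD addNKr oppr_eq0 => /eqP. Qed.

Lemma dotZl (a : R[i]) x y : dot (a *: x) y = a * dot x y.
Proof. by rewrite -[a *: x]addr0 dot_linearl dot0l addr0. Qed.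

Lemma dotDr x y z : dot x (y + z) = dot x y + dot x z.
Proof. by rewrite dotC dotDl rmorphD /= -!dotC. Qed.

Lemma dotZr (a : R[i]) x y : dot x (a *: y) = a^* * dot x y.
Proof. by rewrite dotC dotZl rmorphM /= -dotC. Qed.

Definition orthonormal B :=
  forall x y, B x -> B y -> dot x y = if x == y then 1 else 0.

Lemma bessel_seq B (s : seq H) x : orthonormal B -> uniq s -> (forall e, e \in s -> B e) ->
  \sum_(e <- s) `|dot x e| ^+ 2 <= `|x| ^+ 2.
Proof.
move=> oB; elim: s x => [|e s IH] x; first by rewrite big_nil exprn_ge0.
move=> /= /andP[es us] sB; rewrite big_cons.
have Be : B e by apply: sB; rewrite mem_head.
have sB' f : f \in s -> B f by move=> fs; apply: sB; rewrite inE fs orbT.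
have de : dot e e = 1 by rewrite oB// eqxx.
have := IH (x - dot x e *: e) us sB'.
rewrite -[`|x - _| ^+ 2]dotxx -scaleNr dotDl !dotDr !dotZl !dotZr de mulr1 rmorphN.
rewrite (dotC x e) dotxx sqr_normc -lerBrDl.
rewrite (_ : \sum_(_ <- _) _ = \sum_(f <- s) `|dot x f| ^+ 2); last first.
  apply: eq_big_seq => f fs; rewrite dotDl dotZl (oB e f Be (sB' _ fs)).
  have /negPf -> : e != f by apply: contraNneq es => ->.
  by rewrite mulr0 addr0.
by move=> le; apply: le_trans le _; rewrite le_eqVlt; apply/orP; left; apply/eqP; ring.
Qed.

Definition maximal_orthonormal B :=
  orthonormal B /\ forall B', orthonormal B' -> B `<=` B' -> B' = B.

Lemma ex_onb : exists B, maximal_orthonormal B.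
Proof.
have [|B [oB Bmax]] := @Zorn_bigcup H orthonormal.
  move=> F Fo Ft x y [X FX Xx] [Y FY Yy]; have [XY|YX] := Ft _ _ FX FY.
    by apply: (Fo Y) => //; exact: XY.
  by apply: (Fo X) => //; exact: YX.
exists B; split=> // B' oB' BB'; apply: contrapT => ne.
by apply: (Bmax B') => //; rewrite properEneq; split=> //; apply/eqP => e; exact: ne.
Qed.

(* A chosen orthonormal basis, i.e. a maximal orthonormal set. *)
Definition onb : set H := projT1 (cid ex_onb).

Lemma onbP : maximal_orthonormal onb. Proof. exact: projT2 (cid ex_onb). Qed.

Definition coef2 x e : R := if e \in onb then normc (dot x e) ^+ 2 else 0.

Lemma coef2_ge0 x e : 0 <= coef2 x e.
Proof. by rewrite /coef2; case: ifP => // _; rewrite sqr_ge0. Qed.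

Lemma bessel x : (\esum_(e in [set: H]) (coef2 x e)%:E < +oo)%E.
Proof.
have [oB _] := onbP.
apply: (@le_lt_trans _ _ (complex.Re (`|x| ^+ 2))%:E); last by rewrite ltry.
apply: ge_ereal_sup => _ [A [finA _] <-]; rewrite fsumEFin// lee_fin.
rewrite fsbig_finite//= /coef2 -big_mkcond /= -big_filter.
set s := [seq _ <- _ | _].
have us : uniq s by rewrite filter_uniq// finmap.fset_uniq.
have sB e : e \in s -> onb e by rewrite mem_filter => /andP[/set_mem].
have := bessel_seq x oB us sB; rewrite lecE => /andP[_]; apply: le_trans.
rewrite le_eqVlt; apply/orP; left; apply/eqP.
by rewrite raddf_sum; apply: eq_bigr => e _; rewrite -[`|_|]/(normc _)%:C -rmorphXn.
Qed.

End orthonormal.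
Arguments onb {R} H.

Section htensor.
Context {R : realType}.
Implicit Types H K : hilbertType R.

(* The Hilbert tensor product, modelled on l2 of the product of the two
   orthonormal bases: the elementary tensor of x and y has (e, f)-coordinate
   <x, e> <y, f>, so that elementary tensors span a dense subspace and
   <x (x) y, x' (x) y'> = <x, x'> <y, y'>. *)
Definition htensor H K : hilbertType R :=
  l2 (\1_(onb H `*` onb K) : H * K -> R).

Definition pure_fun H K (x : H) (y : K) (p : H * K) : R[i] :=
  if p \in onb H `*` onb K then dot x p.1 * dot y p.2 else 0.

Lemma pure_subproof H K (x : H) (y : K) :
  pure_fun x y \in l2_mem (\1_(onb H `*` onb K) : H * K -> R).
Proof.
rewrite unfold_in; apply: asboolT; split=> [p|].
  by rewrite indicE /pure_fun ltr0n lt0b => /negPf ->.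
have -> : [set: H * K] = [set: H] `*`` (fun=> [set: K]).
  by apply/seteqP; split=> -[].
under eq_esum => p _.
  rewrite (_ : l2_term _ _ _ = coef2 x p.1 * coef2 y p.2).
    over.
  rewrite /l2_term indicE /pure_fun /coef2 in_setX.
  have [_|_] := boolP (p.1 \in onb H); have [_|_] := boolP (p.2 \in onb K);
    rewrite /= ?mul1r ?mul0r ?mulr0//.
  by rewrite normcM exprMn.
rewrite -(@esum_esum _ _ _ _ _ (fun e f => (coef2 x e * coef2 y f)%:E)); last first.
  by move=> *; rewrite lee_fin mulr_ge0 ?coef2_ge0.
under eq_esum do rewrite esumZ ?coef2_ge0//.
have fy : (\esum_(f in [set: K]) (coef2 y f)%:E)%E \is a fin_num.
  by rewrite ge0_fin_numE ?bessel ?esum_ge0// => *; rewrite lee_fin coef2_ge0.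
rewrite -(fineK fy); under eq_esum do rewrite -EFinM mulrC.
rewrite esumZ; last by rewrite fine_ge0// esum_ge0// => *; rewrite lee_fin coef2_ge0.
apply: lte_mul_pinfty; last exact: bessel.
  by rewrite lee_fin fine_ge0// esum_ge0// => *; rewrite lee_fin coef2_ge0.
by [].
Qed.

Definition pure H K (x : H) (y : K) : htensor H K := L2 (pure_subproof x y).

End htensor.

Record category := Category {
  ob :> Type ;
  mor : ob -> ob -> Type ;
  idm : forall a, mor a a ;
  cmp : forall a b c, mor b c -> mor a b -> mor a c ;
  cmp1m : forall a b (f : mor a b), cmp (idm b) f = f ;
  cmpm1 : forall a b (f : mor a b), cmp f (idm a) = f ;
  cmpA : forall a b c d (h : mor c d) (g : mor b c) (f : mor a b),
    cmp h (cmp g f) = cmp (cmp h g) f }.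
Arguments mor {_} _ _.
Arguments idm {_} _.
Arguments cmp {_ _ _ _} _ _.

Record functor (C D : category) := Functor {
  fob :> C -> D ;
  fmor : forall a b : C, mor a b -> mor (fob a) (fob b) ;
  fmor1 : forall a, fmor (idm a) = idm (fob a) ;
  fmorM : forall (a b c : C) (g : mor b c) (f : mor a b),
    fmor (cmp g f) = cmp (fmor g) (fmor f) }.
Arguments fmor {_ _} _ {_ _} _.

Definition op (C : category) : category :=
  @Category (ob C) (fun a b => @mor C b a) (@idm C)
    (fun a b c g f => cmp f g)
    (fun a b f => cmpm1 f) (fun a b f => cmp1m f)
    (fun a b c d h g f => esym (cmpA f g h)).

Definition full_sub (C : category) (P : C -> Prop) : category :=
  @Category {a : C | P a} (fun a b => mor (sval a) (sval b))
    (fun a => idm (sval a)) (fun a b c g f => cmp g f)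
    (fun a b f => cmp1m f) (fun a b f => cmpm1 f)
    (fun a b c d h g f => cmpA h g f).

Definition is_iso (C : category) (a b : C) (f : mor a b) : Prop :=
  exists g : mor b a, cmp g f = idm a /\ cmp f g = idm b.

Record adjunction (C D : category) (F : functor C D) (G : functor D C) := Adjunction {
  adj_unit : forall a : C, mor a (G (F a)) ;
  adj_counit : forall b : D, mor (F (G b)) b ;
  adj_unit_nat : forall (a a' : C) (f : mor a a'),
    cmp (fmor G (fmor F f)) (adj_unit a) = cmp (adj_unit a') f ;
  adj_counit_nat : forall (b b' : D) (f : mor b b'),
    cmp f (adj_counit b) = cmp (adj_counit b') (fmor F (fmor G f)) ;
  adj_triangleF : forall a : C,
    cmp (adj_counit (F a)) (fmor F (adj_unit a)) = idm (F a) ;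
  adj_triangleG : forall b : D,
    cmp (fmor G (adj_counit b)) (adj_unit (G b)) = idm (G b) }.

Definition adjoint_equivalence (C D : category) (F : functor C D) (G : functor D C)
    (A : adjunction F G) : Prop :=
  (forall a, is_iso (adj_unit A a)) /\ (forall b, is_iso (adj_counit A b)).

Definition equivalent (C D : category) : Prop :=
  exists (F : functor C D) (G : functor D C)
    (eta : forall a : C, mor a (G (F a))) (eps : forall b : D, mor (F (G b)) b),
  [/\ forall a a' (f : mor a a'), cmp (fmor G (fmor F f)) (eta a) = cmp (eta a') f,
      forall b b' (f : mor b b'), cmp f (eps b) = cmp (eps b') (fmor F (fmor G f)),
      forall a, is_iso (eta a) & forall b, is_iso (eps b)].

Section restriction.
Context (C D : category) (P : C -> Prop) (F : functor C D) (G : functor D C).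
Context (GP : forall b, P (G b)).

Definition restrict_dom : functor (full_sub P) D :=
  @Functor (full_sub P) D (fun a => F (sval a)) (fun a b f => fmor F f)
    (fun a => fmor1 F (sval a)) (fun a b c g f => fmorM F g f).

Definition restrict_codom : functor D (full_sub P) :=
  @Functor D (full_sub P) (fun b => exist P (G b) (GP b)) (fun a b f => fmor G f)
    (fun a => fmor1 G a) (fun a b c g f => fmorM G g f).

Definition restrict_adjunction (A : adjunction F G) :
    adjunction restrict_dom restrict_codom :=
  @Adjunction (full_sub P) D restrict_dom restrict_codom
    (fun a => adj_unit A (sval a)) (adj_counit A)
    (fun a a' f => adj_unit_nat A f) (fun b b' f => adj_counit_nat A f)
    (fun a => adj_triangleF A (sval a)) (adj_triangleG A).

End restriction.

Record finpset := FinPSet { fp_car :> finType ; fp_base : fp_car }.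

Record fphom (X Y : finpset) := FPHom {
  fph_fun :> X -> Y ; fph_base : fph_fun (fp_base X) = fp_base Y }.

Lemma fphom_ext X Y (f g : fphom X Y) : f =1 g -> f = g.
Proof.
case: f g => f fb [g gb] /= /funext fg; move: fb gb; rewrite fg => fb gb.
by rewrite (Prop_irrelevance fb gb).
Qed.

Lemma fphom_id (X : finpset) : id (fp_base X) = fp_base X. Proof. by []. Qed.

Lemma fphom_comp (X Y Z : finpset) (g : fphom Y Z) (f : fphom X Y) :
  (g \o f) (fp_base X) = fp_base Z.
Proof. by rewrite /= !fph_base. Qed.

Program Definition FinSet_pt : category :=
  @Category finpset fphom (fun X => FPHom (fphom_id X))
    (fun X Y Z g f => FPHom (fphom_comp g f))
    _ _ _.
Next Obligation. by move=> *; apply: fphom_ext. Qed.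
Next Obligation. by move=> *; apply: fphom_ext. Qed.
Next Obligation. by move=> *; apply: fphom_ext. Qed.

Lemma esum_fiber (R : realType) (X Y : choiceType) (f : X -> Y) (A : set Y)
    (a : X -> \bar R) : (forall x, 0 <= a x)%E ->
  (\esum_(x in f @^-1` A) a x = \esum_(y in A) \esum_(x in f @^-1` [set y]) a x)%E.
Proof.
move=> a0; rewrite esum_esum//.
apply: (@reindex_esum _ _ _ _ _ (fun k : Y * X => k.2)); split.
- by move=> [y x] /= [Ay fxy]; rewrite fxy.
- by move=> [y x] [y' x'] /[!inE] /= -[_ /= <-] [_ /= <-] ->.
- by move=> x /= Ax; exists (f x, x).
Qed.

Section wset.
Context (R : realType).

Record wset := WSet {
  ws_car :> choiceType ;
  ws_base : ws_car ;
  ws_weight : ws_car -> R ;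
  (* The weight function lives on the complement of the base point; it is
     encoded by its extension by 0. *)
  ws_weight_base : ws_weight ws_base = 0 ;
  ws_weight_ge : exists2 c : R, 0 < c & forall x, x <> ws_base -> c <= ws_weight x }.

Definition is_whom (X Y : wset) (f : X -> Y) : Prop :=
  [/\ f (ws_base X) = ws_base Y,
      forall y, y <> ws_base Y -> finite_set (f @^-1` [set y]) &
      exists2 M : R, 0 <= M & forall y, y <> ws_base Y ->
        \sum_(x \in f @^-1` [set y]) ws_weight x <= M * ws_weight y].

Record whom (X Y : wset) := WHom { wh_fun :> X -> Y ; whP : is_whom wh_fun }.

Lemma whom_ext X Y (f g : whom X Y) : f =1 g -> f = g.
Proof.
case: f g => f fb [g gb] /= /funext fg; move: fb gb; rewrite fg => fb gb.
by rewrite (Prop_irrelevance fb gb).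
Qed.

Lemma ws_weight_ge0 (X : wset) (x : X) : 0 <= ws_weight x.
Proof.
have [->|/eqP nx] := eqVneq x (ws_base X); first by rewrite ws_weight_base.
by have [c c0 /(_ x nx)] := ws_weight_ge X; apply: le_trans; exact: ltW.
Qed.

Lemma ws_weight_gt0 (X : wset) (x : X) : (0 < ws_weight x) = (x != ws_base X).
Proof.
have [->|/eqP nx] := eqVneq x (ws_base X); first by rewrite ws_weight_base ltxx.
by have [c c0 /(_ x nx)] := ws_weight_ge X; apply: lt_le_trans.
Qed.

Lemma whom_esum (X Y : wset) (f : X -> Y) (M : R) :
  (forall y, y <> ws_base Y -> finite_set (f @^-1` [set y])) ->
  (forall y, y <> ws_base Y ->
    \sum_(x \in f @^-1` [set y]) ws_weight x <= M * ws_weight y) <->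
  (forall y, y <> ws_base Y ->
    (\esum_(x in f @^-1` [set y]) (ws_weight x)%:E <= (M * ws_weight y)%:E)%E).
Proof.
move=> fin; split=> h y yb; have := h y yb; rewrite esum_fset ?fsumEFin ?lee_fin; auto;
  by move=> *; rewrite ?lee_fin ws_weight_ge0.
Qed.

Lemma whom_id (X : wset) : @is_whom X X id.
Proof.
split=> // [y _|]; first by rewrite preimage_id; exact: finite_set1.
by exists 1 => // y _; rewrite preimage_id fsbig_set1 mul1r.
Qed.

Lemma whom_comp (X Y Z : wset) (g : whom Y Z) (f : whom X Y) : is_whom (g \o f).
Proof.
have [fb ff [M M0 fM]] := whP f; have [gb gf [N N0 gN]] := whP g.
have nb z y : z <> ws_base Z -> g y = z -> y <> ws_base Y.
  by move=> zb gyz yb; apply: zb; rewrite -gyz yb.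
have fin z : z <> ws_base Z -> finite_set ((g \o f) @^-1` [set z]).
  move=> zb; rewrite comp_preimage.
  have -> : f @^-1` (g @^-1` [set z]) =
      \bigcup_(y in g @^-1` [set z]) (f @^-1` [set y]).
    by apply/seteqP; split=> [x gfx|x [y gy /= ->]//]; exists (f x).
  by apply: bigcup_finite => [|y gy]; [exact: gf|apply: ff; exact: nb gy].
split=> //; first by rewrite /= fb gb.
exists (M * N); first by rewrite mulr_ge0.
apply/(whom_esum _ fin) => z zb.
rewrite comp_preimage esum_fiber; last by move=> x; rewrite lee_fin ws_weight_ge0.
apply: (@le_trans _ _ (\esum_(y in g @^-1` [set z]) (M * ws_weight y)%:E)%E).
  by apply: le_esum => y gy; have /(whom_esum _ ff) := fM; apply; exact: nb gy.
rewrite -mulrA.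
rewrite esum_fset; [|exact: gf|by move=> y _; rewrite lee_fin mulr_ge0 ?ws_weight_ge0].
rewrite fsumEFin; last exact: gf.
rewrite -mulr_fsumr lee_fin ler_wpM2l//; exact: gN.
Qed.

Program Definition WSet_pt : category :=
  @Category wset whom (fun X => WHom (whom_id X))
    (fun X Y Z g f => WHom (whom_comp g f))
    _ _ _.
Next Obligation. by move=> *; apply: whom_ext. Qed.
Next Obligation. by move=> *; apply: whom_ext. Qed.
Next Obligation. by move=> *; apply: whom_ext. Qed.

End wset.

Section bounded_maps.
Context {R : realType}.
Implicit Types H K L : hilbertType R.

(* The real-valued norm: the library norm of an R[i]-module takes values in
   R[i]. *)
Definition nrm H (x : H) : R := complex.Re `|x|.

Lemma nrm_ge0 H (x : H) : 0 <= nrm x.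
Proof. by have := normr_ge0 x; rewrite lecE => /andP[_]. Qed.

Lemma nrm0 H : nrm (0 : H) = 0. Proof. by rewrite /nrm normr0. Qed.

Definition bounded_linear H K (f : H -> K) : Prop :=
  linear f /\ exists M : R, forall x, nrm (f x) <= M * nrm x.

Lemma bounded_linear_id H : bounded_linear (@id H).
Proof. by split=> //; exists 1 => x; rewrite mul1r. Qed.

Lemma bounded_linear_comp H K L (g : K -> L) (f : H -> K) :
  bounded_linear g -> bounded_linear f -> bounded_linear (g \o f).
Proof.
move=> [gl [N gN]] [fl [M fM]]; split=> [a x y|]; first by rewrite /= fl gl.
exists (`|N| * M) => x /=; apply: le_trans (gN _) _.
apply: (@le_trans _ _ (`|N| * nrm (f x))).
  by rewrite ler_wpM2r ?nrm_ge0// ler_norm.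
by rewrite -mulrA ler_wpM2l.
Qed.

Definition opnorm H K (f : H -> K) : R :=
  sup [set nrm (f x) | x in [set x | nrm x <= 1]].

(* The Hilbert adjoint; for a bounded linear f the set below is a singleton
   (Riesz), so that get selects its element. *)
Definition adj H K (f : H -> K) (y : K) : H :=
  get [set z | forall x, dot (f x) y = dot x z].

(* The next three maps are the unique bounded linear maps with the prescribed
   values on elementary tensors: the tensor product of two bounded linear maps,
   the canonical unitary and its inverse. Existence is standard, uniqueness is
   density of the span of the elementary tensors. *)
Definition tmap H1 H2 K1 K2 (f : H1 -> K1) (g : H2 -> K2) :
    htensor H1 H2 -> htensor K1 K2 :=
  xget (fun=> 0) [set h | bounded_linear h /\
    forall x y, h (pure x y) = pure (f x) (g y)].

Definition tassoc H K L :
    htensor (htensor H K) L -> htensor H (htensor K L) :=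
  xget (fun=> 0) [set h | bounded_linear h /\
    forall x y z, h (pure (pure x y) z) = pure x (pure y z)].

Definition tassocV H K L :
    htensor H (htensor K L) -> htensor (htensor H K) L :=
  xget (fun=> 0) [set h | bounded_linear h /\
    forall x y z, h (pure x (pure y z)) = pure (pure x y) z].

Lemma dot_inj H (y z : H) : (forall x, dot x y = dot x z) -> y = z.
Proof.
move=> yz; apply/eqP; rewrite -subr_eq0 -normr_eq0 -sqrf_eq0 -dotxx.
by rewrite -[X in dot _ (_ + X)]scaleN1r dotDr dotZr yz -!dotZr -dotDr scaleN1r subrr dotC dot0l conjc0.
Qed.

Lemma adjE H K (f : H -> K) y z : (forall x, dot (f x) y = dot x z) -> adj f y = z.
Proof.
move=> fz; apply: dot_inj => x.
have := @getPex _ [set z | forall x, dot (f x) y = dot x z] (ex_intro _ z fz).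
by move=> /= <-; rewrite fz.
Qed.

Lemma adj0 H K (f : H -> K) : adj f 0 = 0.
Proof. by apply: adjE => x; rewrite dotC dot0l [RHS]dotC dot0l. Qed.

Lemma adj_id H (y : H) : adj id y = y. Proof. exact: adjE. Qed.

End bounded_maps.
Arguments tassoc {R} H K L.
Arguments tassocV {R} H K L.

Section frobsem.
Context (R : realType).

Record is_frobsem (H : hilbertType R) (mu : htensor H H -> H) : Prop := {
  frob_bounded : bounded_linear mu ;
  frob_assoc : forall x y z,
    mu (pure (mu (pure x y)) z) = mu (pure x (mu (pure y z))) ;
  frob_comm : forall x y, mu (pure x y) = mu (pure y x) ;
  frob_left : tmap mu id \o tassocV H H H \o tmap id (adj mu) = adj mu \o mu ;
  frob_right : tmap id mu \o tassoc H H H \o tmap (adj mu) id = adj mu \o mu }.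

Record frobsem := FrobSem {
  fs_car :> hilbertType R ;
  fs_mu : htensor fs_car fs_car -> fs_car ;
  fsP : is_frobsem fs_mu }.

Definition fs_mul (H : frobsem) (x y : H) : H := fs_mu (pure x y).

Definition is_fhom (H K : frobsem) (f : H -> K) : Prop :=
  bounded_linear f /\ forall u v, f (fs_mul u v) = fs_mul (f u) (f v).

Record fhom (H K : frobsem) := FHom { fh_fun :> H -> K ; fhP : is_fhom fh_fun }.

Lemma fhom_ext H K (f g : fhom H K) : f =1 g -> f = g.
Proof.
case: f g => f fb [g gb] /= /funext fg; move: fb gb; rewrite fg => fb gb.
by rewrite (Prop_irrelevance fb gb).
Qed.

Lemma fhom_id (H : frobsem) : @is_fhom H H id.
Proof. by split=> //; exact: bounded_linear_id. Qed.

Lemma fhom_comp (H K L : frobsem) (g : fhom K L) (f : fhom H K) : is_fhom (g \o f).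
Proof.
have [fb fM] := fhP f; have [gb gM] := fhP g.
by split=> [|u v]; [exact: bounded_linear_comp|rewrite /= fM gM].
Qed.

Program Definition FrobSem_cat : category :=
  @Category frobsem fhom (fun X => FHom (fhom_id X))
    (fun X Y Z g f => FHom (fhom_comp g f)) _ _ _.
Next Obligation. by move=> *; apply: fhom_ext. Qed.
Next Obligation. by move=> *; apply: fhom_ext. Qed.
Next Obligation. by move=> *; apply: fhom_ext. Qed.

Section ideals.
Context (H : frobsem).
Implicit Types I J : set H.

(* Ideals of the underlying Banach algebra; they need not be closed. *)
Definition is_ideal I : Prop :=
  [/\ I 0, forall x y, I x -> I y -> I (x + y),
      forall (a : R[i]) x, I x -> I (a *: x) & forall x y, I y -> I (fs_mul x y)].

Definition minimal_ideal I : Prop :=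
  [/\ is_ideal I, I <> [set 0] &
      forall J, is_ideal J -> J `<=` I -> J = [set 0] \/ J = I].

(* The algebra is commutative: left and right modular units coincide. *)
Definition modular I : Prop := exists u : H, forall x, I (x - fs_mul x u).

Definition maximal_modular_ideal I : Prop :=
  [/\ is_ideal I, modular I, I <> [set: H] &
      forall J, is_ideal J -> I `<=` J -> J = I \/ J = [set: H]].

Definition radical : set H := \bigcap_(I in [set I | maximal_modular_ideal I]) I.

Definition semisimple : Prop := radical = [set 0].

Definition finite_dim : Prop :=
  exists (n : nat) (e : 'I_n -> H), forall x, exists c : 'I_n -> R[i],
    x = \sum_(i < n) c i *: e i.

Definition grouplike (x : H) : Prop := x <> 0 /\ adj (@fs_mu H) x = pure x x.

Definition line (x : H) : set H := [set a *: x | a in [set: R[i]]].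

(* Minimal ideals inside the radical are excluded. The radical of a Frobenius
   semigroup is its annihilator, so any line in it is a minimal ideal with zero
   product (for mu = 0 on the complex line, the whole space is one), which is
   not spanned by a group-like element. The exclusion is void in the semisimple
   case, see Min_semisimple. *)
Definition Min : set (set H) := [set I | minimal_ideal I /\ ~ I `<=` radical].

(* Min together with the zero ideal, the base point. *)
Definition Min0 : set (set H) := Min `|` [set [set 0]].

(* The group-like generator of a minimal ideal, and 0 for the zero ideal. *)
Definition gl I : H := get [set g | (grouplike g \/ g = 0) /\ I = line g].

Definition bconst : R :=
  if `[< forall t, fs_mu t = 0 :> H >] then 1 else opnorm (@fs_mu H).

Lemma line0 : line 0 = [set 0].
Proof. by apply/seteqP; split=> [_ [a _ <-]|_ ->]; [rewrite /= scaler0|exists 0; rewrite ?scaler0]. Qed.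

Lemma glE I g : (grouplike g \/ g = 0) -> I = line g ->
  (grouplike (gl I) \/ gl I = 0) /\ I = line (gl I).
Proof. by move=> gg Ig; apply: (@getPex _ [set g | (grouplike g \/ g = 0) /\ I = line g]); exists g. Qed.

Lemma gl0 : gl [set 0] = 0.
Proof.
have [_ e] := glE (or_intror erefl) (esym line0).
have : line (gl [set 0]) (gl [set 0]) by exists 1; rewrite ?scale1r.
by rewrite -e.
Qed.

End ideals.

Lemma Min_semisimple (H : frobsem) : semisimple H ->
  Min (H := H) = [set I | minimal_ideal I].
Proof.
move=> ss; apply/seteqP; split=> [I []//|I mI]; split=> //; rewrite ss => I0.
have [[z0 _ _ _] nz _] := mI; apply: nz; apply/seteqP; split=> // _ ->.
exact: z0.
Qed.

Arguments Min0 H : clear implicits.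
Arguments Min H : clear implicits.
Arguments bconst H : clear implicits.

Lemma Min0_0 (H : frobsem) : [set 0] \in Min0 H.
Proof. by apply/mem_set; right. Qed.

(* What the definition of the functor Min on objects and on morphisms relies on:
   g is a well-defined bijection, the weights are bounded below by b^-2, and
   adjoints of morphisms preserve group-like elements up to 0. *)
Record Min_facts : Prop := {
  Min_grouplike : forall (H : frobsem) (I : set H), Min H I ->
    exists! g, grouplike g /\ I = line g ;
  Min_bij : forall H : frobsem,
    set_bij (Min H) [set g | grouplike g] (@gl H) ;
  bconst_gt0 : forall H : frobsem, 0 < bconst H ;
  Min_weight_ge : forall (H : frobsem) (I : set H), Min H I ->
    (bconst H) ^- 2 <= (nrm (gl I)) ^- 2 ;
  adj_grouplike : forall (H K : frobsem) (f : fhom H K) (k : K),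
    grouplike k -> grouplike (adj f k) \/ adj f k = 0 }.

Section Min_functor.
Context (mf : Min_facts).

Definition Min_weight (H : frobsem) (I : Min0 H) : R := (nrm (gl (val I))) ^- 2.

Lemma Min_weight_base (H : frobsem) : Min_weight (SigSub (Min0_0 H)) = 0.
Proof. by rewrite /Min_weight /= gl0 nrm0 expr0n invr0. Qed.

Lemma Min_weight_bound (H : frobsem) :
  exists2 c : R, 0 < c &
    forall I : Min0 H, I <> SigSub (Min0_0 H) -> c <= Min_weight I.
Proof.
exists ((bconst H) ^- 2); first by rewrite invr_gt0 exprn_gt0// bconst_gt0.
move=> I I0; apply: Min_weight_ge => //.
have [//|/= Iz] : Min0 H (val I) by apply: set_mem; exact: valP.
by exfalso; apply: I0; apply: val_inj.
Qed.

Definition Min_obj (H : frobsem) : wset R :=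
  @WSet R (Min0 H) (SigSub (Min0_0 H)) (@Min_weight H)
    (Min_weight_base H) (Min_weight_bound H).

Lemma Min0_line (H : frobsem) (g : H) : grouplike g \/ g = 0 -> line g \in Min0 H.
Proof.
move=> gg; apply/mem_set; case: gg => [gg|->]; last by right; rewrite line0.
have [_ _ surj] := Min_bij mf H.
have [I MI <-] := surj g gg.
have [g' [[gg' Ig'] _]] := Min_grouplike mf MI.
by have [_ <-] := glE (or_introl gg') Ig'; left.
Qed.

Lemma gl_grouplike (H : frobsem) (I : Min0 H) : grouplike (gl (val I)) \/ gl (val I) = 0.
Proof.
have [MI|/= ->] : Min0 H (val I) by apply: set_mem; exact: valP.
  by have [g [[gg Ig] _]] := Min_grouplike mf MI; have [] := glE (or_introl gg) Ig.
by right; exact: gl0.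
Qed.

Lemma Min_fun_subproof (H K : frobsem) (f : fhom H K) (I : Min0 K) :
  line (adj f (gl (val I))) \in Min0 H.
Proof.
apply: Min0_line; have [|->] := gl_grouplike I; last by right; rewrite adj0.
exact: (adj_grouplike mf).
Qed.

Definition Min_fun (H K : frobsem) (f : fhom H K) (I : Min_obj K) : Min_obj H :=
  SigSub (Min_fun_subproof f I).

(* I |-> C f^dag(g(I)) is a morphism of weighted pointed sets, functorially. *)
Record Min_functoriality : Prop := {
  Min_fun_hom : forall (H K : frobsem) (f : fhom H K), is_whom (Min_fun f) ;
  Min_fun_id : forall (H : frobsem), Min_fun (FHom (fhom_id H)) =1 id ;
  Min_fun_comp : forall (H K L : frobsem) (g : fhom K L) (f : fhom H K),
    Min_fun (FHom (fhom_comp g f)) =1 Min_fun f \o Min_fun g }.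

Program Definition Min_functor (mF : Min_functoriality) : functor FrobSem_cat (op (WSet_pt R)) :=
  @Functor FrobSem_cat (op (WSet_pt R)) Min_obj
    (fun H K f => WHom (Min_fun_hom mF f))
    _ _.
Next Obligation. by move=> mF H; apply: whom_ext; exact: (Min_fun_id mF). Qed.
Next Obligation. by move=> mF H K L g f; apply: whom_ext; exact: (Min_fun_comp mF). Qed.

End Min_functor.

Section ell2.
Implicit Types X Y Z : wset R.

(* Here the support condition of l2 reads u (ws_base X) = 0, as ws_weight X is
   positive exactly off the base point (ws_weight_gt0). *)
Definition ell2 X : hilbertType R := l2 (@ws_weight R X).

Lemma ell2_base X (u : ell2 X) : u (ws_base X) = 0.
Proof. by rewrite l2_suppE// ws_weight_base ltxx. Qed.

(* Pointwise multiplication, as a map on the Hilbert tensor product. *)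
Definition ell2_mu X : htensor (ell2 X) (ell2 X) -> ell2 X :=
  xget (fun=> 0) [set m : htensor (ell2 X) (ell2 X) -> ell2 X | bounded_linear m /\
    forall u v x, m (pure u v) x = u x * v x].

(* Pointwise multiplication extends to a bounded map on the Hilbert tensor
   product, and makes ell2 X a Frobenius semigroup. *)
Record ell2_facts : Prop := {
  ell2_muE : forall X (u v : ell2 X) x, ell2_mu (pure u v) x = u x * v x ;
  ell2_frob : forall X, is_frobsem (@ell2_mu X) }.

Lemma ell2_term_le X Y (f : X -> Y) (M : R) (u : ell2 Y) :
  f (ws_base X) = ws_base Y ->
  (forall y, y <> ws_base Y -> finite_set (f @^-1` [set y])) -> 0 <= M ->
  (forall y, y <> ws_base Y ->
    \sum_(x \in f @^-1` [set y]) ws_weight x <= M * ws_weight y) ->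
  (\esum_(x in [set: X]) (l2_term (@ws_weight R X) (u \o f) x)%:E <=
    M%:E * \esum_(y in [set: Y]) (l2_term (@ws_weight R Y) u y)%:E)%E.
Proof.
move=> fb ff M0 fM.
rewrite -(preimage_setT f) esum_fiber; last first.
  by move=> x; rewrite lee_fin mulr_ge0 ?sqr_ge0 ?ws_weight_ge0.
rewrite -esumZ//; apply: le_esum => y _.
rewrite (_ : esum _ _ = \esum_(x in f @^-1` [set y])
    (normc (u y) ^+ 2 * ws_weight x)%:E)%E; last first.
  by apply: eq_esum => x /= <-; rewrite /l2_term /= mulrC.
rewrite esumZ ?sqr_ge0//.
have [->|/eqP yb] := eqVneq y (ws_base Y).
  by rewrite /l2_term ell2_base normc0 expr0n mul0e lee_fin mulr_ge0// mulr_ge0// ws_weight_ge0.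
have /(_ y yb) le := (whom_esum M ff).1 fM.
rewrite [leRHS](_ : _ = (normc (u y) ^+ 2)%:E * (M * ws_weight y)%:E)%E.
  by apply: lee_wpmul2l => //; rewrite lee_fin sqr_ge0.
by rewrite -EFinM /l2_term; congr EFin; ring.
Qed.

Lemma ell2_fun_subproof X Y (f : whom X Y) (u : ell2 Y) :
  (u : Y -> R[i]) \o f \in l2_mem (@ws_weight R X).
Proof.
have [fb ff [M M0 fM]] := whP f.
rewrite unfold_in; apply: asboolT; split=> [x|].
  by rewrite ws_weight_gt0 negbK => /eqP -> /=; rewrite fb ell2_base.
apply: le_lt_trans (ell2_term_le u fb ff M0 fM) _.
by rewrite -l2_sqE -EFinM ltry.
Qed.

Definition ell2_fun X Y (f : whom X Y) (u : ell2 Y) : ell2 X :=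
  L2 (ell2_fun_subproof f u).

Lemma ell2_fun_bounded X Y (f : whom X Y) : bounded_linear (ell2_fun f).
Proof.
have [fb ff [M M0 fM]] := whP f.
split=> [a u v|]; first by apply: val_inj; apply/funext => x.
exists (Num.sqrt M) => u; rewrite /nrm -[`|ell2_fun f u|]/(l2_norm _) -[`|u|]/(l2_norm _).
rewrite /l2_norm /= -sqrtrM// ler_wsqrtr// -lee_fin EFinM !l2_sqE.
exact: ell2_term_le.
Qed.

Section ell2_functor.
Context (ef : ell2_facts).

Definition ell2_obj X : frobsem := FrobSem (ell2_frob ef X).

Lemma ell2_fun_hom X Y (f : whom X Y) :
  @is_fhom (ell2_obj Y) (ell2_obj X) (ell2_fun f).
Proof.
split=> [|u v]; first exact: ell2_fun_bounded.
by apply: val_inj; apply/funext => x; rewrite /= /fs_mul /= !(ell2_muE ef).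
Qed.

Program Definition ell2_functor : functor (op (WSet_pt R)) FrobSem_cat :=
  @Functor (op (WSet_pt R)) FrobSem_cat ell2_obj
    (fun Y X f => FHom (ell2_fun_hom f))
    _ _.
Next Obligation. by move=> X; apply: fhom_ext => u; apply: val_inj. Qed.
Next Obligation. by move=> Z Y X g f; apply: fhom_ext => u; apply: val_inj. Qed.

End ell2_functor.
End ell2.
End frobsem.

Definition FrobSem_ss (R : realType) : category :=
  @full_sub (FrobSem_cat R) (fun H => semisimple H).

Definition FrobSem_ss_fd (R : realType) : category :=
  @full_sub (FrobSem_cat R) (fun H => semisimple H /\ finite_dim H).

(* Main.v *)
From mathcomp Require Import all_boot all_order all_algebra.
From mathcomp Require Import complex.
From mathcomp Require Import all_classical all_reals all_analysis.
From mathcomp Require Import ring lra.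
Require Import Defs.

(** Write L_x for the multiplication by x on a Frobenius semigroup H, and L_x^*
    for its adjoint. Tested against elementary tensors, the Frobenius equations
    say that L_x^* (u v) = (L_x^* u) v (adjoint_multiplier): the adjoints of the
    multiplications commute with all the multiplications. So the L_x are normal,
    and the orthogonal complement of a maximal modular ideal is again an ideal
    (perp_mull).

    A group-like g is the Riesz representer of a nonzero character. Normality
    turns it into a common eigenvector, u g = <u, g> g (grouplike_mul), hence
    group-like elements are pairwise orthogonal and each spans a minimal ideal.
    Conversely let M be a maximal modular ideal. Its complement is an ideal with
    a unit p (perp_unit), and a field (perp_inverse); a self-adjoint element x
    of that field has a real l for which l p - x is positive but not bounded
    below, hence not invertible, hence zero (perp_selfadjoint). The complement is thus the line
    C p, p divided by its squared norm is group-like, and M is the kernel of the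
    corresponding character (maximal_modular_grouplike). This is Gelfand-Mazur
    without spectral theory, and it identifies the radical with the orthogonal
    complement of the group-like elements (radicalE).

    The unit of the adjunction is the Gelfand transform, sending x to the
    function I |-> <x, g(I)>; Bessel's inequality makes it bounded, and also
    bounds the fibres of the maps that morphisms induce on minimal ideals
    (Min_fun_fiber). The counit sends a point to the line spanned by the
    representer of the evaluation there. On a space of square-summable functions
    every group-like element represents an evaluation (ell2_grouplike), so the
    counit is always invertible. The adjoint of the Gelfand transform is always
    a right inverse of it, and the transform is injective as soon as no nonzero
    vector is orthogonal to all the group-like elements, which is semisimplicity
    (gelfand_iso). Naturality and the triangle identities compare adjoints
    evaluated at group-like elements.

    The maps on Hilbert tensor products that the definition of a Frobenius
    semigroup mentions are specified by their values on elementary tensors and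
    have to be constructed. They all come from one device
    (operator_of_families): a family satisfying a Bessel inequality in the
    source and a family satisfying the Parseval identity in the target determine
    a bounded operator matching their coefficients. Tensor products of such
    families are again of the same kind, which gives the tensor product of two
    maps, the associators, and the pointwise multiplication of functions.

    On finite pointed sets the weights do not matter. Sending such a set to its
    functions vanishing at the base point is fully faithful, by the bijectivity
    of the counit, and it reaches every finite-dimensional semisimple object,
    because orthogonality leaves room for finitely many group-like elements
    only. *)

Set Implicit Arguments.
Unset Strict Implicit.
Unset Printing Implicit Defensive.

Import Order.TTheory GRing.Theory Num.Theory.
Import numFieldNormedType.Exports.
Import Normc.

Local Open Scope classical_set_scope.
Local Open Scope ring_scope.
Local Open Scope complex_scope.


(** * Hilbert spaces *)

Section inner_product.
Context {R : realType}.
Implicit Types (z : R[i]) (H : hilbertType R).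

Lemma normc_ge0 z : 0 <= normc z.
Proof. by case: z => a b; rewrite sqrtr_ge0. Qed.

Lemma normc_eq0 z : (normc z == 0) = (z == 0).
Proof. by apply/eqP/eqP => [/eq0_normc//|->]; rewrite normc0. Qed.

Lemma normcJ z : normc (conjc z) = normc z.
Proof. by case: z => a b /=; rewrite sqrrN. Qed.

Lemma normc_real (r : R) : normc r%:C = `|r|.
Proof. by rewrite /= expr0n addr0 sqrtr_sqr. Qed.

(** The notation for the conjugate elaborates to either of two convertible
    constants according to the surrounding scope; conjc is the normal form here. *)
Lemma conjE z : Num.conj z = conjc z. Proof. by []. Qed.

Lemma conjcM z (t : R[i]) : conjc (z * t) = conjc z * conjc t.
Proof. exact: rmorphM. Qed.

Lemma realcM (r s : R) : (r * s)%:C = r%:C * s%:C :> R[i].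
Proof. exact: rmorphM. Qed.

Lemma realcV (r : R) : (r^-1)%:C = (r%:C)^-1 :> R[i].
Proof. exact: fmorphV. Qed.

Lemma mulJc z : z * conjc z = (normc z ^+ 2)%:C.
Proof.
rewrite normc2; case: z => a b /=.
by apply/eqP; rewrite eq_complex /=; apply/andP; split; apply/eqP; ring.
Qed.

Lemma ge_Re_normc z : complex.Re z <= normc z.
Proof.
case: z => a b /=; apply: le_trans (ler_norm a) _.
by rewrite -sqrtr_sqr ler_wsqrtr// lerDl sqr_ge0.
Qed.

Lemma nrmE H (x : H) : `|x| = (nrm x)%:C.
Proof.
by have := normr_ge0 x; rewrite /nrm; case: `|x| => a b; rewrite lecE /= => /andP[/eqP -> _].
Qed.

Lemma dotxx_nrm H (x : H) : dot x x = (nrm x ^+ 2)%:C.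
Proof. by rewrite dotxx nrmE rmorphXn. Qed.

Lemma nrm2E H (x : H) : nrm x ^+ 2 = complex.Re (dot x x).
Proof. by rewrite dotxx_nrm. Qed.

Lemma nrm_eq0 H (x : H) : (nrm x == 0) = (x == 0).
Proof. by rewrite -[x == 0]normr_eq0 nrmE; apply/eqP/eqP => [->|/complexI]. Qed.

Lemma nrm_gt0 H (x : H) : (0 < nrm x) = (x != 0).
Proof. by rewrite lt_def nrm_eq0 nrm_ge0 andbT. Qed.

Lemma nrmZ H a (x : H) : nrm (a *: x) = normc a * nrm x.
Proof. by apply/complexI; rewrite -nrmE normrZ nrmE rmorphM. Qed.

Lemma nrmN H (x : H) : nrm (- x) = nrm x.
Proof. by rewrite /nrm normrN. Qed.

Lemma nrmBC H (x y : H) : nrm (x - y) = nrm (y - x).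
Proof. by rewrite -nrmN opprB. Qed.

Lemma nrmD_le H (x y : H) : nrm (x + y) <= nrm x + nrm y.
Proof. by rewrite -lecR rmorphD /= -!nrmE ler_normD. Qed.

Lemma nrm_tri H (y x z : H) : nrm (x - z) <= nrm (x - y) + nrm (y - z).
Proof. by apply: le_trans (nrmD_le _ _); rewrite addrA subrK. Qed.

Lemma dot0r H (x : H) : dot x 0 = 0.
Proof. by rewrite dotC dot0l conjc0. Qed.

Lemma dotNl H (x y : H) : dot (- x) y = - dot x y.
Proof. by rewrite -scaleN1r dotZl mulN1r. Qed.

Lemma dotNr H (x y : H) : dot x (- y) = - dot x y.
Proof. by rewrite dotC dotNl rmorphN /= -dotC. Qed.

Lemma dotBl H (x y z : H) : dot (x - y) z = dot x z - dot y z.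
Proof. by rewrite dotDl dotNl. Qed.

Lemma dotBr H (x y z : H) : dot x (y - z) = dot x y - dot x z.
Proof. by rewrite dotDr dotNr. Qed.

Lemma dot_eq0 H (x : H) : dot x x = 0 -> x = 0.
Proof. by rewrite dotxx => /eqP; rewrite sqrf_eq0 normr_eq0 => /eqP. Qed.

Lemma dot_suml H I (r : seq I) (P : pred I) (F : I -> H) y :
  dot (\sum_(i <- r | P i) F i) y = \sum_(i <- r | P i) dot (F i) y.
Proof. by apply: (big_morph (fun x : H => dot x y)) => [u v|]; rewrite ?dotDl ?dot0l. Qed.

Lemma nrm2D H (x y : H) :
  nrm (x + y) ^+ 2 = nrm x ^+ 2 + nrm y ^+ 2 + 2 * complex.Re (dot x y).
Proof.
rewrite !nrm2E dotDl !dotDr (dotC x y).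
by case: (dot x y) (dot x x) (dot y y) => a b [c d] [e f] /=; ring.
Qed.

Lemma nrm2B H (x y : H) :
  nrm (x - y) ^+ 2 = nrm x ^+ 2 + nrm y ^+ 2 - 2 * complex.Re (dot x y).
Proof. by rewrite nrm2D nrmN dotNr raddfN mulrN. Qed.

Lemma parallelogram H (x y : H) :
  nrm (x + y) ^+ 2 + nrm (x - y) ^+ 2 = 2 * (nrm x ^+ 2 + nrm y ^+ 2).
Proof. by rewrite nrm2D nrm2B; ring. Qed.

(** Both Cauchy-Schwarz and the orthogonality of projections come from
    subtracting from x its component along y. *)
Lemma nrm2_projection H (x y : H) : y != 0 ->
  nrm (x - (dot x y / dot y y) *: y) ^+ 2 =
  nrm x ^+ 2 - normc (dot x y) ^+ 2 / nrm y ^+ 2.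
Proof.
move=> y0; have ny : nrm y ^+ 2 != 0 by rewrite sqrf_eq0 nrm_eq0.
rewrite nrm2B nrmZ dotZr conjE dotxx_nrm; set c := dot x y; set n := nrm y ^+ 2.
have -> : (conjc (c / n%:C) * c) = (normc c ^+ 2 / n)%:C.
  rewrite -fmorphV conjcM conjc_real mulrAC [conjc c * c]mulrC mulJc.
  by rewrite -realcM.
rewrite -fmorphV exprMn normcM normc_real exprMn [complex.Re _]/=.
rewrite -normrX ger0_norm ?sqr_ge0// -/n.
by field.
Qed.

Lemma cauchy_schwarz H (x y : H) : normc (dot x y) <= nrm x * nrm y.
Proof.
have [->|y0] := eqVneq y 0; first by rewrite dot0r normc0 mulr_ge0 ?nrm_ge0.
have := sqr_ge0 (nrm (x - (dot x y / dot y y) *: y)).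
rewrite nrm2_projection// subr_ge0 ler_pdivrMr ?exprn_gt0 ?nrm_gt0//.
by rewrite -exprMn ler_sqr ?nnegrE ?mulr_ge0 ?nrm_ge0 ?normc_ge0.
Qed.

Lemma nrm_le_dot H (x : H) (c : R) : 0 <= c ->
  (forall y, normc (dot x y) <= c * nrm y) -> nrm x <= c.
Proof.
move=> c0 h; have [->|x0] := eqVneq x 0; first by rewrite nrm0.
have := h x; rewrite dotxx_nrm normc_real ger0_norm ?sqr_ge0// expr2.
by rewrite ler_pM2r ?nrm_gt0.
Qed.

(** Expanding at x + y and at i x + y separates B x y from B y x; over the reals
    only the symmetric part would vanish. *)
Lemma polarization H (B : H -> H -> R[i]) :
  (forall a x y t, B (a *: x + y) t = a * B x t + B y t) ->
  (forall a x y t, B t (a *: x + y) = conjc a * B t x + B t y) ->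
  (forall x, B x x = 0) -> forall x y, B x y = 0.
Proof.
move=> Bl Br B0 x y.
have h a : a * B x y + conjc a * B y x = 0.
  by have := B0 (a *: x + y); rewrite Bl !Br !B0 mulr0 add0r addr0.
have := h 1; rewrite conjc1 !mul1r => h1.
have := h (0 +i* 1); rewrite (_ : conjc (0 +i* 1) = - (0 +i* 1)); last first.
  by apply/eqP; rewrite eq_complex /= oppr0 !eqxx.
rewrite mulNr -mulrBr => /eqP; rewrite mulf_eq0 eq_complex /= eqxx oner_eq0 /=.
move=> /eqP h2; apply/eqP; have : B x y + B y x + (B x y - B y x) = 0 by rewrite h1 h2 addr0.
rewrite addrACA subrr addr0 -mulr2n => /eqP.
by rewrite mulrn_eq0.
Qed.

Lemma sesquilinear_ext H (B B' : H -> H -> R[i]) :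
  (forall a x y t, B (a *: x + y) t = a * B x t + B y t) ->
  (forall a x y t, B t (a *: x + y) = conjc a * B t x + B t y) ->
  (forall a x y t, B' (a *: x + y) t = a * B' x t + B' y t) ->
  (forall a x y t, B' t (a *: x + y) = conjc a * B' t x + B' t y) ->
  (forall x, B x x = B' x x) -> forall x y, B x y = B' x y.
Proof.
move=> Bl Br Bl' Br' BB' x y; apply/eqP; rewrite -subr_eq0; apply/eqP.
apply: (@polarization H (fun x y => B x y - B' x y)).
- by move=> a u v t; rewrite Bl Bl'; ring.
- by move=> a u v t; rewrite Br Br'; ring.
- by move=> u; rewrite BB' subrr.
Qed.

End inner_product.

Section completeness.
Context {R : realType} (H : hilbertType R).

Lemma cauchy_nrm_cvg (u : nat -> H) :
  (forall e : R, 0 < e -> exists N, forall n m, (N <= n)%N -> (N <= m)%N ->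
     nrm (u n - u m) < e) ->
  exists l : H, forall e : R, 0 < e -> exists N, forall n, (N <= n)%N ->
     nrm (l - u n) < e.
Proof.
move=> uc.
have real_pos (e : R[i]) : 0 < e -> exists2 d : R, 0 < d & e = d%:C.
  by case: e => a b; rewrite ltcE /= => /andP[/eqP -> a0]; exists a.
have /cauchy_cvg /cvg_ex[l ul] : cauchy (u @ \oo).
  apply/cauchyP => _ /real_pos[d d0 ->].
  have [N hN] := uc d d0; exists (u N); exists N => // n /= Nn.
  by rewrite -ball_normE /ball_ /= nrmE ltcR hN.
exists l => e e0.
have /cvg_ballP/(_ e%:C) := ul; rewrite ltcR => /(_ e0)[N _ hN].
by exists N => n /hN; rewrite -ball_normE /ball_ /= nrmE ltcR.
Qed.

End completeness.

Section projection.
Context {R : realType}.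
Implicit Types (H K : hilbertType R).

Lemma normcD_le (z t : R[i]) : normc (z + t) <= normc z + normc t.
Proof. exact: le_normcD. Qed.

Lemma normc_le0 (z : R[i]) : normc z <= 0 -> z = 0.
Proof. by move=> z0; apply/eqP; rewrite -normc_eq0 eq_le z0 normc_ge0. Qed.

Lemma invS_lt (e : R) : 0 < e -> exists N, forall n, (N <= n)%N -> (n.+1%:R^-1 : R) < e.
Proof.
move=> e0; have [N _ hN] := near_infty_natSinv_lt (PosNum e0).
by exists N => n Nn; exact: hN.
Qed.

Definition subspace H (D : set H) : Prop :=
  [/\ D 0, forall x y, D x -> D y -> D (x + y) & forall a x, D x -> D (a *: x)].

(** The minimizing sequence argument; D is not assumed closed, so that q is u
    minus the projection of u on the closure of D. *)
Lemma orthogonal_projection H (D : set H) (u : H) : subspace D ->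
  exists q, (forall e : R, 0 < e -> exists2 d, D d & nrm (q - (u - d)) < e) /\
    forall d, D d -> dot q d = 0.
Proof.
move=> [D0 DD DZ].
pose S := [set nrm (u - d) ^+ 2 | d in D].
have Slb : has_lbound S by exists 0 => _ [d _ <-]; exact: sqr_ge0.
have Sinf : has_inf S by split=> //; exists (nrm (u - 0) ^+ 2), 0.
have dlt n : exists d, D d /\ nrm (u - d) ^+ 2 < inf S + n.+1%:R^-1.
  have [|_ [d Dd <-] dS] := @inf_adherent R S n.+1%:R^-1 _ Sinf; last by exists d.
  by rewrite invr_gt0.
have [d dP] := choice dlt.
have Dd n : D (d n) by case: (dP n).
have dn n : nrm (u - d n) ^+ 2 < inf S + n.+1%:R^-1 by case: (dP n).
have Sle x : D x -> inf S <= nrm (u - x) ^+ 2 by move=> Dx; apply: ge_inf => //; exists x.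
(* The midpoint of two elements of D is again in D. *)
have cau n m : nrm (u - d n - (u - d m)) ^+ 2 < 2 * (n.+1%:R^-1 + m.+1%:R^-1).
  have := parallelogram (u - d n) (u - d m).
  have -> : u - d n + (u - d m) = 2 *: (u - 2^-1 *: (d n + d m)).
    rewrite scalerBr scalerA divff ?pnatr_eq0// scale1r scaler_nat mulr2n.
    by rewrite opprD addrACA.
  rewrite nrmZ exprMn.
  have -> : normc 2 = 2 :> R.
    by rewrite -[2 : R[i]]/(2%:R) -(rmorph_nat (real_complex R)) normc_real ger0_norm.
  have -> : 2 ^+ 2 = 4 :> R by ring.
  have := Sle (2^-1 *: (d n + d m)) (DZ _ _ (DD _ _ (Dd n) (Dd m))).
  have := dn n; have := dn m.
  move: (inf S) (n.+1%:R^-1) (m.+1%:R^-1) (_ ^+ 2) (_ ^+ 2) (_ ^+ 2) (_ ^+ 2) => a b c x1 x2 x3 x4.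
  by lra.
have [|q hq] := @cauchy_nrm_cvg R H (fun n => u - d n).
  move=> e e0; have e4 : 0 < e ^+ 2 / 4 by rewrite divr_gt0 ?exprn_gt0.
  have [N hN] := invS_lt e4; exists N => n m Nn Nm.
  rewrite -ltr_sqr ?nnegrE ?nrm_ge0 ?(ltW e0)//.
  apply: lt_le_trans (cau n m) _; have := hN n Nn; have := hN m Nm.
  by move: (n.+1%:R^-1) (m.+1%:R^-1) (e ^+ 2) => a b c; lra.
exists q; split=> [e /hq[N hN]|x Dx]; first by exists (d N) => //; exact: hN.
have [->|x0] := eqVneq x 0; first by rewrite dot0r.
apply: normc_le0; apply/ler_addgt0Pl => e e0; rewrite addr0.
have nx : 0 < nrm x by rewrite nrm_gt0.
have [N1 h1] := hq (e / 2 / nrm x) ltac:(by rewrite !divr_gt0).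
have [N2 h2] := @invS_lt ((e / 2 / nrm x) ^+ 2) ltac:(by rewrite exprn_gt0// !divr_gt0).
pose n := maxn N1 N2.
have := h1 n (leq_maxl _ _); have := h2 n (leq_maxr _ _); clear h1 h2 => h2 h1.
rewrite -[q](subrK (u - d n)) dotDl; apply: le_trans (normcD_le _ _) _.
rewrite (splitr e); apply: lerD.
  apply: le_trans (cauchy_schwarz _ _) _; rewrite -ler_pdivlMr//; exact: ltW.
rewrite -ler_sqr ?nnegrE ?normc_ge0//; last by rewrite divr_ge0 ?ltW.
(* Moving d n along x cannot go below the infimum, so its component is small. *)
have := nrm2_projection (u - d n) x0; set c := dot _ _ / _ => pe.
have : inf S <= nrm (u - d n - c *: x) ^+ 2.
  rewrite -addrA -opprD; apply: Sle; apply: DD => //; exact: DZ.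
rewrite pe; have := dn n; move: h2; rewrite expr_div_n => h2 h3 h4.
have : normc (dot (u - d n) x) ^+ 2 / nrm x ^+ 2 < (e / 2) ^+ 2 / nrm x ^+ 2.
  apply: lt_trans h2; rewrite -(ltrD2l (inf S)); apply: le_lt_trans h3.
  by rewrite -lerBrDr.
by rewrite ltr_pM2r ?invr_gt0 ?exprn_gt0// => /ltW.
Qed.

(** The representer is a multiple of the component of some u outside the kernel
    of phi that is orthogonal to this kernel; phi being continuous, it takes the
    same value at u and at this component. *)
Lemma riesz H (phi : H -> R[i]) :
  (forall a x y, phi (a *: x + y) = a * phi x + phi y) ->
  (exists M, forall x, normc (phi x) <= M * nrm x) ->
  exists z, forall x, phi x = dot x z.
Proof.
move=> lin [M hM].
have phi0 : phi 0 = 0.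
  by have /eqP := lin 1 0 0; rewrite scaler0 addr0 mul1r -subr_eq0 opprD addNKr oppr_eq0 => /eqP.
have phiD x y : phi (x + y) = phi x + phi y by rewrite -[x]scale1r lin mul1r scale1r.
have phiZ a x : phi (a *: x) = a * phi x by rewrite -[a *: x]addr0 lin phi0 addr0.
have phiB x y : phi (x - y) = phi x - phi y by rewrite -scaleN1r phiD phiZ mulN1r.
have [[u /eqP u0]|all0] := pselect (exists u, phi u <> 0); last first.
  by exists 0 => x; rewrite dot0r; apply: contrapT => x0; apply: all0; exists x.
have [|q [qlim qorth]] := @orthogonal_projection H [set x | phi x = 0] u.
  by split=> [|x y /= hx hy|a x /= hx]; rewrite ?phi0// ?phiD ?phiZ ?hx ?hy ?addr0 ?mulr0.
have qu : phi q = phi u.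
  apply/eqP; rewrite -subr_eq0; apply/eqP/normc_le0/ler_addgt0Pl => e e0; rewrite addr0.
  have M0 : 0 < `|M| + 1 by rewrite ltr_wpDl.
  have [d /= d0 dq] := qlim (e / (`|M| + 1)) ltac:(by rewrite divr_gt0).
  have -> : phi q - phi u = phi (q - (u - d)) by rewrite !phiB d0 subr0.
  apply: le_trans (hM _) _; apply: (@le_trans _ _ ((`|M| + 1) * nrm (q - (u - d)))).
    by rewrite ler_wpM2r ?nrm_ge0// (le_trans (ler_norm _))// lerDl.
  by rewrite mulrC -ler_pdivlMr// ltW.
rewrite -qu in u0.
have q0 : q != 0 by apply: contraNneq u0 => ->; rewrite phi0.
have dq0 : dot q q != 0 by apply: contra_neq q0; exact: dot_eq0.
exists ((conjc (phi q) / conjc (dot q q)) *: q) => x.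
have : dot (x - (phi x / phi q) *: q) q = 0.
  by rewrite dotC qorth ?conjc0//= phiB phiZ divfK ?subrr.
rewrite dotBl dotZl => /eqP; rewrite subr_eq0 dotZr conjE conjcM conjcK => /eqP ->.
have -> : conjc (conjc (dot q q))^-1 = (dot q q)^-1.
  by rewrite -dotC dotxx_nrm -fmorphV conjc_real.
by field; rewrite u0.
Qed.

End projection.

Section adjoint.
Context {R : realType}.
Implicit Types (H K : hilbertType R).

Section bounded_linear_theory.
Context H K (f : H -> K) (fb : bounded_linear f).

Lemma blD x y : f (x + y) = f x + f y.
Proof. by have [lin _] := fb; rewrite -[x]scale1r lin !scale1r. Qed.

Lemma bl0 : f 0 = 0.
Proof. by have /eqP := blD 0 0; rewrite addr0 -subr_eq0 opprD addNKr oppr_eq0 => /eqP. Qed.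

Lemma blZ a x : f (a *: x) = a *: f x.
Proof. by have [lin _] := fb; rewrite -[a *: x]addr0 lin bl0 addr0. Qed.

Lemma blN x : f (- x) = - f x.
Proof. by rewrite -scaleN1r blZ scaleN1r. Qed.

Lemma blB x y : f (x - y) = f x - f y.
Proof. by rewrite blD blN. Qed.

Lemma bl_ge0 : exists2 M : R, 0 <= M & forall x, nrm (f x) <= M * nrm x.
Proof.
have [_ [M hM]] := fb; exists `|M| => // x; apply: le_trans (hM x) _.
by rewrite ler_wpM2r ?nrm_ge0// ler_norm.
Qed.

Lemma adjP x y : dot (f x) y = dot x (adj f y).
Proof.
have [M M0 hM] := bl_ge0.
have [|| z hz] := @riesz R H (fun x => dot (f x) y).
- by move=> a v w; have [lin _] := fb; rewrite lin dotDl dotZl.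
- exists (M * nrm y) => v; apply: le_trans (cauchy_schwarz _ _) _.
  by rewrite mulrAC ler_wpM2r ?nrm_ge0.
by rewrite (adjE hz) hz.
Qed.

Lemma adjP' x y : dot y (f x) = dot (adj f y) x.
Proof. by rewrite dotC adjP -dotC. Qed.

Lemma adj_bounded : bounded_linear (adj f).
Proof.
split=> [a x y|].
  by apply: adjE => v; rewrite !dotDr !dotZr -!adjP.
have [M M0 hM] := bl_ge0; exists M => y.
apply: nrm_le_dot => [|x]; first by rewrite mulr_ge0 ?nrm_ge0.
rewrite -adjP' mulrAC mulrC; apply: le_trans (cauchy_schwarz _ _) _.
by rewrite ler_wpM2l ?nrm_ge0.
Qed.

End bounded_linear_theory.

Lemma dot_ext H (y z : H) : (forall x, dot y x = dot z x) -> y = z.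
Proof. by move=> yz; apply: dot_inj => x; rewrite dotC yz -dotC. Qed.

End adjoint.

(** * Bessel and Parseval families *)

Section l2_delta.
Context {R : realType} {I : choiceType} (w : I -> R).

Lemma nrm_l2 (u : l2 w) : nrm u ^+ 2 = l2_sq u.
Proof. by rewrite /nrm -[`|u|]/(l2_norm u) /l2_norm /= sqr_sqrtr ?l2_sq_ge0. Qed.

Lemma l2_ext (u v : l2 w) : (forall x, u x = v x) -> u = v.
Proof. by move=> uv; apply: val_inj; apply/funext. Qed.

Lemma esum_supp1 (f : I -> \bar R) x : (forall y, 0 <= f y)%E ->
  (forall y, y != x -> f y = 0%E) -> (\esum_(y in [set: I]) f y = f x)%E.
Proof.
move=> f0 fx; rewrite -[RHS](@esum_set1 R I x f)// [RHS]esum_mkcond.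
by apply: eq_esum => y _; case: ifPn => //; rewrite in_set1 => /fx.
Qed.

Lemma rsum_supp1 (f : I -> R) x : (forall y, y != x -> f y = 0) -> rsum f = f x.
Proof.
move=> fx; rewrite /rsum !(@esum_supp1 _ x) => [|y|y yx|y|y yx]; last 4 first.
- by rewrite lee_fin le_max lexx orbT.
- by rewrite fx// oppr0 maxxx.
- by rewrite lee_fin le_max lexx orbT.
- by rewrite fx// maxxx.
exact: posnegB.
Qed.

(** The second condition zeroes delta at the points of weight zero, where every
    element of l2 vanishes. *)
Definition delta_fun (x : I) : I -> R[i] :=
  fun y => if (y == x) && (0 < w x) then 1 else 0.

Lemma delta_subproof x : delta_fun x \in l2_mem w.
Proof.
rewrite unfold_in; apply: asboolT; split=> [y wy|].
  by rewrite /delta_fun; case: eqP => // <-; rewrite (negPf wy).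
rewrite (@esum_supp1 _ x) ?ltry// => [y|y yx]; last first.
  by rewrite /l2_term /delta_fun (negPf yx) normc0 expr0n mulr0.
rewrite lee_fin /l2_term /delta_fun; case: ifP => [/andP[/eqP -> w0]|_].
  by rewrite mulr_ge0 ?sqr_ge0// ltW.
by rewrite normc0 expr0n mulr0.
Qed.

Definition delta x : l2 w := L2 (delta_subproof x).

Lemma dot_delta (u : l2 w) x : dot u (delta x) = (w x)%:C * u x.
Proof.
have supp y : y != x -> (w y)%:C * u y * conjc (delta x y) = 0.
  by move=> yx; rewrite /= /delta_fun (negPf yx) conjc0 mulr0.
rewrite -[LHS]/(csum (fun y => (w y)%:C * u y * conjc (delta x y))) /csum.
rewrite !(@rsum_supp1 _ x) => [|y /supp ->|y /supp ->]//.
rewrite /= /delta_fun eqxx /=; case: ifPn => [_|wx].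
  by rewrite conjc1 mulr1; case: (_ * _).
by rewrite l2_suppE// !mulr0 mul0r.
Qed.

End l2_delta.

Section families.
Context {R : realType}.
Implicit Types (A B : hilbertType R) (I : choiceType).

(** Families are indexed by types and may contain zero vectors, so that a subset
    of A, such as an orthonormal basis, can be indexed by A itself. *)
Definition energy A I (c : I -> A) (t : A) : \bar R :=
  (\esum_(i in [set: I]) (normc (dot t (c i)) ^+ 2)%:E)%E.

Definition bessel_family A I (M : R) (c : I -> A) : Prop :=
  forall t, (energy c t <= (M * nrm t ^+ 2)%:E)%E.

Definition parseval_family A I (c : I -> A) : Prop :=
  forall t, energy c t = (nrm t ^+ 2)%:E.

Lemma parseval_bessel A I (c : I -> A) : parseval_family c -> bessel_family 1 c.
Proof. by move=> cP t; rewrite cP mul1r. Qed.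

Section analysis.
Context A I (M : R) (c : I -> A) (cB : bessel_family M c).

Lemma analysis_subproof t : (fun i => dot t (c i)) \in l2_mem (fun _ : I => 1 : R).
Proof.
rewrite unfold_in; apply: asboolT; split=> [y|]; first by rewrite ltr01.
rewrite (eq_esum (b := fun i => (normc (dot t (c i)) ^+ 2)%:E)).
  by apply: le_lt_trans (cB t) _; rewrite ltry.
by move=> i _; rewrite /l2_term mul1r.
Qed.

Definition analysis t : l2 (fun _ : I => 1 : R) := L2 (analysis_subproof t).

Lemma nrm_analysis t : (nrm (analysis t) ^+ 2)%:E = energy c t.
Proof.
by rewrite nrm_l2 l2_sqE; apply: eq_esum => i _; rewrite /l2_term mul1r.
Qed.

Lemma analysis_bounded : bounded_linear analysis.
Proof.
split=> [a x y|].
  by apply: l2_ext => i; rewrite l2D l2Z /= dotDl dotZl.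
exists (Num.sqrt `|M|) => x; rewrite -ler_sqr ?nnegrE ?nrm_ge0//; last first.
  by rewrite mulr_ge0 ?nrm_ge0 ?sqrtr_ge0.
rewrite -lee_fin nrm_analysis; apply: le_trans (cB x) _.
by rewrite lee_fin exprMn sqr_sqrtr// ler_wpM2r ?sqr_ge0// ler_norm.
Qed.

End analysis.

Lemma parseval_dot A I (c : I -> A) (cB : bessel_family 1 c) : parseval_family c ->
  forall x y, dot (analysis cB x) (analysis cB y) = dot x y.
Proof.
move=> cP; have [lin _] := analysis_bounded cB.
apply: sesquilinear_ext => [a u v t|a u v t|a u v t|a u v t|u].
- by rewrite lin dotDl dotZl.
- by rewrite lin dotDr dotZr.
- by rewrite dotDl dotZl.
- by rewrite dotDr dotZr.
- by rewrite !dotxx_nrm; congr _%:C; apply: EFin_inj; rewrite nrm_analysis cP.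
Qed.

(** The device by which all bounded operators below are constructed: U is the
    adjoint of the analysis operator of b after the analysis operator of c. *)
Lemma operator_of_families A B I (M : R) (c : I -> A) (b : I -> B) :
  bessel_family M c -> parseval_family b ->
  exists U : A -> B, bounded_linear U /\
    forall t y, (forall i, dot t (c i) = dot y (b i)) -> U t = y.
Proof.
move=> cB bP; have bB := parseval_bessel bP.
exists (adj (analysis bB) \o analysis cB); split.
  apply: bounded_linear_comp (analysis_bounded cB).
  exact: adj_bounded (analysis_bounded bB).
move=> t y ty /=; rewrite (_ : analysis cB t = analysis bB y); last exact: l2_ext.
by apply: adjE => x; rewrite parseval_dot.
Qed.

(** Norms at most one, instead of exactly one, allow for zero vectors. *)
Lemma orthogonal_bessel A I (c : I -> A) :
  (forall i j, i != j -> dot (c i) (c j) = 0) -> (forall i, nrm (c i) <= 1) ->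
  bessel_family 1 c.
Proof.
move=> cO c1 t; apply: ge_ereal_sup => _ [F [finF _] <-]; rewrite fsumEFin// lee_fin mul1r.
rewrite fsbig_finite//=; set s := finmap.enum_fset _.
have : uniq s by exact: finmap.fset_uniq.
elim: s t => [|i s IH] t /=; first by rewrite big_nil sqr_ge0.
move=> /andP[si us]; rewrite big_cons.
have := IH (t - dot t (c i) *: c i) us.
rewrite (eq_big_seq (fun j => normc (dot t (c j)) ^+ 2)); last first.
  move=> j sj; rewrite dotBl dotZl cO ?mulr0 ?subr0//.
  by apply: contraNneq si => ->.
rewrite nrm2B nrmZ dotZr conjE [conjc _ * _]mulrC mulJc [complex.Re _]/=.
have := c1 i; set n := normc _; set S := \sum_(_ <- _) _ => n1 h.
have : (n * nrm (c i)) ^+ 2 <= n ^+ 2.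
  rewrite ler_sqr ?nnegrE ?mulr_ge0 ?nrm_ge0 ?normc_ge0//.
  by rewrite ler_piMr// normc_ge0.
by move: h; move: (_ ^+ 2) (_ ^+ 2) (_ ^+ 2) => *; lra.
Qed.

Definition onb_family A (e : A) : A := if e \in onb A then e else 0.

Lemma onb_orthogonal A (e f : A) : e != f -> dot (onb_family e) (onb_family f) = 0.
Proof.
have [oB _] := onbP A; rewrite /onb_family => /negPf ef.
case: ifPn => [/set_mem Be|_]; last by rewrite dot0l.
case: ifPn => [/set_mem Bf|_]; last by rewrite dot0r.
by rewrite oB// ef.
Qed.

Lemma onb_norm A (e : A) : onb A e -> nrm e = 1.
Proof.
move=> Be; have [oB _] := onbP A; have := oB e e Be Be; rewrite eqxx dotxx_nrm => /complexI h.
by apply/eqP; rewrite -(@eqrXn2 _ 2) ?nrm_ge0// expr1n; apply/eqP.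
Qed.

(** A unit vector orthogonal to the basis would enlarge it. *)
Lemma onb_complete A (y : A) : (forall e, onb A e -> dot y e = 0) -> y = 0.
Proof.
move=> yB; apply: contrapT => /eqP y0; have [oB Bmax] := onbP A.
pose f := ((nrm y)^-1)%:C *: y.
have ny : nrm y != 0 by rewrite nrm_eq0.
have fy : dot f f = 1.
  by rewrite dotxx_nrm nrmZ normc_real ger0_norm ?invr_ge0 ?nrm_ge0// mulVf// expr1n.
have fB e : onb A e -> dot f e = 0 by move=> Be; rewrite dotZl yB// mulr0.
have BfB : onb A `|` [set f] = onb A.
  apply: Bmax; last by move=> x Bx; left.
  move=> u v [Bu|->] [Bv|->].
  - exact: oB.
  - have [uf|_] := eqVneq u f; last by rewrite dotC fB// conjc0.
    by have := fB u Bu; rewrite uf fy => /eqP; rewrite oner_eq0.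
  - have [uf|_] := eqVneq f v; last by rewrite fB.
    by have := fB v Bv; rewrite -uf fy => /eqP; rewrite oner_eq0.
  - by rewrite eqxx.
have Bf : onb A f by rewrite -BfB; right.
by have := fB f Bf; rewrite fy => /eqP; rewrite oner_eq0.
Qed.

Lemma onb_bessel A : bessel_family 1 (@onb_family A).
Proof.
apply: orthogonal_bessel; first exact: onb_orthogonal.
by move=> e; rewrite /onb_family; case: ifPn => [/set_mem/onb_norm ->//|_]; rewrite nrm0.
Qed.

(** With T the analysis operator, x and T^* T x have the same coordinates, hence
    they agree by completeness of the basis, and |T x|^2 = <x, T^* T x> = |x|^2. *)
Lemma onb_parseval A : parseval_family (@onb_family A).
Proof.
move=> x; have B1 := @onb_bessel A; rewrite -(nrm_analysis B1); congr EFin.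
have Tb := analysis_bounded B1.
rewrite !nrm2E (adjP Tb); congr (complex.Re (dot x _)).
apply/eqP; rewrite eq_sym -subr_eq0; apply/eqP/onb_complete => e Be.
have ee : onb_family e = e by rewrite /onb_family mem_set.
rewrite dotBl -(adjP' Tb).
have -> : analysis B1 e = delta (fun _ : A => 1 : R) e.
  apply: l2_ext => f /=; rewrite /delta_fun ltr01 andbT.
  have [->|fe] := eqVneq f e; last by rewrite -{1}ee onb_orthogonal// eq_sym.
  by rewrite ee dotxx_nrm onb_norm// expr1n.
by rewrite dot_delta mul1r /= ee subrr.
Qed.

End families.

(** * The Hilbert tensor product *)

Section tensor.
Context {R : realType}.
Implicit Types (H K L : hilbertType R).

Lemma esum_pair (I J : choiceType) (F : I -> J -> \bar R) : (forall i j, 0 <= F i j)%E ->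
  (\esum_(p in [set: I * J]) F p.1 p.2 = \esum_(i in [set: I]) \esum_(j in [set: J]) F i j)%E.
Proof.
move=> F0; rewrite esum_esum//; congr esum.
by apply/seteqP; split.
Qed.

Lemma esum_swap (I J : choiceType) (F : I -> J -> \bar R) : (forall i j, 0 <= F i j)%E ->
  (\esum_(i in [set: I]) \esum_(j in [set: J]) F i j =
   \esum_(j in [set: J]) \esum_(i in [set: I]) F i j)%E.
Proof.
move=> F0; rewrite -!esum_pair//.
apply: (@reindex_esum _ _ _ [set: J * I] [set: I * J] (fun p => (p.2, p.1))
  (fun p => F p.1 p.2)).
split=> [//|[i j] [k l] _ _ /= [-> ->]//|[i j] _].
by exists (j, i).
Qed.

Lemma pureDl H K a (x y : H) (z : K) : pure (a *: x + y) z = a *: pure x z + pure y z.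
Proof.
apply: l2_ext => p; rewrite l2D l2Z /= /pure_fun.
by case: ifP => _; rewrite ?mulr0 ?addr0// dotDl dotZl; ring.
Qed.

Lemma pureDr H K a (x : H) (y z : K) : pure x (a *: y + z) = a *: pure x y + pure x z.
Proof.
apply: l2_ext => p; rewrite l2D l2Z /= /pure_fun.
by case: ifP => _; rewrite ?mulr0 ?addr0// dotDl dotZl; ring.
Qed.

Lemma coef2E H (x e : H) : coef2 x e = normc (dot x (onb_family e)) ^+ 2.
Proof. by rewrite /coef2 /onb_family; case: ifP => // _; rewrite dot0r normc0 expr0n. Qed.

Lemma nrm_htensor H K (t : htensor H K) : (nrm t ^+ 2)%:E =
  (\esum_(p in [set: H * K]) (l2_term (\1_(onb H `*` onb K)) t p)%:E)%E.
Proof. by rewrite -l2_sqE -nrm_l2. Qed.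

Lemma nrm_pure H K (x : H) (y : K) : nrm (pure x y) = nrm x * nrm y.
Proof.
apply/eqP; rewrite -(@eqrXn2 _ 2) ?mulr_ge0 ?nrm_ge0//; apply/eqP/EFin_inj.
rewrite nrm_htensor exprMn [RHS]EFinM.
rewrite (eq_esum (b := fun p => (coef2 x p.1 * coef2 y p.2)%:E)); last first.
  move=> p _; congr EFin; rewrite /l2_term indicE /= /pure_fun /coef2 in_setX.
  have [_|_] := boolP (p.1 \in onb H); have [_|_] := boolP (p.2 \in onb K);
    rewrite /= ?mul1r ?mul0r ?mulr0//.
  by rewrite normcM exprMn.
rewrite (@esum_pair _ _ (fun e f => (coef2 x e * coef2 y f)%:E)); last first.
  by move=> e f; rewrite lee_fin mulr_ge0 ?coef2_ge0.
have coefE (G : hilbertType R) (z : G) : (\esum_(f in [set: G]) (coef2 z f)%:E)%E = (nrm z ^+ 2)%:E.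
  by rewrite -onb_parseval; apply: eq_esum => f _; rewrite coef2E.
under eq_esum do rewrite esumZ ?coef2_ge0// coefE -EFinM mulrC.
by rewrite esumZ ?sqr_ge0// coefE muleC.
Qed.

Lemma purel_bounded H K (y : K) : bounded_linear (fun x : H => pure x y).
Proof.
split=> [a u v|]; first exact: pureDl.
by exists (nrm y) => x; rewrite nrm_pure mulrC.
Qed.

Lemma purer_bounded H K (x : H) : bounded_linear (fun y : K => pure x y).
Proof.
split=> [a u v|]; first exact: pureDr.
by exists (nrm x) => y; rewrite nrm_pure.
Qed.

Lemma pure0l H K (y : K) : pure (0 : H) y = 0. Proof. exact: bl0 (purel_bounded H y). Qed.
Lemma pure0r H K (x : H) : pure x (0 : K) = 0. Proof. exact: bl0 (purer_bounded K x). Qed.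

(** The diagonal case is the norm of elementary tensors; polarization is applied
    in each factor in turn. *)
Lemma dot_pure H K (x x' : H) (y y' : K) :
  dot (pure x y) (pure x' y') = dot x x' * dot y y'.
Proof.
have diag (z : K) u v : dot (pure u z) (pure v z) = dot u v * dot z z.
  move: u v; apply: sesquilinear_ext => [a s t r|a s t r|a s t r|a s t r|s].
  - by rewrite pureDl dotDl dotZl.
  - by rewrite pureDl dotDr dotZr.
  - by rewrite dotDl dotZl; ring.
  - by rewrite dotDr dotZr; ring.
  - by rewrite !dotxx_nrm nrm_pure exprMn realcM.
move: y y'; apply: sesquilinear_ext => [a s t r|a s t r|a s t r|a s t r|s].
- by rewrite pureDr dotDl dotZl.
- by rewrite pureDr dotDr dotZr.
- by rewrite dotDl dotZl; ring.
- by rewrite dotDr dotZr; ring.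
- exact: diag.
Qed.

Definition tensor_family H K (I J : choiceType) (a : I -> H) (b : J -> K) (p : I * J) :=
  pure (a p.1) (b p.2).

Lemma energy_onb_tensor H K (t : htensor H K) :
  energy (tensor_family (@onb_family R H) (@onb_family R K)) t = (nrm t ^+ 2)%:E.
Proof.
rewrite nrm_htensor; apply: eq_esum => -[e f] _; congr EFin.
rewrite /l2_term indicE in_setX /tensor_family /onb_family.
rewrite -![(e, f).1]/e -![(e, f).2]/f.
have [Be|_] := boolP (e \in onb H); last by rewrite pure0l dot0r normc0 expr0n mul0r.
have [Bf|_] := boolP (f \in onb K); last by rewrite pure0r dot0r normc0 expr0n mul0r.
rewrite mul1r; congr (normc _ ^+ 2).
rewrite (_ : pure e f = delta _ (e, f)).
  by rewrite dot_delta indicE in_setX Be Bf mul1r.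
have [oH _] := onbP H; have [oK _] := onbP K.
apply: l2_ext => -[e' f'] /=; rewrite /pure_fun /delta_fun !indicE !in_setX Be Bf ltr01 andbT /=.
rewrite xpair_eqE; case: ifPn => [/andP[/set_mem Be' /set_mem Bf']|].
  rewrite (oH _ _ (set_mem Be) Be') (oK _ _ (set_mem Bf) Bf') [e == e']eq_sym [f == f']eq_sym.
  by case: (e' == e); case: (f' == f); rewrite ?mulr1 ?mulr0 ?mul0r.
by case: (eqVneq e' e) => [->|//]; case: (eqVneq f' f) => [->|//]; rewrite Be Bf.
Qed.

Lemma tensor_ext H K (t t' : htensor H K) :
  (forall x y, dot t (pure x y) = dot t' (pure x y)) -> t = t'.
Proof.
move=> tt'; apply/eqP; rewrite -subr_eq0 -nrm_eq0 -sqrf_eq0; apply/eqP/EFin_inj.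
rewrite -energy_onb_tensor [LHS]esum1// => p _.
by rewrite dotBl tt' subrr normc0 expr0n.
Qed.

(** Density of elementary tensors, in the form needed to compute the adjoint of D
    at a given vector z. *)
Lemma tensor_dual_ext H K L (D : htensor H K -> L) (z : L) (z' : htensor H K) :
  bounded_linear D ->
  (forall a b, dot (D (pure a b)) z = dot (pure a b) z') ->
  forall t, dot (D t) z = dot t z'.
Proof.
move=> Db Dz t; rewrite (adjP Db); congr dot.
by apply: tensor_ext => a b; rewrite dotC -(adjP Db) Dz -dotC.
Qed.

Lemma tensor_map_ext H K L (D E : htensor H K -> L) :
  bounded_linear D -> bounded_linear E ->
  (forall a b, D (pure a b) = E (pure a b)) -> D = E.
Proof.
move=> Db Eb DE; apply/funext => t; apply: dot_ext => z.
by rewrite (adjP Eb); apply: tensor_dual_ext => // a b; rewrite DE (adjP Eb).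
Qed.

(** Slicing: the sum over the second index of the energies of the slices of t
    is compared with the energy for another family in the first factor. *)
Lemma energy_tensorl H K (I I' J : choiceType) (M : R) (a : I -> H) (a' : I' -> H)
    (b : J -> K) t : 0 <= M -> bessel_family M a -> parseval_family a' ->
  (energy (tensor_family a b) t <= M%:E * energy (tensor_family a' b) t)%E.
Proof.
move=> M0 aB aP; have F0 (z : R[i]) : (0 <= (normc z ^+ 2)%:E)%E by rewrite lee_fin sqr_ge0.
pose sl y := adj (fun x : H => pure x y) t.
have slE x y : dot t (pure x y) = dot (sl y) x by rewrite (adjP' (purel_bounded H y)).
have eE (I0 : choiceType) (c : I0 -> H) :
    energy (tensor_family c b) t = (\esum_(j in [set: J]) energy c (sl (b j)))%E.
  rewrite /energy (@esum_pair _ _ (fun i j => (normc (dot t (pure (c i) (b j))) ^+ 2)%:E))//.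
  by rewrite esum_swap//; apply: eq_esum => j _; apply: eq_esum => i _; rewrite slE.
rewrite !eE [X in (M%:E * X)%E](eq_esum (b := fun j => (nrm (sl (b j)) ^+ 2)%:E)).
  by rewrite -esumZ//; apply: le_esum => j _; exact: aB.
by move=> j _; exact: aP.
Qed.

Lemma energy_tensorr H K (I J J' : choiceType) (M : R) (a : I -> H) (b : J -> K)
    (b' : J' -> K) t : 0 <= M -> bessel_family M b -> parseval_family b' ->
  (energy (tensor_family a b) t <= M%:E * energy (tensor_family a b') t)%E.
Proof.
move=> M0 bB bP; have F0 (z : R[i]) : (0 <= (normc z ^+ 2)%:E)%E by rewrite lee_fin sqr_ge0.
pose sl x := adj (fun y : K => pure x y) t.
have slE x y : dot t (pure x y) = dot (sl x) y by rewrite (adjP' (purer_bounded K x)).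
have eE (J0 : choiceType) (c : J0 -> K) :
    energy (tensor_family a c) t = (\esum_(i in [set: I]) energy c (sl (a i)))%E.
  rewrite /energy (@esum_pair _ _ (fun i j => (normc (dot t (pure (a i) (c j))) ^+ 2)%:E))//.
  by apply: eq_esum => i _; apply: eq_esum => j _; rewrite slE.
rewrite !eE [X in (M%:E * X)%E](eq_esum (b := fun i => (nrm (sl (a i)) ^+ 2)%:E)).
  by rewrite -esumZ//; apply: le_esum => i _; exact: bB.
by move=> i _; exact: bP.
Qed.

Lemma tensor_bessel H K (I J : choiceType) (M N : R) (a : I -> H) (b : J -> K) :
  0 <= M -> 0 <= N -> bessel_family M a -> bessel_family N b ->
  bessel_family (M * N) (tensor_family a b).
Proof.
move=> M0 N0 aB bB t; apply: le_trans (energy_tensorl _ _ M0 aB (@onb_parseval R H)) _.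
rewrite -mulrA EFinM; apply: lee_wpmul2l; first by rewrite lee_fin.
apply: le_trans (energy_tensorr _ _ N0 bB (@onb_parseval R K)) _.
by rewrite energy_onb_tensor.
Qed.

(** Two Bessel bounds with constant 1, one against the basis and one from it,
    enclose the energy. *)
Lemma tensor_parseval H K (I J : choiceType) (a : I -> H) (b : J -> K) :
  parseval_family a -> parseval_family b -> parseval_family (tensor_family a b).
Proof.
move=> aP bP t; apply/eqP; rewrite eq_le; apply/andP; split.
  have := tensor_bessel ler01 ler01 (parseval_bessel aP) (parseval_bessel bP) t.
  by rewrite !mul1r.
rewrite -energy_onb_tensor.
apply: le_trans (energy_tensorl _ _ ler01 (@onb_bessel R H) aP) _; rewrite mul1e.
by apply: le_trans (energy_tensorr _ _ ler01 (@onb_bessel R K) bP) _; rewrite mul1e.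
Qed.

Lemma adj_family_bessel H K (f : H -> K) (I : choiceType) (b : I -> K) :
  bounded_linear f -> parseval_family b ->
  exists2 M : R, 0 <= M & bessel_family M (fun i => adj f (b i)).
Proof.
move=> fb bP; have [M M0 hM] := bl_ge0 fb; exists (M ^+ 2); first exact: sqr_ge0.
move=> t; rewrite /energy.
under eq_esum do rewrite -(adjP fb).
rewrite [leLHS]bP lee_fin -exprMn ler_sqr ?nnegrE ?mulr_ge0 ?nrm_ge0//.
Qed.

Lemma tmapP H1 H2 K1 K2 (f : H1 -> K1) (g : H2 -> K2) :
  bounded_linear f -> bounded_linear g ->
  bounded_linear (tmap f g) /\ forall x y, tmap f g (pure x y) = pure (f x) (g y).
Proof.
move=> fb gb; apply: (@xgetPex _ (fun=> 0) [set h | bounded_linear h /\ _]).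
have [M M0 fB] := adj_family_bessel fb (@onb_parseval R K1).
have [N N0 gB] := adj_family_bessel gb (@onb_parseval R K2).
have [U [Ub UE]] := operator_of_families (tensor_bessel M0 N0 fB gB)
  (tensor_parseval (@onb_parseval R K1) (@onb_parseval R K2)).
exists U; split=> // x y; apply: UE => -[e e'].
by rewrite /tensor_family /= !dot_pure (adjP fb) (adjP gb).
Qed.

Lemma triple_parseval_l H K L : parseval_family
  (fun p : H * K * L => pure (pure (onb_family p.1.1) (onb_family p.1.2)) (onb_family p.2)).
Proof.
have h1 := tensor_parseval (@onb_parseval R H) (@onb_parseval R K).
exact: tensor_parseval h1 (@onb_parseval R L).
Qed.

(** Both bracketings of the triple products are indexed by the same type, so that
    operator_of_families can match them. *)
Lemma triple_parseval_r H K L : parseval_family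
  (fun p : H * K * L => pure (onb_family p.1.1) (pure (onb_family p.1.2) (onb_family p.2))).
Proof.
have h1 := tensor_parseval (@onb_parseval R K) (@onb_parseval R L).
have h2 := tensor_parseval (@onb_parseval R H) h1.
move=> t; rewrite -[RHS]h2 /energy; symmetry.
apply: (@reindex_esum _ _ _ [set: H * K * L] [set: H * (K * L)]
  (fun p => (p.1.1, (p.1.2, p.2))) (fun p => (normc (dot t (tensor_family _ _ p)) ^+ 2)%:E)).
split=> [//|[[i j] k] [[i' j'] k'] _ _ /= [-> -> ->]//|[i [j k]] _].
by exists (i, j, k).
Qed.

Lemma tassocP H K L : bounded_linear (tassoc H K L) /\
  forall x y z, tassoc H K L (pure (pure x y) z) = pure x (pure y z).
Proof.
apply: (@xgetPex _ (fun=> 0) [set h | bounded_linear h /\ _]).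
have [U [Ub UE]] := operator_of_families (parseval_bessel (@triple_parseval_l H K L))
  (@triple_parseval_r H K L).
by exists U; split=> // x y z; apply: UE => p; rewrite !dot_pure mulrA.
Qed.

Lemma tassocVP H K L : bounded_linear (tassocV H K L) /\
  forall x y z, tassocV H K L (pure x (pure y z)) = pure (pure x y) z.
Proof.
apply: (@xgetPex _ (fun=> 0) [set h | bounded_linear h /\ _]).
have [U [Ub UE]] := operator_of_families (parseval_bessel (@triple_parseval_r H K L))
  (@triple_parseval_l H K L).
by exists U; split=> // x y z; apply: UE => p; rewrite !dot_pure mulrA.
Qed.

End tensor.

(** * The Frobenius identity *)

Section frobenius.
Context {R : realType} (H : hilbertType R) (mu : htensor H H -> H).
Context (mub : bounded_linear mu).

Lemma mull_bounded (x : H) : bounded_linear (fun y => mu (pure x y)).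
Proof. exact: bounded_linear_comp mub (purer_bounded H x). Qed.

Lemma mull_adj (x y z : H) :
  dot (mu (pure x y)) z = dot y (adj (fun t => mu (pure x t)) z).
Proof. exact: adjP (mull_bounded x) y z. Qed.

(** On elementary tensors t, mapping x (x) t through the associator and the
    multiplication is adjoint to mapping u (x) v to L_x^* u (x) v; by density this
    applies to t the comultiplication of y, which then moves across the product. *)
Lemma frob_left_dot x y u v :
  dot (tmap mu id (tassocV H H H (tmap id (adj mu) (pure x y)))) (pure u v) =
  dot y (mu (pure (adj (fun z => mu (pure x z)) u) v)).
Proof.
have [m1b m1E] := tmapP mub (bounded_linear_id H).
have [m2b m2E] := tmapP (bounded_linear_id H) (adj_bounded mub).
have [ab aE] := tassocVP H H H.
rewrite m2E (adjP' mub).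
apply: (@tensor_dual_ext _ _ _ _ (fun t => tmap mu id (tassocV H H H (pure x t)))).
  exact: bounded_linear_comp m1b (bounded_linear_comp ab (purer_bounded _ x)).
by move=> a b; rewrite aE m1E !dot_pure mull_adj.
Qed.

Lemma frob_right_dot x y u v : (forall a b, mu (pure a b) = mu (pure b a)) ->
  dot (tmap id mu (tassoc H H H (tmap (adj mu) id (pure x y)))) (pure u v) =
  dot x (mu (pure u (adj (fun z => mu (pure y z)) v))).
Proof.
move=> muC.
have [m1b m1E] := tmapP (bounded_linear_id H) mub.
have [m2b m2E] := tmapP (adj_bounded mub) (bounded_linear_id H).
have [ab aE] := tassocP H H H.
rewrite m2E (adjP' mub).
apply: (@tensor_dual_ext _ _ _ _ (fun t => tmap id mu (tassoc H H H (pure t y)))).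
  exact: bounded_linear_comp m1b (bounded_linear_comp ab (purel_bounded _ y)).
by move=> a b; rewrite aE m1E !dot_pure muC mull_adj.
Qed.

(** Tested against elementary tensors, either Frobenius equation says that the
    adjoint of the multiplication by x commutes with all multiplications. *)
Lemma frobsem_of_adjoint_multiplier :
  (forall x y z, mu (pure (mu (pure x y)) z) = mu (pure x (mu (pure y z)))) ->
  (forall x y, mu (pure x y) = mu (pure y x)) ->
  (forall x u v, adj (fun z => mu (pure x z)) (mu (pure u v)) =
     mu (pure (adj (fun z => mu (pure x z)) u) v)) ->
  is_frobsem mu.
Proof.
move=> muA muC muF.
have mu2b : bounded_linear (adj mu \o mu) := bounded_linear_comp (adj_bounded mub) mub.
have dotF x y u v : dot (adj mu (mu (pure x y))) (pure u v) =
    dot y (mu (pure (adj (fun z => mu (pure x z)) u) v)).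
  by rewrite -(adjP' mub) mull_adj muF.
have [m1b _] := tmapP mub (bounded_linear_id H).
have [m2b _] := tmapP (bounded_linear_id H) (adj_bounded mub).
have [n1b _] := tmapP (bounded_linear_id H) mub.
have [n2b _] := tmapP (adj_bounded mub) (bounded_linear_id H).
have [ab _] := tassocP H H H; have [bb _] := tassocVP H H H.
split=> //.
- apply: tensor_map_ext => //.
    exact: bounded_linear_comp (bounded_linear_comp m1b bb) m2b.
  by move=> a b; apply: tensor_ext => u v; rewrite [LHS]frob_left_dot [RHS]dotF.
- apply: tensor_map_ext => //.
    exact: bounded_linear_comp (bounded_linear_comp n1b ab) n2b.
  move=> a b; apply: tensor_ext => u v; rewrite [LHS]frob_right_dot//.
  rewrite -[RHS]/(dot (adj mu (mu (pure a b))) (pure u v)) -(adjP' mub).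
  by rewrite [mu (pure a b)]muC mull_adj [mu (pure u v)]muC muF; congr dot; exact: muC.
Qed.

Lemma adjoint_multiplier : is_frobsem mu -> forall x u v,
  adj (fun z => mu (pure x z)) (mu (pure u v)) =
  mu (pure (adj (fun z => mu (pure x z)) u) v).
Proof.
move=> F x u v; apply: dot_inj => y; rewrite -mull_adj.
rewrite -frob_left_dot.
have /(congr1 (fun D => D (pure x y))) := frob_left F; rewrite /comp => ->.
by rewrite -(adjP' mub).
Qed.

End frobenius.

(** * Group-like elements *)

Section grouplikes.
Context {R : realType} (H : frobsem R).
Implicit Types (x y z u v g h : H).

Local Notation "x ** y" := (fs_mul x y) (at level 40, left associativity).

Definition adjmul x : H -> H := adj (fs_mul x).

Lemma fs_mu_bounded : bounded_linear (@fs_mu R H).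
Proof. exact: frob_bounded (fsP H). Qed.

Lemma fs_mul_bounded x : bounded_linear (fs_mul x).
Proof. exact: mull_bounded fs_mu_bounded x. Qed.

Lemma fs_mulC x y : x ** y = y ** x.
Proof. exact: frob_comm (fsP H) x y. Qed.

Lemma fs_mulA x y z : x ** (y ** z) = x ** y ** z.
Proof. by rewrite /fs_mul (frob_assoc (fsP H)). Qed.

Lemma fs_mulCA x y z : x ** (y ** z) = y ** (x ** z).
Proof. by rewrite fs_mulA [x ** y]fs_mulC -fs_mulA. Qed.

Lemma fs_mulDr x y z : x ** (y + z) = x ** y + x ** z.
Proof. exact: blD (fs_mul_bounded x) y z. Qed.

Lemma fs_mulBr x y z : x ** (y - z) = x ** y - x ** z.
Proof. exact: blB (fs_mul_bounded x) y z. Qed.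

Lemma fs_mulZr a x y : x ** (a *: y) = a *: (x ** y).
Proof. exact: blZ (fs_mul_bounded x) a y. Qed.

Lemma fs_mul0r x : x ** 0 = 0.
Proof. exact: bl0 (fs_mul_bounded x). Qed.

Lemma fs_mulDl x y z : (x + y) ** z = x ** z + y ** z.
Proof. by rewrite fs_mulC fs_mulDr ![z ** _]fs_mulC. Qed.

Lemma fs_mulBl x y z : (x - y) ** z = x ** z - y ** z.
Proof. by rewrite fs_mulC fs_mulBr ![z ** _]fs_mulC. Qed.

Lemma fs_mulZl a x y : (a *: x) ** y = a *: (x ** y).
Proof. by rewrite fs_mulC fs_mulZr [y ** _]fs_mulC. Qed.

Lemma fs_mul0l x : 0 ** x = 0.
Proof. by rewrite fs_mulC fs_mul0r. Qed.

Lemma fs_mul_le : exists2 b : R, 0 < b & forall x y, nrm (x ** y) <= b * (nrm x * nrm y).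
Proof.
have [b b0 hb] := bl_ge0 fs_mu_bounded; exists (b + 1); first by rewrite ltr_wpDl.
move=> x y; apply: le_trans (hb _) _; rewrite nrm_pure ler_wpM2r ?mulr_ge0 ?nrm_ge0//.
by rewrite lerDl.
Qed.

Lemma adjmulP x y z : dot (x ** y) z = dot y (adjmul x z).
Proof. exact: adjP (fs_mul_bounded x) y z. Qed.

Lemma adjmulP' x y z : dot z (x ** y) = dot (adjmul x z) y.
Proof. exact: adjP' (fs_mul_bounded x) y z. Qed.

Lemma adjmulM x u v : adjmul x (u ** v) = adjmul x u ** v.
Proof. exact: adjoint_multiplier fs_mu_bounded (fsP H) x u v. Qed.

Lemma adjmulD x y z : adjmul (x + y) z = adjmul x z + adjmul y z.
Proof. by apply: adjE => v; rewrite fs_mulDl dotDl dotDr !adjmulP. Qed.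

Lemma adjmulB x y z : adjmul (x - y) z = adjmul x z - adjmul y z.
Proof. by apply: adjE => v; rewrite fs_mulBl dotBl dotBr !adjmulP. Qed.

Lemma adjmulZ a x z : adjmul (a *: x) z = conjc a *: adjmul x z.
Proof. by apply: adjE => v; rewrite fs_mulZl dotZl dotZr conjE conjcK adjmulP. Qed.

(** Group-like elements are the nonzero Riesz representers of characters. *)
Lemma grouplikeP g : grouplike g <->
  g <> 0 /\ forall u v, dot (u ** v) g = dot u g * dot v g.
Proof.
split=> [[g0 gg]|[g0 gg]]; (split; first exact: g0); first move=> u v.
  by rewrite (adjP fs_mu_bounded) gg dot_pure.
apply: tensor_ext => u v; rewrite -(adjP' fs_mu_bounded) dotC [dot (fs_mu _) _]gg.
by rewrite -dot_pure -dotC.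
Qed.

Lemma grouplike_neq0 g : grouplike g -> g != 0.
Proof. by move=> [/eqP]. Qed.

Lemma grouplike_dot_neq0 g : grouplike g -> dot g g != 0.
Proof. by move=> /grouplike_neq0; apply: contra_neq; exact: dot_eq0. Qed.

Lemma grouplikeM g u v : grouplike g -> dot (u ** v) g = dot u g * dot v g.
Proof. by move=> /grouplikeP[_]. Qed.

(** g is an eigenvector of every adjoint multiplication by definition; the
    multiplication operators being normal by adjmulM, it is an eigenvector of
    them too, with the conjugate eigenvalues. *)
Lemma grouplike_mul g u : grouplike g -> u ** g = dot u g *: g.
Proof.
move=> gg; set l := dot u g.
have Sg : adjmul u g = conjc l *: g.
  by apply: adjE => v; rewrite dotZr conjE conjcK grouplikeM.
have ugg : dot (u ** g) g = l * dot g g by rewrite grouplikeM.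
have gug : dot g (u ** g) = conjc l * dot g g by rewrite dotC ugg conjcM -dotC.
have uu : dot (u ** g) (u ** g) = l * (conjc l * dot g g).
  rewrite adjmulP {1}[u ** g]fs_mulC adjmulM Sg fs_mulZl [g ** u]fs_mulC.
  by rewrite dotZr conjE conjcK gug.
apply/eqP; rewrite -subr_eq0; apply/eqP/dot_eq0.
by rewrite dotBl !dotBr !dotZr !dotZl !conjE uu gug ugg; ring.
Qed.

(** Multiplicativity of the characters of g and of a g, evaluated at g, forces the
    conjugate of a to equal its own square. *)
Lemma grouplike_scale a g : grouplike g -> grouplike (a *: g) -> a = 1.
Proof.
move=> gg ag; have a0 : conjc a != 0.
  have := grouplike_neq0 ag; apply: contra_neq => /(congr1 conjc).
  by rewrite conjcK conjc0 => ->; rewrite scale0r.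
have := grouplikeM g g ag; rewrite !dotZr !conjE grouplikeM// => h.
have d0 := grouplike_dot_neq0 gg.
apply: (can_inj (@conjcK R)); rewrite conjc1.
have nz : conjc a * (dot g g * dot g g) != 0 by rewrite !mulf_neq0.
by apply: (mulfI nz); rewrite mulr1 [RHS]h; ring.
Qed.

(** Both <h, g> g and <g, h> h equal the product of g and h. *)
Lemma grouplike_orthogonal g h : grouplike g -> grouplike h -> g <> h -> dot g h = 0.
Proof.
move=> gg hh gh; apply: contrapT => /eqP d0; apply: gh.
have : dot h g *: g = dot g h *: h.
  by rewrite -(grouplike_mul h gg) -(grouplike_mul g hh) fs_mulC.
have d0' : dot h g != 0.
  by rewrite dotC; apply: contra_neq d0 => /(congr1 conjc); rewrite conjcK conjc0.
move=> /(congr1 (fun x => (dot h g)^-1 *: x)); rewrite !scalerA mulVf// scale1r => gE.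
by move: gg; rewrite gE => /(grouplike_scale hh) ->; rewrite scale1r.
Qed.

Lemma line_ideal g : grouplike g -> is_ideal (line g).
Proof.
move=> gg; split=> [|_ _ [a _ <-] [b _ <-]|a _ [b _ <-]|x _ [b _ <-]].
- by exists 0; rewrite ?scale0r.
- by exists (a + b); rewrite ?scalerDl.
- by exists (a * b); rewrite ?scalerA.
- by exists (b * dot x g) => //; rewrite fs_mulZr grouplike_mul// scalerA.
Qed.

Lemma line_self g : line g g. Proof. by exists 1; rewrite ?scale1r. Qed.

Lemma line_minimal g : grouplike g -> minimal_ideal (line g).
Proof.
move=> gg; split; first exact: line_ideal.
  move=> l0; have := line_self g; rewrite l0 => /= g0.
  by have := grouplike_neq0 gg; rewrite g0 eqxx.
move=> J [J0 JD JZ JM] Jg; have [[x [Jx x0]]|none] := pselect (exists x, J x /\ x <> 0).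
  right; apply/seteqP; split=> // _ [b _ <-].
  have [a _ xE] := Jg x Jx; have a0 : a != 0.
    by apply/eqP => a0; apply: x0; rewrite -xE a0 scale0r.
  have -> : b *: g = (b / a) *: x by rewrite -xE scalerA divfK.
  exact: JZ.
left; apply/seteqP; split=> [x Jx|_ -> //].
by apply: contrapT => x0; apply: none; exists x.
Qed.

(** The kernel of the character of g has codimension one, and the idempotent
    g / <g, g> is a modular unit for it. *)
Lemma grouplike_kernel_maximal g : grouplike g ->
  maximal_modular_ideal [set x : H | dot x g = 0].
Proof.
move=> gg; have d0 := grouplike_dot_neq0 gg; split.
- split=> [|x y /= hx hy|a x /= hx|x y /= hy]; rewrite /= ?dot0l//.
  + by rewrite dotDl hx hy addr0.
  + by rewrite dotZl hx mulr0.
  + by rewrite grouplikeM// hy mulr0.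
- exists ((dot g g)^-1 *: g) => x /=.
  by rewrite dotBl grouplikeM// dotZl mulVf// mulr1 subrr.
- move=> /seteqP[_ /(_ g I)] /= g0.
  by rewrite g0 eqxx in d0.
- move=> J [J0 JD JZ JM] KJ; have [[x [Jx x0]]|none] := pselect (exists x, J x /\ dot x g <> 0).
    right; apply/seteqP; split=> // y _; move/eqP in x0.
    rewrite -[y](subrK ((dot y g / dot x g) *: x)); apply: JD; last exact: JZ.
    by apply: KJ; rewrite /= dotBl dotZl divfK// subrr.
  left; apply/seteqP; split=> // x Jx /=.
  by apply: contrapT => x0; apply: none; exists x.
Qed.

End grouplikes.

(** * Maximal modular ideals are kernels of group-like elements *)

Section maximal_modular.
Context {R : realType} (H : frobsem R).
Implicit Types (x y z u v g h : H).

Local Notation "x ** y" := (fs_mul x y) (at level 40, left associativity).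

Lemma geometric_small (C k e : R) : 0 <= k -> k < 1 -> 0 < e -> exists N, C * k ^+ N < e.
Proof.
move=> k0 k1 e0; have kn : `|k| < 1 by rewrite ger0_norm.
have /cvgrPdist_lt/(_ (e / (`|C| + 1))) := cvg_expr kn.
have C1 : 0 < `|C| + 1 by rewrite ltr_wpDl.
rewrite divr_gt0// => /(_ isT)[N _ /(_ N (leqnn N))]; rewrite /= sub0r normrN => h.
exists N; apply: le_lt_trans (_ : `|C * k ^+ N| < e); first exact: ler_norm.
rewrite normrM; move: h; rewrite ltr_pdivlMr// mulrC; apply: le_lt_trans.
by rewrite ler_wpM2r// lerDl.
Qed.

(** The Neumann series: x is the limit of the iteration t |-> y + t r. *)
Lemma quasi_inverse (b : R) r : 0 < b -> (forall x y, nrm (x ** y) <= b * (nrm x * nrm y)) ->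
  b * nrm r < 1 -> forall y, exists x, x - x ** r = y.
Proof.
move=> b0 bM k1 y; set k := b * nrm r in k1.
have k0 : 0 <= k by rewrite mulr_ge0 ?nrm_ge0// ltW.
have mulr_le x : nrm (x ** r) <= k * nrm x.
  by apply: le_trans (bM _ _) _; rewrite mulrCA mulrC -mulrA.
pose s n := iter n (fun t => y + t ** r) 0.
have sS n : nrm (s n.+1 - s n) <= k ^+ n * nrm y.
  elim: n => [|n IH]; first by rewrite /= fs_mul0l addr0 subr0 expr0 mul1r.
  rewrite [s n.+2]iterS [s n.+1 in X in _ - X]iterS -/(s n) -/(s n.+1).
  rewrite opprD addrACA subrr add0r -fs_mulBl exprS -mulrA.
  by apply: le_trans (mulr_le _) _; rewrite ler_wpM2l.
(* C bounds the tail of the geometric series; sj is stated with a difference of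
   powers so that it telescopes. *)
pose C := nrm y / (1 - k).
have k1' : 0 < 1 - k by rewrite subr_gt0.
have C0 : 0 <= C by rewrite divr_ge0 ?nrm_ge0 ?ltW.
have yE : nrm y = C * (1 - k) by rewrite /C divfK// gt_eqF.
have sj n j : nrm (s (n + j)%N - s n) <= C * (k ^+ n - k ^+ (n + j)%N).
  elim: j => [|j IH]; first by rewrite addn0 !subrr nrm0 mulr0.
  apply: le_trans (nrm_tri (s (n + j)%N) _ _) _; rewrite addnS.
  apply: le_trans (lerD (sS _) IH) _; rewrite yE exprS le_eqVlt; apply/orP; left.
  by apply/eqP; ring.
have sN N n : (N <= n)%N -> nrm (s n - s N) <= C * k ^+ N.
  move=> Nn; rewrite -(subnKC Nn); apply: le_trans (sj _ _) _.
  by rewrite ler_wpM2l// lerBlDr lerDl exprn_ge0.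
have [|x sx] := @cauchy_nrm_cvg R H s.
  move=> e e0; have e2 : 0 < e / 2 by rewrite divr_gt0.
  have [N hN] := geometric_small C k0 k1 e2; exists N => n m Nn Nm.
  apply: le_lt_trans (nrm_tri (s N) _ _) _; rewrite (splitr e).
  apply: ltrD; first exact: le_lt_trans (sN _ _ Nn) hN.
  by rewrite nrmBC; exact: le_lt_trans (sN _ _ Nm) hN.
exists x; apply/eqP; rewrite -subr_eq0 -nrm_eq0 eq_le nrm_ge0 andbT.
apply/ler_addgt0Pl => e e0; rewrite addr0.
have [N hN] := sx (e / 2) ltac:(by rewrite divr_gt0).
have -> : x - x ** r - y = (x - s N.+1) - (x - s N) ** r.
  by rewrite [s N.+1]iterS -/(s N) fs_mulBl opprB opprD !addrA subrK addrAC.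
apply: le_trans (nrmD_le _ _) _; rewrite nrmN (splitr e); apply: lerD.
  by apply/ltW/hN.
apply: le_trans (mulr_le _) _; apply: le_trans (ltW (hN N (leqnn N))).
by rewrite ler_piMl ?nrm_ge0// ltW.
Qed.

Section ideal_complement.
Context (M : set H) (hM : maximal_modular_ideal M).

Let perp x := forall m, M m -> dot x m = 0.

Lemma max_idealD x y : M x -> M y -> M (x + y). Proof. by have [[]] := hM; auto. Qed.
Lemma max_idealZ a x : M x -> M (a *: x). Proof. by have [[]] := hM; auto. Qed.
Lemma max_idealMl x y : M y -> M (x ** y). Proof. by have [[]] := hM; auto. Qed.

Lemma perpD x y : perp x -> perp y -> perp (x + y).
Proof. by move=> px py m Mm; rewrite dotDl px// py// addr0. Qed.
Lemma perpZ a x : perp x -> perp (a *: x).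
Proof. by move=> px m Mm; rewrite dotZl px// mulr0. Qed.

Lemma perpB x y : perp x -> perp y -> perp (x - y).
Proof. by move=> px py; rewrite -scaleN1r; apply: perpD => //; exact: perpZ. Qed.

Lemma perp_adjmul x z : perp z -> perp (adjmul x z).
Proof. by move=> pz m Mm; rewrite -adjmulP' pz//; exact: max_idealMl. Qed.

(** Modulo M the vector L_x^* m equals (L_x^* m) u = L_x^* (u m) = (L_x^* u) m. *)
Lemma max_ideal_adjmul x m : M m -> M (adjmul x m).
Proof.
move=> Mm; have [_ [u hu] _ _] := hM; rewrite -[adjmul x m](subrK (adjmul x m ** u)).
apply: max_idealD => //; rewrite -adjmulM fs_mulC adjmulM; exact: max_idealMl.
Qed.

Lemma perp_mull x z : perp z -> perp (x ** z).
Proof. by move=> pz m Mm; rewrite adjmulP pz//; exact: max_ideal_adjmul. Qed.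

Lemma perp_disjoint x : perp x -> M x -> x = 0.
Proof. by move=> px Mx; apply: dot_eq0; exact: px. Qed.

Lemma perp_annihilates z m : perp z -> M m -> z ** m = 0.
Proof.
by move=> pz Mm; apply: perp_disjoint; [rewrite fs_mulC; exact: perp_mull|exact: max_idealMl].
Qed.

(** A maximal modular ideal stays at a positive distance of its modular unit u,
    since u - m with m in M cannot be quasi-invertible; so u has a nonzero
    component orthogonal to M, and this component is a unit of the complement. *)
Lemma perp_unit : exists p, [/\ perp p, p <> 0 & forall z, perp z -> z ** p = z].
Proof.
have [idM [u hu] Mproper _] := hM; have [M0 _ _ _] := idM.
have [b b0 bM] := fs_mul_le H.
have far m : M m -> 1 <= b * nrm (u - m).
  move=> Mm; rewrite leNgt; apply/negP => lt1; apply: Mproper.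
  apply/seteqP; split=> // y _; have [x <-] := quasi_inverse b0 bM lt1 y.
  rewrite fs_mulBr opprB addrCA addrC; apply: max_idealD => //; exact: max_idealMl.
have [|p [plim porth]] := @orthogonal_projection R H M u.
  by split=> //; [exact: max_idealD|exact: max_idealZ].
exists p; split=> // [p0|z pz].
  have [m Mm] := plim b^-1 ltac:(by rewrite invr_gt0).
  rewrite p0 sub0r nrmN -(ltr_pM2l b0) mulfV ?gt_eqF// => lt1.
  by have := far m Mm; rewrite leNgt lt1.
have zu : z ** u = z ** p.
  apply/eqP; rewrite -subr_eq0 -fs_mulBr -nrm_eq0 eq_le nrm_ge0 andbT.
  apply/ler_addgt0Pl => e e0; rewrite addr0.
  have z1 : 0 < nrm z + 1 by rewrite ltr_wpDl ?nrm_ge0.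
  have [m Mm pm] := plim (e / b / (nrm z + 1)) ltac:(by rewrite !divr_gt0).
  have -> : z ** (u - p) = z ** ((u - m) - p).
    by rewrite addrAC [RHS]fs_mulBr (perp_annihilates pz Mm) subr0.
  apply: le_trans (bM _ _) _; rewrite -ler_pdivlMl// mulrC.
  move/ltW: pm; rewrite nrmBC ler_pdivlMr// [b^-1 * e]mulrC; apply: le_trans.
  by rewrite ler_wpM2l ?nrm_ge0// lerDl.
apply/eqP; rewrite eq_sym -subr_eq0; apply/eqP; apply: perp_disjoint.
  by apply: perpB => //; rewrite -zu fs_mulC; exact: perp_mull.
by rewrite -zu; exact: hu.
Qed.

Context (p : H) (pp : perp p) (p0 : p <> 0) (p1 : forall z, perp z -> z ** p = z).

(** The annihilator of p is a proper ideal containing M. *)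
Lemma max_idealE x : M x <-> x ** p = 0.
Proof.
split=> [Mx|xp]; first by rewrite fs_mulC perp_annihilates.
have [_ _ _ maxM] := hM.
have [||JM|JT] := maxM [set y : H | y ** p = 0].
- split=> [|y z /= hy hz|a y /= hy|y z /= hz]; rewrite /= ?fs_mul0l//.
  + by rewrite fs_mulDl hy hz addr0.
  + by rewrite fs_mulZl hy scaler0.
  + by rewrite -fs_mulA hz fs_mul0r.
- by move=> m Mm; rewrite /= fs_mulC perp_annihilates.
- by rewrite -JM.
- have : [set y : H | y ** p = 0] p by rewrite JT.
  by rewrite /= p1.
Qed.

(** By maximality M and x generate H; multiply the resulting expression of p by p
    to remove its component in M. *)
Lemma perp_inverse x : perp x -> x <> 0 -> exists2 y, perp y & x ** y = p.
Proof.
move=> px x0; have [[M0 _ _ _] _ _ maxM] := hM.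
have [||JM|JT] := maxM [set t : H | exists m h : H, M m /\ t = m + x ** h].
- split=> [|_ _ [m [h [Mm ->]]] [m' [h' [Mm' ->]]]|a _ [m [h [Mm ->]]]|z _ [m [h [Mm ->]]]].
  + by exists 0, 0; rewrite fs_mul0r addr0.
  + by exists (m + m'), (h + h'); rewrite fs_mulDr addrACA; split=> //; exact: max_idealD.
  + by exists (a *: m), (a *: h); rewrite fs_mulZr scalerDr; split=> //; exact: max_idealZ.
  + by exists (z ** m), (z ** h); rewrite fs_mulDr fs_mulCA; split=> //; exact: max_idealMl.
- by move=> m Mm; exists m, 0; rewrite fs_mul0r addr0.
- exfalso; apply: x0; apply: perp_disjoint => //; rewrite -JM.
  by exists 0, p; rewrite p1// add0r.
- have [m [h [Mm pE]]] : [set t : H | exists m h : H, M m /\ t = m + x ** h] p by rewrite JT.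
  exists (h ** p); first exact: perp_mull.
  rewrite fs_mulA -[RHS](p1 pp) {2}pE fs_mulDl.
  by have /max_idealE -> := Mm; rewrite add0r.
Qed.

(** In the field M^perp, x with x^* = x acts as a self-adjoint operator; if l is
    the supremum of its numerical range then l p - x is positive but not bounded
    below, hence not invertible, hence zero. *)
Lemma perp_selfadjoint x : perp x -> adjmul x p = x -> exists l : R, x = l%:C *: p.
Proof.
move=> px xx; have [b b0 bM] := fs_mul_le H.
have adjx v : perp v -> adjmul x v = x ** v.
  by move=> pv; rewrite -[in LHS](p1 pv) fs_mulC adjmulM xx.
have [l hl] : exists l : R, (forall v, perp v -> complex.Re (dot (x ** v) v) <= l * nrm v ^+ 2) /\
    forall l', (forall v, perp v -> complex.Re (dot (x ** v) v) <= l' * nrm v ^+ 2) -> l <= l'.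
  pose E := [set complex.Re (dot (x ** v) v) | v in [set v | perp v /\ nrm v = 1]].
  have normalize v : perp v -> v != 0 -> exists w, [/\ perp w, nrm w = 1 &
      complex.Re (dot (x ** v) v) = complex.Re (dot (x ** w) w) * nrm v ^+ 2].
    move=> pv v0; have n0 : nrm v != 0 by rewrite nrm_eq0.
    exists ((nrm v)^-1%:C *: v); split; first exact: perpZ.
      by rewrite nrmZ normc_real ger0_norm ?invr_ge0 ?nrm_ge0// mulVf.
    rewrite fs_mulZr dotZl dotZr conjE conjc_real.
    by case: (dot (x ** v) v) => c d /=; field.
  have Ene : E !=set0.
    have [w [pw w1 _]] := normalize p pp (introN eqP p0).
    by exists (complex.Re (dot (x ** w) w)), w.
  have Eub : has_ubound E.
    exists (b * nrm x) => _ [v [pv v1] <-]; apply: le_trans (ge_Re_normc _) _.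
    apply: le_trans (cauchy_schwarz _ _) _; rewrite v1 mulr1.
    by apply: le_trans (bM _ _) _; rewrite v1 mulr1.
  exists (sup E); split=> [v pv|l' hl'].
    have [->|v0] := eqVneq v 0; first by rewrite dot0r nrm0 expr0n mulr0.
    have [w [pw w1 ->]] := normalize v pv v0.
    by rewrite ler_wpM2r ?sqr_ge0//; apply: ub_le_sup => //; exists w.
  apply: ge_sup => // _ [v [pv v1] <-]; have := hl' v pv.
  by rewrite v1 expr1n mulr1.
have [lub lmin] := hl.
exists l; apply/eqP; rewrite eq_sym -subr_eq0; apply: contrapT => /negP/eqP a0.
set a := _ - x in a0.
have pa : perp a by apply: perpB => //; exact: perpZ.
have [c pc ac] := perp_inverse pa a0.
have av v : perp v -> a ** v = l%:C *: v - x ** v.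
  by move=> pv; rewrite fs_mulBl fs_mulZl fs_mulC p1.
have a_pos v : perp v -> 0 <= complex.Re (dot (a ** v) v).
  move=> pv; rewrite av// dotBl dotZl dotxx_nrm -realcM raddfB /= subr_ge0.
  exact: lub.
have a_sym v w : perp v -> perp w -> dot (a ** v) w = dot v (a ** w).
  move=> pv pw; rewrite !av// dotBl dotBr dotZl dotZr conjE conjc_real adjmulP.
  by rewrite adjx.
pose B := b * nrm a.
have na : 0 < nrm a by rewrite nrm_gt0; apply/eqP.
have nc : 0 < nrm c.
  rewrite nrm_gt0; apply/eqP => c0; apply: p0; by rewrite -ac c0 fs_mul0r.
have B0 : 0 < B by rewrite mulr_gt0.
(* Cauchy-Schwarz for the positive form <a v, v>, by testing positivity at
   v - a v / B. *)
have a_ge v : perp v -> nrm (a ** v) ^+ 2 / B <= complex.Re (dot (a ** v) v).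
  move=> pv; have pav : perp (a ** v) by exact: perp_mull.
  have := a_pos (v - (B^-1)%:C *: (a ** v)) (perpB pv (perpZ _ pav)).
  rewrite fs_mulBr fs_mulZr dotBl !dotBr dotZl !dotZr !dotZl !conjE conjc_real.
  rewrite (a_sym (a ** v) v)// dotxx_nrm.
  have : complex.Re (dot (a ** (a ** v)) (a ** v)) <= B * nrm (a ** v) ^+ 2.
    apply: le_trans (ge_Re_normc _) _; apply: le_trans (cauchy_schwarz _ _) _.
    rewrite expr2 mulrA ler_wpM2r ?nrm_ge0//; apply: le_trans (bM _ _) _.
    by rewrite mulrA.
  set n := nrm (a ** v) ^+ 2.
  case: (dot (a ** (a ** v)) _) => r1 r2; case: (dot (a ** v) v) => s1 s2 /=.
  move=> h1 h2; have h3 : B^-1 * (B^-1 * r1) <= n / B.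
    rewrite mulrA -ler_pdivlMl ?mulr_gt0 ?invr_gt0//.
    apply: le_trans h1 _; rewrite le_eqVlt; apply/orP; left; apply/eqP; field.
    by rewrite gt_eqF.
  rewrite mulrC; move: h2 h3; rewrite !(mul0r, subr0, oppr0, addr0, mulr0).
  move: (B^-1) => i; lra.
(* As a is invertible, the form is bounded below by k, so l - k would still
   bound the numerical range of x. *)
pose k := (B * (b * nrm c) ^+ 2)^-1.
have k0 : 0 < k by rewrite invr_gt0 mulr_gt0// exprn_gt0// mulr_gt0.
have /lmin : forall v, perp v -> complex.Re (dot (x ** v) v) <= (l - k) * nrm v ^+ 2.
  move=> v pv; have vE : c ** (a ** v) = v.
    by rewrite fs_mulA [c ** a]fs_mulC ac fs_mulC p1.
  have h1 : k * nrm v ^+ 2 <= nrm (a ** v) ^+ 2 / B.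
    rewrite /k invfM -mulrA mulrC ler_wpM2r ?invr_ge0 ?(ltW B0)//.
    rewrite mulrC -exprVn -exprMn mulrC ler_sqr ?nnegrE ?mulr_ge0 ?nrm_ge0 ?invr_ge0 ?mulr_ge0 ?nrm_ge0 ?(ltW b0)//.
    rewrite mulrC ler_pdivrMr ?mulr_gt0//.
    by rewrite -{1}vE; apply: le_trans (bM _ _) _; rewrite mulrA mulrC.
  have := le_trans h1 (a_ge v pv); rewrite av// dotBl dotZl dotxx_nrm -realcM raddfB /=.
  by move: (complex.Re _) (nrm v ^+ 2) => s n; lra.
by rewrite lerBrDr -lerBrDl subrr leNgt k0.
Qed.

(** With xs the involution of x, the elements x + xs and i (x - xs) are
    self-adjoint and x is a combination of them. *)
Lemma perp_scalar x : perp x -> exists c : R[i], x = c *: p.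
Proof.
move=> px; pose xs := adjmul x p.
have pxs : perp xs by exact: perp_adjmul.
have xsE v : perp v -> xs ** v = adjmul x v.
  by move=> pv; rewrite -adjmulM fs_mulC p1.
have xss : adjmul xs p = x.
  apply/eqP; rewrite -subr_eq0; apply/eqP.
  have pd : perp (adjmul xs p - x) by apply: perpB => //; exact: perp_adjmul.
  apply: dot_eq0; set d := _ - x in pd *.
  by rewrite {2}/d dotBr -adjmulP xsE// -adjmulP' p1// subrr.
have [l1 h1] : exists l : R, x + xs = l%:C *: p.
  by apply: perp_selfadjoint; [exact: perpD|rewrite adjmulD xss addrC].
have [l2 h2] : exists l : R, (0 +i* 1) *: (x - xs) = l%:C *: p.
  apply: perp_selfadjoint; first by apply: perpZ; exact: perpB.
  rewrite adjmulZ adjmulB xss -/xs -[xs - x]opprB scalerN -scaleNr; congr (_ *: _).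
  by apply/eqP; rewrite eq_complex /= opprK oppr0 !eqxx.
exists (2^-1 * (l1%:C - (0 +i* 1) * l2%:C)).
have ii : (0 +i* 1) * (0 +i* 1) = -1 :> R[i].
  by apply/eqP; rewrite eq_complex /=; apply/andP; split; apply/eqP; ring.
rewrite -[LHS](scale1r x) -scalerA scalerBl -scalerA -h1 -h2 scalerA ii scaleN1r opprK.
by rewrite addrACA subrr addr0 -mulr2n -[x *+ 2]scaler_nat scalerA mulVf ?pnatr_eq0.
Qed.

End ideal_complement.

(** The complement of a maximal modular ideal is a line C p, and then u p is a
    multiple of p whose coefficient is a character of H. *)
Lemma maximal_modular_grouplike (M : set H) : maximal_modular_ideal M ->
  exists2 g, grouplike g & forall x, M x <-> dot x g = 0.
Proof.
move=> hM; have [p [pp p0 p1]] := perp_unit hM.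
have ME := max_idealE hM pp p0 p1.
have dp0 : dot p p != 0 by apply/eqP => /dot_eq0.
(* p acts as the orthogonal projection on the complement of M. *)
have pdot v : dot (v ** p) p = dot v p.
  apply/eqP; rewrite -subr_eq0 -dotBl; apply/eqP; rewrite dotC pp ?conjc0//.
  by apply/ME; rewrite fs_mulBl -fs_mulA p1// subrr.
have npC : dot p p = conjc (dot p p) by rewrite -dotC.
pose g := (dot p p)^-1 *: p.
have dg u : dot u g = dot u p / dot p p.
  by rewrite /g dotZr conjE dotxx_nrm -fmorphV conjc_real mulrC.
have up u : u ** p = dot u g *: p.
  have [c uc] : exists c, u ** p = c *: p.
    by apply: (perp_scalar hM pp p0 p1); exact: perp_mull.
  by rewrite uc dg -pdot uc dotZl mulfK.
exists g.
  apply/grouplikeP; split=> [g0|u v].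
    by have := dg p; rewrite g0 dot0r divff// => /eqP; rewrite eq_sym oner_eq0.
  have : dot (u ** v) g *: p = (dot u g * dot v g) *: p.
    by rewrite -up -fs_mulA up fs_mulZr up scalerA mulrC.
  move=> /(congr1 (fun x => dot x p)); rewrite !dotZl.
  exact: mulIf.
move=> x; split=> [/ME|xg]; last by apply/ME; rewrite up xg scale0r.
by rewrite up => /eqP; rewrite scaler_eq0 => /orP[/eqP//|/eqP].
Qed.

Lemma radicalE x : @radical R H x <-> forall g, grouplike g -> dot x g = 0.
Proof.
split=> [rx g gg|xg M hM].
  exact: rx _ (grouplike_kernel_maximal gg).
by have [g gg ->] := maximal_modular_grouplike hM; exact: xg.
Qed.

Lemma semisimple_ext : semisimple H ->
  forall x y, (forall g, grouplike g -> dot x g = dot y g) -> x = y.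
Proof.
move=> ss x y xy; apply/eqP; rewrite -subr_eq0; apply/eqP.
have : @radical R H (x - y) by apply/radicalE => g gg; rewrite dotBl xy// subrr.
by rewrite ss.
Qed.

End maximal_modular.

(** * Minimal ideals and their generators *)

Section minimal_ideals.
Context {R : realType}.
Implicit Types H K : frobsem R.

(** Zero is included so that the condition is stable under adjoints of morphisms,
    and covers the base point. *)
Lemma grouplike0P H (g : H) : grouplike g \/ g = 0 <->
  forall u v, dot (fs_mul u v) g = dot u g * dot v g.
Proof.
split=> [[gg u v|-> u v]|gM]; first exact: grouplikeM; first by rewrite !dot0r mul0r.
have [->|/eqP g0] := eqVneq g 0; [by right|left].
exact/grouplikeP.
Qed.

Lemma line_inj H (g h : H) : grouplike g \/ g = 0 -> grouplike h \/ h = 0 ->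
  line g = line h -> g = h.
Proof.
move=> gg hh gh; have : line h g by rewrite -gh; exact: line_self.
move=> [a _ ahg]; case: gg => [gg|g0].
  case: hh ahg => [hh|->]; last by rewrite scaler0.
  by move=> ahg; move: gg; rewrite -ahg => /(grouplike_scale hh) ->; rewrite scale1r.
have : line g h by rewrite gh; exact: line_self.
by move=> [b _ <-]; rewrite g0 scaler0.
Qed.

Lemma gl_line H (g : H) : grouplike g \/ g = 0 -> gl (line g) = g.
Proof.
move=> gg; have [g'g' gg'] := glE gg erefl.
by apply: line_inj => //; rewrite -gg'.
Qed.

Lemma Min_line H (g : H) : grouplike g -> Min (line g).
Proof.
move=> gg; split; first exact: line_minimal.
move=> /(_ g (line_self g)) /radicalE /(_ g gg) /eqP.
by rewrite (negPf (grouplike_dot_neq0 gg)).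
Qed.

(** If I is not inside the radical, some group-like g has <x, g> <> 0 for an x in
    I, and then x g = <x, g> g puts g in I. *)
Lemma MinP H (I : set H) : Min I -> exists2 g, grouplike g & I = line g.
Proof.
move=> [[[I0 ID IZ IM] _ minI] Irad].
have [x [Ix [g [gg xg]]]] : exists x, I x /\ exists g, grouplike g /\ dot x g <> 0.
  apply: contrapT => none; apply: Irad => x Ix; apply/radicalE => g gg.
  by apply: contrapT => xg; apply: none; exists x; split=> //; exists g.
exists g => //; have Ig : I g.
  have := IZ (dot x g)^-1 _ (IM g x Ix).
  by rewrite fs_mulC grouplike_mul// scalerA mulVf ?scale1r//; exact/eqP.
have [|l0|//] := minI (line g) (line_ideal gg).
  by move=> _ [a _ <-]; exact: IZ.
have := line_self g; rewrite l0 => /= g0.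
by have := grouplike_neq0 gg; rewrite g0 eqxx.
Qed.

Lemma adj_grouplike0 H K (f : fhom H K) (k : K) : grouplike k \/ k = 0 ->
  grouplike (adj f k) \/ adj f k = 0.
Proof.
have [fb fM] := fhP f; move=> /grouplike0P kM; apply/grouplike0P => u v.
by rewrite -!(adjP fb) fM kM.
Qed.

Lemma opnorm_ge (A B : hilbertType R) (f : A -> B) (t : A) : bounded_linear f ->
  nrm t <= 1 -> nrm (f t) <= opnorm f.
Proof.
move=> fb t1; apply: ub_le_sup; last by exists t.
have [M M0 hM] := bl_ge0 fb; exists M => _ [s /= s1 <-].
by apply: le_trans (hM s) _; rewrite ler_piMr.
Qed.

Lemma normalized (A : hilbertType R) (t : A) : t != 0 ->
  nrm (((nrm t)^-1)%:C *: t) = 1.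
Proof.
move=> t0; rewrite nrmZ normc_real ger0_norm ?invr_ge0 ?nrm_ge0// mulVf//.
by rewrite nrm_eq0.
Qed.

Lemma bconst_pos H : 0 < bconst H.
Proof.
rewrite /bconst; case: asboolP => // /existsNP[t /eqP mt0].
have mb := fs_mu_bounded H.
have t0 : t != 0 by apply: contra_neq mt0 => ->; rewrite (bl0 mb).
apply: lt_le_trans (opnorm_ge mb (_ : nrm (((nrm t)^-1)%:C *: t) <= 1)).
  by rewrite (blZ mb) nrmZ mulr_gt0 ?nrm_gt0// normc_real normr_gt0 invr_eq0 nrm_eq0.
by rewrite normalized.
Qed.

(** The unit vector e = g / |g| satisfies e e = g. *)
Lemma nrm_grouplike_le H (g : H) : grouplike g -> nrm g <= bconst H.
Proof.
move=> gg; have g0 := grouplike_neq0 gg; have mb := fs_mu_bounded H.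
pose e : H := ((nrm g)^-1)%:C *: g.
have ng : nrm g != 0 by rewrite nrm_eq0.
have muee : fs_mu (pure e e) = g.
  rewrite -/(fs_mul e e) /e fs_mulZl fs_mulZr grouplike_mul// dotxx_nrm !scalerA -!realcM.
  by rewrite (_ : _ * _ = 1) ?scale1r//; field.
rewrite /bconst; case: asboolP => [m0|_]; first by move: g0; rewrite -muee m0 eqxx.
rewrite -{1}muee; apply: opnorm_ge => //.
by rewrite nrm_pure normalized// mulr1.
Qed.

Lemma Min_factsP : Min_facts R.
Proof.
split.
- move=> H I /MinP[g gg ->]; exists g; split=> // h [hh gh].
  by apply: line_inj => //; left.
- move=> H; split.
  + by move=> _ /MinP[g gg ->] /=; rewrite gl_line//; left.
  + move=> I J /set_mem/MinP[g gg ->] /set_mem/MinP[h hh ->].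
    by rewrite !gl_line; [move=> ->|left..].
  + move=> g gg; exists (line g); first exact: Min_line.
    by rewrite gl_line//; left.
- exact: bconst_pos.
- move=> H _ /MinP[g gg ->]; rewrite gl_line; last by left.
  rewrite lef_pV2 ?posrE ?exprn_gt0 ?bconst_pos ?nrm_gt0 ?grouplike_neq0//.
  by rewrite ler_sqr ?nnegrE ?nrm_ge0 ?(ltW (bconst_pos H))// nrm_grouplike_le.
- by move=> H K f k kk; apply: adj_grouplike0; left.
Qed.

Lemma finite_of_esum (X : choiceType) (A : set X) (w : X -> R) (c : R) : 0 < c ->
  (forall x, A x -> c <= w x) -> (\esum_(x in A) (w x)%:E < +oo)%E -> finite_set A.
Proof.
move=> c0 wc lt; apply: contrapT => Ainf.
have w0 x : A x -> 0 <= w x by move=> /wc; apply: le_trans; exact: ltW.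
have sfin : (\esum_(x in A) (w x)%:E)%E \is a fin_num.
  by rewrite ge0_fin_numE//; apply: esum_ge0 => x Ax; rewrite lee_fin w0.
set S := fine (\esum_(x in A) (w x)%:E)%E.
pose n := (Num.trunc (S / c)).+1.
have [B [finB BA nB]] : exists B : set X,
    [/\ finite_set B, B `<=` A & (n <= size (finmap.enum_fset (fset_set B)))%N].
  have [F FA nF] := infinite_set_fset n Ainf.
  by eexists; split; [exact: finite_fset|exact: FA|rewrite set_fsetK].
have : (\sum_(x \in B) (w x)%:E <= S%:E)%E.
  by rewrite fineK//; apply: esum_ge; exists B.
rewrite fsumEFin// lee_fin.
apply/negP; rewrite -ltNge; apply: (@lt_le_trans _ _ (n%:R * c)).
  by rewrite -ltr_pdivrMr//; exact: truncnS_gt.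
rewrite fsbig_finite//=.
apply: (@le_trans _ _ (\sum_(x <- finmap.enum_fset (fset_set B)) c)).
  rewrite big_const_seq count_predT iter_addr_0 -[leRHS]mulr_natl ler_wpM2r ?(ltW c0)//.
  by rewrite ler_nat.
rewrite big_seq [leRHS]big_seq; apply: ler_sum => x xB; apply/wc/BA.
by move: xB; rewrite in_fset_set// => /set_mem.
Qed.

Local Notation mf := Min_factsP.

Definition gen H (I : Min_obj mf H) : H := gl (\val (I : Min0 (H:=H))).

Lemma gen0 H : gen (ws_base (Min_obj mf H)) = 0.
Proof. exact: gl0. Qed.

Lemma genP H (I : Min_obj mf H) : grouplike (gen I) \/ gen I = 0.
Proof. exact (gl_grouplike mf I). Qed.

Lemma val_line H (I : Min_obj mf H) : \val (I : Min0 (H:=H)) = line (gen I).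
Proof.
have [/MinP[g gg]|] : (@Min R H `|` [set [set 0]]) (\val (I : Min0 (H:=H))).
- by apply: set_mem; exact: valP.
- by rewrite /gen => ->; rewrite gl_line//; left.
- by rewrite /gen /= => ->; rewrite gl0 line0.
Qed.

Lemma gen_inj H (I J : Min_obj mf H) : gen I = gen J -> I = J.
Proof. by move=> IJ; apply: val_inj; rewrite val_line IJ -val_line. Qed.

Lemma gen_grouplike H (I : Min_obj mf H) : I <> ws_base (Min_obj mf H) ->
  grouplike (gen I).
Proof.
move=> I0; have [//|g0] := genP I.
by exfalso; apply: I0; apply: gen_inj; rewrite g0 gen0.
Qed.

Definition Min0_of H (g : H) (gg : grouplike g \/ g = 0) : Min_obj mf H :=
  SigSub (Min0_line mf gg).

Lemma gen_Min0_of H (g : H) (gg : grouplike g \/ g = 0) : gen (Min0_of gg) = g.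
Proof. exact: gl_line. Qed.

Lemma gen_Min_fun H K (f : fhom H K) (I : Min_obj mf K) :
  gen (Min_fun f I) = adj f (gen I).
Proof. exact (gl_line (adj_grouplike0 f (genP I))). Qed.

Definition unit_gen H (I : Min_obj mf H) : H :=
  ((nrm (gen I))^-1)%:C *: gen I.

Lemma unit_gen_bessel H : bessel_family 1 (@unit_gen H).
Proof.
apply: orthogonal_bessel => [I J /eqP IJ|I].
  rewrite /unit_gen dotZl dotZr; have [gI|->] := genP I; last by rewrite dot0l !mulr0.
  have [gJ|->] := genP J; last by rewrite dot0r !mulr0.
  rewrite grouplike_orthogonal ?mulr0// => /gen_inj; exact: IJ.
have [g0|g0] := eqVneq (gen I) 0; first by rewrite /unit_gen g0 scaler0 nrm0.
by rewrite normalized.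
Qed.

Lemma dot_unit_gen H (x : H) (I : Min_obj mf H) :
  normc (dot x (unit_gen I)) ^+ 2 = ws_weight I * normc (dot x (gen I)) ^+ 2.
Proof.
rewrite /unit_gen dotZr conjE conjc_real normcM normc_real exprMn.
by rewrite real_normK ?num_real// exprVn.
Qed.

(** The fibre over h of the map induced by f is controlled by Bessel's
    inequality for f h against the normalized group-like elements of K, since
    <f h, g> = <h, h> whenever g lies in that fibre. *)
Lemma Min_fun_fiber H K (f : fhom H K) : exists2 M : R, 0 <= M &
  forall J : Min_obj mf H, J <> ws_base (Min_obj mf H) ->
  (\esum_(I in Min_fun f @^-1` [set J]) (ws_weight (I : Min_obj mf K))%:E <=
    (M * ws_weight J)%:E)%E.
Proof.
have [fb fM] := fhP f; have [M M0 hM] := bl_ge0 fb.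
exists (M ^+ 2); first exact: sqr_ge0.
move=> J J0; set h := gen J; have hh : grouplike h := gen_grouplike J0.
have h0 : 0 < nrm h by rewrite nrm_gt0 grouplike_neq0.
rewrite -(@lee_pmul2l R ((nrm h ^+ 2) ^+ 2)%:E) ?lte_fin ?exprn_gt0//.
rewrite -esumZ ?sqr_ge0// -EFinM.
have -> : (nrm h ^+ 2) ^+ 2 * (M ^+ 2 * ws_weight J) = (M * nrm h) ^+ 2.
  rewrite -[ws_weight J]/((nrm h) ^- 2); field; exact: lt0r_neq0.
apply: (@le_trans _ _ (nrm (f h) ^+ 2)%:E); last first.
  by rewrite lee_fin ler_sqr ?nnegrE ?mulr_ge0 ?nrm_ge0.
have := @unit_gen_bessel K (f h); rewrite mul1r; apply: le_trans.
rewrite esum_mkcond; apply: le_esum => I _; case: ifPn => [/set_mem|_].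
  move=> /(congr1 (fun I => gen I)); rewrite gen_Min_fun => adjh.
  rewrite lee_fin dot_unit_gen (adjP fb) adjh -/h dotxx_nrm normc_real ger0_norm ?sqr_ge0//.
  by rewrite mulrC.
by rewrite lee_fin sqr_ge0.
Qed.

Lemma Min_fun_whom H K (f : fhom H K) :
  @is_whom R (Min_obj mf K) (Min_obj mf H) (Min_fun f).
Proof.
have [M M0 hM] := Min_fun_fiber f.
have base : Min_fun f (ws_base (Min_obj mf K)) = ws_base (Min_obj mf H).
  by apply: gen_inj; rewrite gen_Min_fun !gen0 adj0.
have fin J : J <> ws_base (Min_obj mf H) -> finite_set (Min_fun f @^-1` [set J]).
  move=> J0; have [c c0 wc] := ws_weight_ge (Min_obj mf K).
  apply: (finite_of_esum c0) (le_lt_trans (hM J J0) (ltry _)) => I /= IJ.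
  by apply: wc => I0; apply: J0; rewrite -IJ I0 base.
split=> //; exists M => //.
by apply/(whom_esum M fin).
Qed.

Lemma Min_functorialityP : Min_functoriality mf.
Proof.
split; first exact: Min_fun_whom.
- by move=> H I; apply: gen_inj; rewrite gen_Min_fun adj_id.
- move=> H K L g f I; apply: gen_inj; rewrite !gen_Min_fun /=.
  have [fb _] := fhP f; have [gb _] := fhP g.
  by apply: adjE => x; rewrite /= (adjP gb) (adjP fb) -gen_Min_fun.
Qed.

End minimal_ideals.

(** * Weighted square-summable functions *)

Section ell2_frobenius.
Context {R : realType} (X : wset R).
Implicit Types (u v : ell2 X) (x y : X).

Local Notation w := (@ws_weight R X).

Lemma nrm_ell2 u : (nrm u ^+ 2)%:E = (\esum_(x in [set: X]) (w x * normc (u x) ^+ 2)%:E)%E.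
Proof. by rewrite [nrm u ^+ 2]nrm_l2 l2_sqE. Qed.

(** Zero at the base point, where the square root of the weight is zero. *)
Definition unit_delta x : ell2 X := ((Num.sqrt (w x))^-1)%:C *: (delta w x : ell2 X).

Lemma dot_ell2_delta u x : dot u (delta w x : ell2 X) = (w x)%:C * u x.
Proof. exact: dot_delta. Qed.

Lemma dot_unit_delta u x : dot u (unit_delta x) = (Num.sqrt (w x))%:C * u x.
Proof.
rewrite /unit_delta dotZr conjE conjc_real dot_ell2_delta mulrA -realcM; congr (_%:C * _).
have [->|x0] := eqVneq (Num.sqrt (w x)) 0; first by rewrite invr0 mul0r.
by rewrite -{2}(sqr_sqrtr (ws_weight_ge0 x)) expr2 mulKf.
Qed.

Lemma unit_delta_parseval : parseval_family unit_delta.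
Proof.
move=> u; rewrite nrm_ell2; apply: eq_esum => x _; congr EFin.
rewrite dot_unit_delta normcM normc_real exprMn real_normK ?num_real//.
by rewrite sqr_sqrtr ?ws_weight_ge0.
Qed.

Lemma ell2_mul_subproof u v : (fun x => u x * v x) \in l2_mem w.
Proof.
have [c c0 wc] := ws_weight_ge X.
rewrite unfold_in; apply: asboolT; split=> [x wx|].
  by rewrite [u x]l2_suppE// mul0r.
apply: (@le_lt_trans _ _ ((c^-1 * nrm u ^+ 2)%:E *
    \esum_(x in [set: X]) (w x * normc (v x) ^+ 2)%:E)%E); last first.
  by rewrite -nrm_ell2 -EFinM ltry.
rewrite -esumZ ?mulr_ge0 ?nrm_ge0 ?invr_ge0 ?(ltW c0)//.
apply: le_esum => x _; rewrite lee_fin /l2_term normcM exprMn.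
have [x0|/eqP x0] := eqVneq x (ws_base X).
  by rewrite x0 !ell2_base normc0 expr0n !mulr0.
rewrite mulrCA; apply: ler_wpM2r; first by rewrite mulr_ge0 ?sqr_ge0 ?ws_weight_ge0.
rewrite ler_pdivlMl//; apply: le_trans (_ : w x * normc (u x) ^+ 2 <= _).
  by rewrite ler_wpM2r ?sqr_ge0//; exact: wc.
by rewrite [nrm u ^+ 2]nrm_l2; exact: l2_le_sq.
Qed.

Definition ell2_mul u v : ell2 X := L2 (ell2_mul_subproof u v).

(** The diagonal of a Parseval family of the tensor square, rescaled: the lower
    bound on the weights is what makes the product bounded. *)
Lemma diagonal_bessel : exists M : R, bessel_family M
  (fun x => ((Num.sqrt (w x))^-1)%:C *: pure (unit_delta x) (unit_delta x)).
Proof.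
have [c c0 wc] := ws_weight_ge X; exists c^-1 => t.
have F0 (z : R[i]) : (0 <= (normc z ^+ 2)%:E)%E by rewrite lee_fin sqr_ge0.
rewrite EFinM -(tensor_parseval unit_delta_parseval unit_delta_parseval) /energy.
rewrite (@esum_pair _ _ _ (fun x y => (normc (dot t (pure (unit_delta x) (unit_delta y))) ^+ 2)%:E))//.
apply: (@le_trans _ _ (\esum_(x in [set: X]) (c^-1 *
    normc (dot t (pure (unit_delta x) (unit_delta x))) ^+ 2)%:E)%E).
  apply: le_esum => x _; rewrite lee_fin dotZr conjE conjc_real normcM normc_real exprMn.
  have [x0|/eqP x0] := eqVneq x (ws_base X).
    rewrite x0 ws_weight_base sqrtr0 invr0 normr0 expr0n mul0r.
    by rewrite mulr_ge0 ?sqr_ge0 ?invr_ge0 ?ltW.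
  apply: ler_wpM2r; first exact: sqr_ge0.
  rewrite real_normK ?num_real// exprVn sqr_sqrtr ?ws_weight_ge0//.
  by rewrite lef_pV2 ?posrE// ?wc// (lt_le_trans c0) ?wc.
rewrite esumZ ?invr_ge0 ?(ltW c0)//; apply: lee_wpmul2l.
  by rewrite lee_fin invr_ge0 ltW.
apply: le_esum => x _; apply: esum_ge; exists [set x].
  by split=> //; exact: finite_set1.
by rewrite fsbig_set1.
Qed.

Lemma ell2_muP : bounded_linear (@ell2_mu R X) /\
  forall u v x, ell2_mu (pure u v) x = u x * v x.
Proof.
apply: (@xgetPex _ (fun=> 0) [set m : htensor (ell2 X) (ell2 X) -> ell2 X | bounded_linear m /\ _]).
have [M cB] := diagonal_bessel.
have [U [Ub UE]] := operator_of_families cB unit_delta_parseval.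
exists U; split=> // u v x; rewrite (UE _ (ell2_mul u v))// => y.
rewrite dotZr conjE conjc_real dot_pure !dot_unit_delta.
rewrite -[(ell2_mul u v) y]/(u y * v y).
have [->|y0] := eqVneq (Num.sqrt (w y)) 0; first by rewrite invr0 !mul0r.
rewrite realcV; field.
by apply: contra_neq y0 => /complexI.
Qed.

Lemma ell2_mu_pure u v : ell2_mu (pure u v) = ell2_mul u v.
Proof. by apply: l2_ext => x; rewrite (ell2_muP.2). Qed.

Lemma ell2_conj_subproof u : (fun x => conjc (u x)) \in l2_mem w.
Proof.
rewrite unfold_in; apply: asboolT; split=> [x wx|]; first by rewrite l2_suppE// conjc0.
rewrite (eq_esum (b := fun x => (l2_term w u x)%:E)) -?l2_sqE ?ltry// => x _.
by rewrite /l2_term normcJ.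
Qed.

Definition ell2_conj u : ell2 X := L2 (ell2_conj_subproof u).

Lemma ell2_adj_mul u v :
  adj (fun z => ell2_mu (pure u z)) v = ell2_mul (ell2_conj u) v.
Proof.
apply: adjE => z; rewrite ell2_mu_pure.
change (csum (fun x => (w x)%:C * (u x * z x) * conjc (v x)) =
  csum (fun x => (w x)%:C * z x * conjc (conjc (u x) * v x))).
by congr csum; apply/funext => x; rewrite conjcM conjcK; ring.
Qed.

(** The adjoint of the multiplication by u is the multiplication by its complex
    conjugate. *)
Lemma ell2_is_frobsem : is_frobsem (@ell2_mu R X).
Proof.
apply: frobsem_of_adjoint_multiplier; first exact: (ell2_muP.1).
- by move=> u v z; rewrite !ell2_mu_pure; apply: l2_ext => x /=; rewrite mulrA.
- by move=> u v; rewrite !ell2_mu_pure; apply: l2_ext => x /=; rewrite mulrC.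
- move=> u v z; rewrite !ell2_adj_mul !ell2_mu_pure.
  by apply: l2_ext => x /=; rewrite mulrA.
Qed.

End ell2_frobenius.

Section ell2_grouplikes.
Context {R : realType}.
Implicit Types X Y : wset R.

Lemma ell2_factsP : ell2_facts R.
Proof. split=> X; [exact: (ell2_muP X).2|exact: ell2_is_frobsem]. Qed.

Local Notation ef := ell2_factsP.
Local Notation mf := Min_factsP.
Local Notation L X := (ell2_obj ef X).

Lemma ell2_mulE X (u v : L X) x : (fs_mul u v : ell2 X) x = (u : ell2 X) x * (v : ell2 X) x.
Proof. exact: ell2_muE ef X u v x. Qed.

(** The Riesz representer of the evaluation at x (dot_eval_at). *)
Definition eval_at X (x : X) : L X := ((ws_weight x)^-1)%:C *: (delta (@ws_weight R X) x : ell2 X).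

Lemma dot_eval_at X (u : L X) x : dot u (eval_at x) = (u : ell2 X) x.
Proof.
rewrite /eval_at dotZr conjE conjc_real [dot u _](dot_ell2_delta (u : ell2 X)) mulrA -realcM.
have [->|x0] := eqVneq x (ws_base X); first by rewrite !ell2_base mulr0.
by rewrite mulVf ?mul1r// gt_eqF// ws_weight_gt0.
Qed.

Lemma eval_at_grouplike0 X (x : X) : grouplike (eval_at x) \/ eval_at x = 0.
Proof. by apply/grouplike0P => u v; rewrite !dot_eval_at ell2_mulE. Qed.

Lemma eval_at_val X (x y : X) : x <> ws_base X ->
  (eval_at x : ell2 X) y = if y == x then ((ws_weight x)^-1)%:C else 0.
Proof.
move=> /eqP x0; rewrite /eval_at l2Z /= /delta_fun ws_weight_gt0 x0 andbT.
by case: eqP; rewrite ?mulr1 ?mulr0.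
Qed.

Lemma eval_at_base X : eval_at (ws_base X) = 0.
Proof. by rewrite /eval_at ws_weight_base invr0 scale0r. Qed.

Lemma eval_at_inj X : injective (@eval_at X).
Proof.
have aux (x y : X) : x <> ws_base X -> eval_at x = eval_at y -> x = y.
  move=> x0 xy; apply: contrapT => xy'.
  have y0 : y <> ws_base X.
    move=> y0; have := eval_at_val x x0; rewrite xy y0 eval_at_base eqxx => /esym/eqP.
    rewrite -[X in _ == X]/((0 : R)%:C) (inj_eq (@complexI R)) invr_eq0 gt_eqF// ws_weight_gt0.
    exact/eqP.
  have := eval_at_val x x0; rewrite xy eval_at_val// eqxx; case: eqP => // _ /esym/eqP.
  rewrite -[X in _ == X]/((0 : R)%:C) (inj_eq (@complexI R)) invr_eq0 gt_eqF// ws_weight_gt0.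
  exact/eqP.
move=> x y xy; have [x0|/eqP x0] := eqVneq x (ws_base X); last exact: aux.
have [y0|/eqP y0] := eqVneq y (ws_base X); first by rewrite x0 y0.
by apply/esym/aux.
Qed.

Lemma nrm_eval_at X (x : X) : nrm (eval_at x) ^- 2 = ws_weight x.
Proof.
have [->|/eqP x0] := eqVneq x (ws_base X).
  by rewrite eval_at_base nrm0 expr0n invr0 ws_weight_base.
by rewrite nrm2E dot_eval_at eval_at_val// eqxx /= invrK.
Qed.

(** If g does not vanish at x then it is not orthogonal to the evaluation there,
    and distinct group-like elements are orthogonal. *)
Lemma ell2_grouplike X (g : L X) : grouplike g -> exists x, g = eval_at x.
Proof.
move=> gg; have [x gx] : exists x, (g : ell2 X) x <> 0.
  apply: contrapT => none; have /eqP := grouplike_neq0 gg; apply; apply: l2_ext => x.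
  by apply: contrapT => gx; apply: none; exists x.
have x0 : x <> ws_base X by move=> x0; apply: gx; rewrite x0 ell2_base.
exists x; have ee : grouplike (eval_at x).
  have [//|/(congr1 (fun u : ell2 X => u x))] := eval_at_grouplike0 x.
  rewrite eval_at_val// eqxx => /eqP.
  rewrite -[X in _ == X]/((0 : R)%:C) (inj_eq (@complexI R)) invr_eq0 gt_eqF// ws_weight_gt0.
  exact/eqP.
have dge : dot g (eval_at x) != 0 by rewrite dot_eval_at; exact/eqP.
apply: contrapT => ne; move: dge; rewrite grouplike_orthogonal ?eqxx//.
Qed.

Lemma ell2_semisimple X : semisimple (L X).
Proof.
apply/seteqP; split=> [u /radicalE u0|_ ->] /=; last by apply/radicalE => g _; rewrite dot0l.
apply: l2_ext => x; rewrite -dot_eval_at.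
by have [/u0|->] := eval_at_grouplike0 x; rewrite ?dot0r.
Qed.

End ell2_grouplikes.

(** * The adjunction *)

Section adjunction.
Context {R : realType}.
Implicit Types (X Y : wset R) (H K : frobsem R).

Local Notation ef := (@ell2_factsP R).
Local Notation mf := (@Min_factsP R).
Local Notation mF := (@Min_functorialityP R).
Local Notation L X := (ell2_obj ef X).
Local Notation Mi H := (Min_obj mf H).

Lemma gelfand_subproof H (x : H) :
  (fun I : Mi H => dot x (gen I)) \in l2_mem (@ws_weight R (Mi H)).
Proof.
rewrite unfold_in; apply: asboolT; split=> [I|].
  by rewrite ws_weight_gt0 negbK => /eqP ->; rewrite gen0 dot0r.
rewrite (eq_esum (b := fun I => (normc (dot x (unit_gen I)) ^+ 2)%:E)); last first.
  by move=> I _; rewrite dot_unit_gen.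
by apply: le_lt_trans (@unit_gen_bessel R H x) _; rewrite ltry.
Qed.

(** The Gelfand transform, with the characters of H indexed by Min H. *)
Definition gelfand H (x : H) : L (Mi H) := L2 (gelfand_subproof x).

Lemma gelfand_bounded H : bounded_linear (@gelfand H).
Proof.
split=> [a x y|].
  by apply: l2_ext => I; rewrite l2D l2Z /= dotDl dotZl.
exists 1 => x; rewrite mul1r -ler_sqr ?nnegrE ?nrm_ge0// -lee_fin.
rewrite [(nrm (gelfand x) ^+ 2)%:E](nrm_ell2 (gelfand x : ell2 _)).
rewrite (eq_esum (b := fun I => (normc (dot x (unit_gen I)) ^+ 2)%:E)).
  by have := @unit_gen_bessel R H x; rewrite mul1r.
by move=> I _; rewrite dot_unit_gen.
Qed.

Lemma gelfand_hom H : is_fhom (@gelfand H).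
Proof.
split=> [|u v]; first exact: gelfand_bounded.
apply: l2_ext => I; rewrite ell2_mulE /=.
by have /grouplike0P := genP I; exact.
Qed.

Definition adj_unit_map H : fhom H (L (Mi H)) := FHom (@gelfand_hom H).

Lemma whom_of_injective X Y (f : X -> Y) : f (ws_base X) = ws_base Y -> injective f ->
  (forall x, ws_weight (f x) = ws_weight x) -> is_whom f.
Proof.
move=> fb fI fw; have fib y : f @^-1` [set y] = set0 \/
    exists x, f @^-1` [set y] = [set x] /\ f x = y.
  have [[x fx]|none] := pselect (exists x, f x = y); last first.
    by left; apply/seteqP; split=> // x fx; apply: none; exists x.
  right; exists x; split=> //; apply/seteqP; split=> [z /= fz|_ -> //].
  by apply: fI; rewrite fx fz.
split=> // [y _|]; first by have [->|[x [-> _]]] := fib y; [exact: finite_set0|exact: finite_set1].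
exists 1 => // y _; rewrite mul1r; have [->|[x [-> <-]]] := fib y.
  by rewrite fsbig_set0 ws_weight_ge0.
by rewrite fsbig_set1 fw.
Qed.

Definition counit_fun X (x : X) : Mi (L X) := Min0_of (eval_at_grouplike0 x).

Lemma gen_counit X (x : X) : gen (counit_fun x) = eval_at x.
Proof. exact: gen_Min0_of. Qed.

Lemma counit_inj X : injective (@counit_fun X).
Proof. by move=> x y xy; apply: eval_at_inj; rewrite -!gen_counit xy. Qed.

Lemma counit_base X : counit_fun (ws_base X) = ws_base (Mi (L X)).
Proof. by apply: gen_inj; rewrite gen_counit gen0 eval_at_base. Qed.

Lemma counit_weight X (x : X) : ws_weight (counit_fun x) = ws_weight x.
Proof. by rewrite -[LHS]/(nrm (gen (counit_fun x)) ^- 2) gen_counit nrm_eval_at. Qed.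

Lemma counit_surj X (I : Mi (L X)) : exists x, counit_fun x = I.
Proof.
have [/ell2_grouplike[x gx]|g0] := genP I.
  by exists x; apply: gen_inj; rewrite gen_counit.
by exists (ws_base X); apply: gen_inj; rewrite gen_counit eval_at_base.
Qed.

Definition adj_counit_map X : whom X (Mi (L X)) :=
  WHom (whom_of_injective (@counit_base X) (@counit_inj X) (@counit_weight X)).

Lemma counit_iso X : exists g : whom (Mi (L X)) X,
  @counit_fun X \o g =1 id /\ g \o @counit_fun X =1 id.
Proof.
have [g gK] := choice (@counit_surj X).
have gw : is_whom g.
  apply: whom_of_injective => [|I J IJ|I].
  - by apply: counit_inj; rewrite gK counit_base.
  - by rewrite -(gK I) IJ gK.
  - by rewrite -counit_weight gK.
by exists (WHom gw); split=> // x; apply: counit_inj; exact: gK.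
Qed.

Lemma gelfand_gen H (I : Mi H) : gelfand (gen I) = eval_at I.
Proof.
apply: l2_ext => J; rewrite -[LHS]/(dot (gen I) (gen J)).
have [I0|/eqP I0] := eqVneq I (ws_base (Mi H)); first by rewrite I0 gen0 dot0l eval_at_base.
rewrite eval_at_val//; have [->|/eqP JI] := eqVneq J I.
  by rewrite dotxx_nrm -[ws_weight I]/(nrm (gen I) ^- 2) invrK.
have [gJ|->] := genP J; last by rewrite dot0r.
apply: grouplike_orthogonal => //; first exact: gen_grouplike.
by move=> /gen_inj/esym.
Qed.

Lemma gelfandK H : cancel (adj (@gelfand H)) (@gelfand H).
Proof.
move=> y; apply: l2_ext => I; rewrite -[LHS]/(dot (adj (@gelfand H) y) (gen I)).
by rewrite -(adjP' (@gelfand_bounded H)) gelfand_gen dot_eval_at.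
Qed.

Lemma gelfand_inj H : semisimple H -> injective (@gelfand H).
Proof.
move=> ss x y xy; apply: (semisimple_ext ss) => g gg.
have := congr1 (fun u : L (Mi H) => (u : ell2 _) (Min0_of (or_introl gg))) xy.
by rewrite /= gen_Min0_of.
Qed.

(** The adjoint of the Gelfand transform is always a section of it, so only
    injectivity depends on semisimplicity. *)
Lemma gelfand_iso H : semisimple H -> exists g : fhom (L (Mi H)) H,
  g \o @gelfand H =1 id /\ @gelfand H \o g =1 id.
Proof.
move=> ss; have gI := gelfand_inj ss; have [gb gM] := gelfand_hom H.
have aM : is_fhom (adj (@gelfand H)).
  split=> [|u v]; first exact: adj_bounded gb.
  by apply: gI; rewrite gM !gelfandK.
exists (FHom aM); split=> [x|y]; last exact: gelfandK.
by apply: gI; exact: gelfandK.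
Qed.

Lemma adj_ell2_fun X Y (f : whom X Y) (x : X) :
  adj (ell2_fun f : L Y -> L X) (eval_at x) = eval_at (f x).
Proof. by apply: adjE => u; rewrite !dot_eval_at. Qed.

Program Definition Min_ell2_adjunction : adjunction (Min_functor mF) (ell2_functor ef) :=
  @Adjunction _ _ (Min_functor mF) (ell2_functor ef) adj_unit_map adj_counit_map _ _ _ _.
Next Obligation.
move=> H K f; apply: fhom_ext => x; apply: l2_ext => I.
have [fb _] := fhP f.
rewrite -[LHS]/(dot x (gen (Min_fun f I))) -[RHS]/(dot (f x) (gen I)).
by rewrite gen_Min_fun (adjP fb).
Qed.
Next Obligation.
move=> X Y f; apply: whom_ext => y; apply: gen_inj.
rewrite -[LHS]/(gen (counit_fun (f y))).
rewrite -[RHS]/(gen (Min_fun (FHom (ell2_fun_hom ef f)) (counit_fun y))).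
by rewrite gen_Min_fun !gen_counit adj_ell2_fun.
Qed.
Next Obligation.
move=> H; apply: whom_ext => I; apply: gen_inj.
rewrite -[LHS]/(gen (Min_fun (adj_unit_map H) (counit_fun I))) gen_Min_fun gen_counit.
by apply: adjE => x; rewrite dot_eval_at.
Qed.
Next Obligation.
move=> X; apply: fhom_ext => u; apply: l2_ext => x.
rewrite -[LHS]/(dot u (gen (counit_fun x))) gen_counit dot_eval_at.
by [].
Qed.

Lemma Min_ell2_equivalence (ss : forall X : op (WSet_pt R), semisimple (ell2_functor ef X)) :
  @adjoint_equivalence (FrobSem_ss R) (op (WSet_pt R))
    (restrict_dom (fun H : FrobSem_cat R => semisimple H) (Min_functor mF))
    (restrict_codom (P := fun H : FrobSem_cat R => semisimple H) ss)
    (restrict_adjunction ss Min_ell2_adjunction).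
Proof.
split=> [[H ssH]|X].
  have [g [gK Kg]] := gelfand_iso ssH.
  by exists g; split; apply: fhom_ext.
have [g [gK Kg]] := counit_iso X.
by exists g; split; apply: whom_ext.
Qed.

End adjunction.

(** * The finite-dimensional case *)

(** On objects the quasi-inverse is a choice of preimages up to isomorphism, and
    full faithfulness transports morphisms along the chosen isomorphisms. *)
Lemma equivalent_of_fully_faithful (C D : category) (G : functor D C) :
  (forall (b b' : D) (h : mor (G b) (G b')), exists! g : mor b b', fmor G g = h) ->
  (forall a : C, exists b : D, exists i : mor a (G b), is_iso i) ->
  equivalent C D.
Proof.
move=> ff es.
have [F0 hF0] := choice es.
pose i a : mor a (G (F0 a)) := projT1 (cid (hF0 a)).
have iP a : is_iso (i a) := projT2 (cid (hF0 a)).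
pose j a : mor (G (F0 a)) a := projT1 (cid (iP a)).
have jP a : cmp (j a) (i a) = idm a /\ cmp (i a) (j a) = idm (G (F0 a)) := projT2 (cid (iP a)).
have faithful (b b' : D) (g g' : mor b b') : fmor G g = fmor G g' -> g = g'.
  move=> gg'; have [g0 [_ u]] := ff _ _ (fmor G g').
  by rewrite -(u g gg') -(u g' erefl).
pose lift (b b' : D) (h : mor (G b) (G b')) : mor b b' := projT1 (cid (ff _ _ h)).
have liftE (b b' : D) (h : mor (G b) (G b')) : fmor G (lift _ _ h) = h.
  by have [] := projT2 (cid (ff _ _ h)).
pose F1 (a a' : C) (f : mor a a') := lift _ _ (cmp (i a') (cmp f (j a))).
have F11 a : F1 _ _ (idm a) = idm (F0 a).
  by apply: faithful; rewrite liftE fmor1 cmp1m (jP a).2.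
have F1M (a b c : C) (g : mor b c) (f : mor a b) : F1 _ _ (cmp g f) = cmp (F1 _ _ g) (F1 _ _ f).
  apply: faithful; rewrite fmorM !liftE -!cmpA; congr cmp; congr cmp.
  by rewrite cmpA (jP b).1 cmp1m.
pose F := Functor F11 F1M.
exists F, G, i, (fun b => lift _ _ (j (G b))); split.
- by move=> a a' f; rewrite /= liftE -!cmpA (jP a).1 cmpm1.
- move=> b b' f; apply: faithful; rewrite !fmorM !liftE.
  by rewrite !cmpA (jP (G b')).1 cmp1m.
- exact: iP.
- move=> b; exists (lift _ _ (i (G b))).
  by split; apply: faithful; rewrite fmorM !liftE fmor1; [exact: (jP (G b)).2|exact: (jP (G b)).1].
Qed.

Section finite_dimensional.
Context {R : realType}.

Local Notation ef := (@ell2_factsP R).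
Local Notation mf := (@Min_factsP R).
Local Notation L X := (ell2_obj ef X).
Local Notation Mi H := (Min_obj mf H).

(** The total weight of X and the lower bound c on the weights of Y give a uniform
    constant. *)
Lemma whom_of_finite (X Y : wset R) (f : X -> Y) : finite_set [set: X] ->
  f (ws_base X) = ws_base Y -> is_whom f.
Proof.
move=> finX fb; have [c c0 wc] := ws_weight_ge Y.
have finA (A : set X) : finite_set A by exact: sub_finite_set finX.
have w0 (x : X) : 0 <= ws_weight x by exact: ws_weight_ge0.
have S0 : 0 <= \sum_(x \in [set: X]) ws_weight x by by apply: fsumr_ge0 => *; exact: w0.
split=> //; exists ((\sum_(x \in [set: X]) ws_weight x) / c); first by rewrite divr_ge0 ?(ltW c0).
move=> y y0; apply: (@le_trans _ _ (\sum_(x \in [set: X]) ws_weight x)).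
  rewrite -lee_fin -!fsumEFin// -!esum_fset//; [|by move=> *; rewrite lee_fin..].
  rewrite esum_mkcond; apply: le_esum => x _.
  by case: ifP => _; rewrite lee_fin.
by rewrite -mulrA ler_peMr// ler_pdivlMl// mulr1 wc.
Qed.

Section counting_weight.
Context (X : finpset).

Definition counting_weight (x : X) : R := if x == fp_base X then 0 else 1.

Lemma counting_weight_base : counting_weight (fp_base X) = 0.
Proof. by rewrite /counting_weight eqxx. Qed.

Lemma counting_weight_ge : exists2 c : R, 0 < c &
  forall x : X, x <> fp_base X -> c <= counting_weight x.
Proof. by exists 1 => // x /eqP x0; rewrite /counting_weight (negPf x0). Qed.

Definition wset_of_finpset : wset R :=
  @WSet R X (fp_base X) counting_weight counting_weight_base counting_weight_ge.

Lemma finite_wset_of_finpset : finite_set [set: wset_of_finpset].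
Proof. exact: (@finite_finset X). Qed.

End counting_weight.
Local Notation W := wset_of_finpset.

Lemma whom_of_fphom (X Y : finpset) (f : fphom X Y) : @is_whom R (W X) (W Y) f.
Proof. by apply: whom_of_finite; [exact: finite_wset_of_finpset|exact: fph_base]. Qed.

Lemma finite_dim_of_enum (Y : wset R) (n : nat) (e : 'I_n -> Y) (r : Y -> 'I_n) :
  cancel e r -> cancel r e -> finite_dim (L Y).
Proof.
move=> eK rK; exists n, (fun k => eval_at (e k)) => u.
exists (fun k => (ws_weight (e k))%:C * (u : ell2 Y) (e k)); apply: l2_ext => y.
rewrite -!dot_eval_at dot_suml (bigD1 (r y))// big1 => [|k ky].
  rewrite [RHS]addr0 rK dotZl !dot_eval_at.
  have [->|/eqP y0] := eqVneq y (ws_base Y); first by rewrite !ell2_base !mulr0.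
  rewrite eval_at_val// eqxx mulrAC -realcM mulfV ?mul1r// gt_eqF// ws_weight_gt0.
  exact/eqP.
rewrite dotZl dot_eval_at.
have [k0|/eqP k0] := eqVneq (e k) (ws_base Y); first by rewrite k0 ell2_base mulr0 mul0r.
rewrite eval_at_val// ifN ?mulr0//; apply: contra_neq ky => ->.
by rewrite eK.
Qed.

Lemma ell2_finite_dim (X : finpset) : finite_dim (L (W X)).
Proof. exact: (@finite_dim_of_enum (W X) _ _ _ (@enum_valK X) (@enum_rankK X)). Qed.

(** A Gram matrix argument: m orthonormal vectors spanned by n vectors factor
    the identity matrix of size m through size n. *)
Lemma orthonormal_le_dim (H : hilbertType R) (n m : nat) (e : 'I_n -> H) (v : 'I_m -> H) :
  (forall x, exists c : 'I_n -> R[i], x = \sum_(i < n) c i *: e i) ->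
  (forall i j, dot (v i) (v j) = (i == j)%:R) -> (m <= n)%N.
Proof.
move=> span vO; have [c cE] := choice (fun i => span (v i)).
have : (\matrix_(i < m, k < n) c i k) *m (\matrix_(k < n, j < m) dot (e k) (v j)) = 1%:M.
  apply/matrixP => i j; rewrite !mxE -vO {1}(cE i) dot_suml.
  by apply: eq_bigr => k _; rewrite !mxE dotZl.
move=> /(congr1 mxrank); rewrite mxrank1 => <-.
exact: leq_trans (mxrankM_maxl _ _) (rank_leq_col _).
Qed.

Lemma finite_Min (H : frobsem R) : finite_dim H -> finite_set [set: Mi H].
Proof.
move=> [n [e span]].
rewrite (_ : [set: Mi H] = [set ws_base (Mi H)] `|` [set I | I <> ws_base (Mi H)]); last first.
  apply/seteqP; split=> // I _.
  by have [->|/eqP I0] := eqVneq I (ws_base (Mi H)); [left|right].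
rewrite finite_setU; split; first exact: finite_set1.
apply: contrapT => inf; have [F Fne nF] := infinite_set_fset n.+1 inf.
pose s := finmap.enum_fset F.
have us : uniq s by exact: finmap.fset_uniq.
have s0 I : I \in s -> I <> ws_base (Mi H) by move=> Is; exact: Fne.
pose v (k : 'I_(size s)) := unit_gen (nth (ws_base (Mi H)) s k).
suff : (size s <= n)%N by rewrite leqNgt nF.
have gk (k : 'I_(size s)) : grouplike (gen (nth (ws_base (Mi H)) s k)).
  by apply/gen_grouplike/s0/mem_nth.
apply: (orthonormal_le_dim span (v := v)) => k l; rewrite /v.
have [->|kl] := eqVneq k l.
  by rewrite dotxx_nrm normalized ?expr1n//; apply: grouplike_neq0.
rewrite /unit_gen dotZl dotZr grouplike_orthogonal ?mulr0//.
move=> /gen_inj/eqP; rewrite nth_uniq//; exact/negP.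
Qed.

(** Fullness: the adjoint of h maps the representers of evaluations to group-like
    elements or zero, that is, to representers of evaluations. *)
Lemma eval_at_of_adj (X Y : wset R) (h : fhom (L X) (L Y)) :
  exists f : Y -> X, f (ws_base Y) = ws_base X /\ forall y, adj h (eval_at y) = eval_at (f y).
Proof.
have hE y : exists x : X, adj h (eval_at y) = eval_at x.
  have [/ell2_grouplike//|->] := adj_grouplike0 h (eval_at_grouplike0 y).
  by exists (ws_base X); rewrite eval_at_base.
have [f fE] := choice hE.
exists f; split=> //; apply: eval_at_inj.
by rewrite -fE !eval_at_base adj0.
Qed.

Lemma ell2_fun_adj (X Y : wset R) (h : fhom (L X) (L Y)) (f : whom Y X) :
  (forall y, adj h (eval_at y) = eval_at (f y)) -> ell2_fun f =1 h.
Proof.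
move=> hf u; have [hb _] := fhP h; apply: l2_ext => y.
rewrite -[LHS]/((u : ell2 X) (f y)) -dot_eval_at -hf -(adjP hb).
exact: dot_eval_at.
Qed.

Lemma ell2_fun_inj (X Y : wset R) (f g : whom X Y) : ell2_fun f =1 ell2_fun g -> f =1 g.
Proof.
move=> fg x; apply: eval_at_inj; apply: (@dot_inj R (L Y)) => u; rewrite !dot_eval_at.
exact (congr1 (fun v : ell2 X => v x) (fg u)).
Qed.

Lemma is_fhom_ell2 (X Y : finpset) (f : fphom X Y) :
  @is_fhom R (L (W Y)) (L (W X)) (ell2_fun (WHom (whom_of_fphom f))).
Proof. exact: ell2_fun_hom. Qed.

Definition ell2_fd_obj (X : op FinSet_pt) : FrobSem_ss_fd R :=
  exist _ (L (W X)) (conj (@ell2_semisimple R (W X)) (ell2_finite_dim X)).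

Program Definition ell2_fd_functor : functor (op FinSet_pt) (FrobSem_ss_fd R) :=
  @Functor (op FinSet_pt) (FrobSem_ss_fd R) ell2_fd_obj
    (fun Y X f => FHom (is_fhom_ell2 f)) _ _.
Next Obligation. by move=> X; apply: fhom_ext => u; apply: l2_ext. Qed.
Next Obligation. by move=> X Y Z g f; apply: fhom_ext => u; apply: l2_ext. Qed.

Lemma FrobSem_ss_fd_equivalent : equivalent (FrobSem_ss_fd R) (op FinSet_pt).
Proof.
apply: (@equivalent_of_fully_faithful _ _ ell2_fd_functor).
- move=> Y X h; have [f [fb fE]] := eval_at_of_adj (h : fhom (L (W Y)) (L (W X))).
  exists (@FPHom X Y f fb); split.
    by apply: fhom_ext => u; apply: ell2_fun_adj.
  move=> g gh; apply: fphom_ext => x.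
  have := @ell2_fun_inj (W X) (W Y)
    (WHom (whom_of_fphom (@FPHom X Y f fb))) (WHom (whom_of_fphom g)).
  apply=> u; rewrite (@ell2_fun_adj (W Y) (W X) h)//.
  by have := congr1 (fun k : fhom (L (W Y)) (L (W X)) => k u) gh.
- move=> [H [ss fd]]; have fin := finite_Min fd.
  pose s := finmap.enum_fset (fset_set [set: Mi H]).
  have sT I : I \in s by rewrite in_fset_set// in_setT.
  pose X := @FinPSet (seq_sub s) (SeqSub (sT (ws_base (Mi H)))).
  have vw : @is_whom R (W X) (Mi H) (fun x => ssval (x : seq_sub s)).
    by apply: whom_of_finite => //; exact: finite_wset_of_finpset.
  have ww : @is_whom R (Mi H) (W X) (fun I => SeqSub (sT I)) by exact: whom_of_finite.
  have [g [gK Kg]] := gelfand_iso ss.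
  pose iota := FHom (ell2_fun_hom ef (WHom vw)).
  pose iota' := FHom (ell2_fun_hom ef (WHom ww)).
  exists X, (FHom (fhom_comp iota (adj_unit_map H))), (FHom (fhom_comp g iota')).
  split; apply: fhom_ext => u.
    rewrite -[RHS]gK -[LHS]/(g (iota' (iota (gelfand u)))); congr (g _).
    by apply: l2_ext.
  rewrite -[LHS]/(iota ((@gelfand R H \o g) (iota' u))) Kg.
  by apply: l2_ext => x; rewrite /=; congr (_ _); apply: val_inj.
Qed.

End finite_dimensional.

Theorem theorem56 (R : realType) :
  (exists (mf : Min_facts R) (mF : Min_functoriality mf) (ef : ell2_facts R)
          (A : adjunction (Min_functor mF) (ell2_functor ef))
          (ss : forall X : op (WSet_pt R), semisimple (ell2_functor ef X)),
     @adjoint_equivalence (FrobSem_ss R) (op (WSet_pt R))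
       (restrict_dom (fun H : FrobSem_cat R => semisimple H) (Min_functor mF))
       (restrict_codom (P := fun H : FrobSem_cat R => semisimple H) ss)
       (restrict_adjunction ss A)) /\
  equivalent (FrobSem_ss_fd R) (op FinSet_pt).
Proof.
split; last exact: FrobSem_ss_fd_equivalent.
exists (@Min_factsP R), (@Min_functorialityP R), (@ell2_factsP R).
exists (@Min_ell2_adjunction R), (@ell2_semisimple R).
exact: Min_ell2_equivalence.
Qed.
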